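(* Let $(X,\mathcal O)$ be a semi-separated finite space. Then the category $\mathrm{Qcoh}(X)$ of quasi-coherent $\mathcal O$-modules has enough flats: every quasi-coherent $\mathcal O$-module $\mathcal M$ admits a resolution $$\cdots\to\mathcal P^{-2}\to\mathcal P^{-1}\to\mathcal P^0\to\mathcal M\to0$$ by quasi-coherent and flat $\mathcal O$-modules.
   Context: A finite ringed space is a ringed space $(X,\mathcal O)$ whose underlying topological space $X$ is finite, $\mathcal O$ being a sheaf of commutative rings with unity. For $p\in X$ let $U_p$ be the smallest open subset containing $p$, and write $p\le q$ iff $U_p\supseteq U_q$. One has $\mathcal O_p=\mathcal O(U_p)$. An $\mathcal O$-module $\mathcal M$ is quasi-coherent iff the induced map $\mathcal M_p\otimes_{\mathcal O_p}\mathcal O_q\to\mathcal M_q$ is an isomorphism for all $p\le q$. A finite space is a finite ringed space such that all restriction maps $\mathcal O_p\to\mathcal O_q$ ($p\le q$) are flat. The product $X\times X$ has the product topology and the sheaf of rings with stalks $\mathcal O_{x}\otimes_{\mathbb Z}\mathcal O_{y}$. A finite space $(X,\mathcal O)$ is semi-separated if, for the diagonal morphism $\delta\colon X\to X\times X$, $\delta_*\mathcal O$ is quasi-coherent and $R^i\delta_*\mathcal O=0$ for all $i>0$. Equivalently: (a) $H^i(U_p\cap U_q,\mathcal O)=0$ for all $p,q\in X$ and $i>0$, and (b) $\mathcal O(U_p\cap U_q)\otimes_{\mathcal O_p}\mathcal O_{p'}\to\mathcal O(U_{p'}\cap U_q)$ is an isomorphism for all $p,q\in X$ and $p'\ge p$.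 *)

(* Defs.v *)
From HB Require Import structures.
From mathcomp Require Import all_boot all_algebra.
From mathcomp Require Import finmap.
From mathcomp Require Import boolp classical_sets functions cardinality filter topology.

Set Implicit Arguments.
Unset Strict Implicit.
Unset Printing Implicit Defensive.

Import GRing.Theory.
Local Open Scope quotient_scope.
Local Open Scope classical_set_scope.
Local Open Scope ring_scope.

Section Tensor.
Variables (R : comPzRingType) (M N : lmodType R).

(* Formal sums of pure tensors modulo the defining relations; the inverse of
   the class of (x, y) is the class of (- x, y). *)
Inductive tens_eq : seq (M * N) -> seq (M * N) -> Prop :=
| tens_refl s : tens_eq s s
| tens_sym s t : tens_eq s t -> tens_eq t s
| tens_trans s t u : tens_eq s t -> tens_eq t u -> tens_eq s u
| tens_cat s s' t t' : tens_eq s s' -> tens_eq t t' -> tens_eq (s ++ t) (s' ++ t')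
| tens_comm s t : tens_eq (s ++ t) (t ++ s)
| tens_addl x x' y : tens_eq [:: (x + x', y)] [:: (x, y); (x', y)]
| tens_addr x y y' : tens_eq [:: (x, y + y')] [:: (x, y); (x, y')]
| tens_scale a x y : tens_eq [:: (a *: x, y)] [:: (x, a *: y)]
| tens_zero y : tens_eq [:: (0, y)] [::].

Definition tens_eqb : rel (seq (M * N)) := fun s t => `[< tens_eq s t >].

Lemma tens_eqb_equiv : equiv_class_of tens_eqb.
Proof.
split=> [s|s t|t s u].
- by apply/asboolP; exact: tens_refl.
- by apply/asboolP/asboolP; exact: tens_sym.
- by move=> /asboolP st /asboolP tu; apply/asboolP; exact: tens_trans tu.
Qed.

Canonical tens_equiv := EquivRelPack tens_eqb_equiv.

Definition tensor : Type := {eq_quot tens_equiv}.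
HB.instance Definition _ : EqQuotient _ tens_equiv tensor := EqQuotient.on tensor.
HB.instance Definition _ := Choice.on tensor.

Definition tclass (s : seq (M * N)) : tensor := \pi_tensor s.
Definition tens (x : M) (y : N) : tensor := tclass [:: (x, y)].

Lemma tclassP s t : tclass s = tclass t <-> tens_eq s t.
Proof. by split=> [/eqmodP/asboolP//|st]; apply/eqmodP/asboolP. Qed.

Lemma tclassK t : tclass (repr t) = t.
Proof. exact: reprK. Qed.

Definition tadd (t u : tensor) := tclass (repr t ++ repr u).
Definition topp (t : tensor) := tclass [seq (- x.1, x.2) | x <- repr t].
Definition tscale a (t : tensor) := tclass [seq (a *: x.1, x.2) | x <- repr t].

Lemma repr_tclass s : tens_eq (repr (tclass s)) s.
Proof. by apply/tclassP; rewrite tclassK. Qed.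

Lemma taddE s t : tadd (tclass s) (tclass t) = tclass (s ++ t).
Proof. by apply/tclassP; apply: tens_cat; exact: repr_tclass. Qed.

Lemma tens_map (f : M -> M) :
  {morph f : x y / x + y} -> (forall a, {morph f : x / a *: x}) ->
  forall s t, tens_eq s t ->
  tens_eq [seq (f x.1, x.2) | x <- s] [seq (f x.1, x.2) | x <- t].
Proof.
move=> fD fZ s t; have f0 : f 0 = 0 by rewrite -(scale0r 0) fZ !scale0r.
elim=> {s t} [s|s t _|s t u _ ? _|s s' t t' _ ? _ ?|s t|x x' y|x y y'|a x y|y].
- exact: tens_refl.
- exact: tens_sym.
- exact: tens_trans.
- by rewrite !map_cat; exact: tens_cat.
- by rewrite !map_cat; exact: tens_comm.
- by rewrite /= fD; exact: tens_addl.
- exact: tens_addr.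
- by rewrite /= fZ; exact: tens_scale.
- by rewrite /= f0; exact: tens_zero.
Qed.

Lemma toppE s : topp (tclass s) = tclass [seq (- x.1, x.2) | x <- s].
Proof.
apply/tclassP/(@tens_map -%R); last exact: repr_tclass.
- by move=> x y; rewrite opprD.
- by move=> a x; rewrite scalerN.
Qed.

Lemma tscaleE a s : tscale a (tclass s) = tclass [seq (a *: x.1, x.2) | x <- s].
Proof.
apply/tclassP/(@tens_map ( *:%R a)); last exact: repr_tclass.
- by move=> x y; rewrite scalerDr.
- by move=> b x; rewrite !scalerA mulrC.
Qed.

Lemma tens_oppK s : tens_eq ([seq (- x.1, x.2) | x <- s] ++ s) [::].
Proof.
elim: s => [|[x y] s IH]; first exact: tens_refl.
have E t : tens_eq ((- x, y) :: t ++ (x, y) :: s)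
                   ([:: (- x, y); (x, y)] ++ (t ++ s)).
  rewrite -[_ :: t ++ _]/([:: (- x, y)] ++ (t ++ [:: (x, y)] ++ s)).
  rewrite -[[:: _; _] ++ _]/([:: (- x, y)] ++ ([:: (x, y)] ++ (t ++ s))).
  apply: tens_cat; first exact: tens_refl.
  by rewrite !catA; apply: tens_cat; [exact: tens_comm | exact: tens_refl].
apply: tens_trans (E _) _; rewrite -[[::]]/([::] ++ [::]).
apply: tens_cat => //; apply: tens_trans (tens_zero y).
by apply: tens_sym; rewrite -(addNr x); exact: tens_addl.
Qed.

Lemma taddA : associative tadd.
Proof.
move=> t u v; rewrite -(tclassK t) -(tclassK u) -(tclassK v).
by rewrite !taddE catA.
Qed.

Lemma taddC : commutative tadd.
Proof.
move=> t u; rewrite -(tclassK t) -(tclassK u) !taddE.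
by apply/tclassP; exact: tens_comm.
Qed.

Lemma tadd0 : left_id (tclass [::]) tadd.
Proof. by move=> t; rewrite -(tclassK t) taddE. Qed.

Lemma taddN : left_inverse (tclass [::]) topp tadd.
Proof.
move=> t; rewrite -(tclassK t) toppE taddE; apply/tclassP; exact: tens_oppK.
Qed.

HB.instance Definition _ := GRing.isZmodule.Build tensor taddA taddC tadd0 taddN.

Lemma tclass_cat s t : tclass (s ++ t) = tclass s + tclass t.
Proof. by rewrite -taddE. Qed.

Lemma tclassE s : tclass s = \sum_(x <- s) tens x.1 x.2.
Proof.
elim: s => [|[x y] s IH]; first by rewrite big_nil.
by rewrite big_cons -IH -tclass_cat.
Qed.

Lemma tensDl x x' y : tens (x + x') y = tens x y + tens x' y.
Proof. by rewrite -tclass_cat; apply/tclassP; exact: tens_addl. Qed.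

Lemma tensDr x y y' : tens x (y + y') = tens x y + tens x y'.
Proof. by rewrite -tclass_cat; apply/tclassP; exact: tens_addr. Qed.

Lemma tensZ a x y : tens (a *: x) y = tens x (a *: y).
Proof. by apply/tclassP; exact: tens_scale. Qed.

Lemma tens0l y : tens 0 y = 0.
Proof. by apply/tclassP; exact: tens_zero. Qed.

Lemma tens0r x : tens x 0 = 0.
Proof. by rewrite -(scale0r 0) -tensZ scale0r tens0l. Qed.

Lemma tensor_ind (P : tensor -> Prop) :
  P 0 -> (forall t u, P t -> P u -> P (t + u)) -> (forall x y, P (tens x y)) ->
  forall t, P t.
Proof.
move=> P0 PD Pt t; rewrite -(tclassK t) tclassE.
by elim: (repr t) => [|x s IH]; rewrite ?big_nil ?big_cons //; apply: PD.
Qed.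

Lemma tscaleD a : {morph tscale a : t u / t + u}.
Proof.
move=> t u; rewrite -(tclassK t) -(tclassK u) -tclass_cat !tscaleE.
by rewrite map_cat tclass_cat.
Qed.

Lemma tscale0 a : tscale a 0 = 0.
Proof. exact: (tscaleE a [::]). Qed.

Lemma tscale_tens a x y : tscale a (tens x y) = tens (a *: x) y.
Proof. by rewrite tscaleE. Qed.

Lemma tscaleA a b t : tscale a (tscale b t) = tscale (a * b) t.
Proof.
elim/tensor_ind: t => [|t u IHt IHu|x y]; first by rewrite !tscale0.
  by rewrite !tscaleD IHt IHu.
by rewrite !tscale_tens scalerA.
Qed.

Lemma tscale1 : left_id 1 tscale.
Proof.
elim/tensor_ind=> [|t u IHt IHu|x y]; first by rewrite !tscale0.
  by rewrite !tscaleD IHt IHu.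
by rewrite !tscale_tens scale1r.
Qed.

Lemma tscaleDl t : {morph tscale^~ t : a b / a + b}.
Proof.
move=> a b; elim/tensor_ind: t => [|t u IHt IHu|x y].
- by rewrite !tscale0 addr0.
- by rewrite !tscaleD IHt IHu addrACA.
- by rewrite !tscale_tens scalerDl tensDl.
Qed.

HB.instance Definition _ :=
  GRing.Zmodule_isLmodule.Build R tensor tscaleA tscale1 tscaleD tscaleDl.

Lemma tensZl a x y : a *: tens x y = tens (a *: x) y.
Proof. exact: tscale_tens. Qed.

Lemma tensZr a x y : a *: tens x y = tens x (a *: y).
Proof. by rewrite tensZl tensZ. Qed.

Section Lift.
Variable P : zmodType.

Definition balanced (f : M -> N -> P) : Prop :=
  [/\ forall y, {morph f^~ y : x x' / x + x'},
      forall x, {morph f x : y y' / y + y'} &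
      forall a x y, f (a *: x) y = f x (a *: y)].

(* Meaningful when f is balanced: see tensor_liftE. *)
Definition tensor_lift (f : M -> N -> P) (t : tensor) : P :=
  \sum_(x <- repr t) f x.1 x.2.

Variables (f : M -> N -> P) (f_bal : balanced f).

Lemma tensor_lift_class s :
  tensor_lift f (tclass s) = \sum_(x <- s) f x.1 x.2.
Proof.
have [fDl fDr fZ] := f_bal; move: (repr_tclass s).
rewrite /tensor_lift; set r := repr _; move: r => r.
elim=> {s r} // [s t u _ -> _ -> //|s s' t t' _ IH _ IH'|s t|x x' y|x y y'|a x y|y];
  rewrite ?big_cat ?big_cons ?big_nil /= ?addr0 ?fDl ?fDr ?fZ ?IH ?IH' //.
- by rewrite addrC.
- by apply: (addrI (f 0 y)); rewrite -fDl !addr0.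
Qed.

Lemma tensor_liftE x y : tensor_lift f (tens x y) = f x y.
Proof. by rewrite tensor_lift_class big_seq1. Qed.

Lemma tensor_liftD : {morph tensor_lift f : t u / t + u}.
Proof.
move=> t u; rewrite -(tclassK t) -(tclassK u) -tclass_cat !tensor_lift_class.
by rewrite big_cat.
Qed.

Lemma tensor_lift0 : tensor_lift f 0 = 0.
Proof. by rewrite (tensor_lift_class [::]) big_nil. Qed.

End Lift.
End Tensor.

Section Map.
Variables (R : comPzRingType) (M N N' : lmodType R) (f : {linear N -> N'}).

(* id (x) f: see tensor_mapE. *)
Definition tensor_map : tensor M N -> tensor M N' :=
  tensor_lift (fun x y => tens x (f y)).

Lemma tensor_map_balanced : balanced (fun (x : M) y => tens x (f y)).
Proof.
split=> [y x x'|x y y'|a x y]; first by rewrite tensDl.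
- by rewrite raddfD tensDr.
- by rewrite linearZ tensZ.
Qed.

Lemma tensor_mapE x y : tensor_map (tens x y) = tens x (f y).
Proof. exact: tensor_liftE tensor_map_balanced _ _. Qed.

End Map.

Definition flat_module (R : comPzRingType) (M : lmodType R) : Prop :=
  forall (N N' : lmodType R) (f : {linear N -> N'}),
    injective f -> injective (tensor_map (M := M) f).

(* M seen as an A-module through phi : A -> B. *)
Definition restrict_scalars (A B : pzRingType) (phi : {rmorphism A -> B})
  (M : lmodType B) : Type := M.

Section RestrictScalars.
Variables (A B : pzRingType) (phi : {rmorphism A -> B}) (M : lmodType B).

HB.instance Definition _ := GRing.Zmodule.on (restrict_scalars phi M).

Fact rscaleA (a b : A) (x : M) : phi a *: (phi b *: x) = phi (a * b) *: x.
Proof. by rewrite scalerA rmorphM. Qed.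
Fact rscale1 (x : M) : phi 1 *: x = x.
Proof. by rewrite rmorph1 scale1r. Qed.
Fact rscaleDr (a : A) : {morph (fun x : M => phi a *: x) : x y / x + y}.
Proof. exact: scalerDr. Qed.
Fact rscaleDl (x : M) : {morph (fun a : A => phi a *: x) : a b / a + b}.
Proof. by move=> a b; rewrite rmorphD scalerDl. Qed.

HB.instance Definition _ := @GRing.Zmodule_isLmodule.Build A
  (restrict_scalars phi M) (fun a x => phi a *: (x : M))
  rscaleA rscale1 rscaleDr rscaleDl.
End RestrictScalars.

Definition flat_morphism (A B : comPzRingType) (phi : {rmorphism A -> B}) : Prop :=
  flat_module (restrict_scalars phi B^o).

Section BaseChange.
Variables (A B : comPzRingType) (phi : {rmorphism A -> B}).
Variables (M : lmodType A) (N : lmodType B) (f : {linear M -> N | phi \; *:%R}).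

(* The B-linear map M (x)_A B -> N, x (x) b |-> b f(x), induced by the
   phi-semilinear map f: see base_changeE. *)
Definition base_change : tensor M (restrict_scalars phi B^o) -> N :=
  tensor_lift (fun (x : M) (b : restrict_scalars phi B^o) => (b : B) *: f x).

Lemma base_change_balanced :
  balanced (fun (x : M) (b : restrict_scalars phi B^o) => (b : B) *: f x).
Proof.
split=> [b x x'|x b b'|a x b]; first by rewrite raddfD scalerDr.
- exact: scalerDl.
- by rewrite linearZ /= scalerA mulrC.
Qed.

Lemma base_changeE x (b : restrict_scalars phi B^o) : base_change (tens x b) = (b : B) *: f x.
Proof. exact: tensor_liftE base_change_balanced _ _. Qed.

End BaseChange.

(* The ring A (x)_Z B; zmodule A is A seen as a Z-module. *)
Definition tensor_ring (A B : comPzRingType) : Type :=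
  tensor (zmodule A) (zmodule B).

Section TensorRing.
Variables A B : comPzRingType.
Implicit Types t u v : tensor_ring A B.

HB.instance Definition _ := GRing.Zmodule.on (tensor_ring A B).

Definition rtens (a : A) (b : B) : tensor_ring A B :=
  tens (a : zmodule A) (b : zmodule B).

Lemma rtensDl a a' b : rtens (a + a') b = rtens a b + rtens a' b.
Proof. exact: tensDl. Qed.
Lemma rtensDr a b b' : rtens a (b + b') = rtens a b + rtens a b'.
Proof. exact: tensDr. Qed.
Lemma rtensMz a b (n : int) : rtens (a *~ n) b = rtens a (b *~ n).
Proof. exact: (tensZ n (a : zmodule A) (b : zmodule B)). Qed.

Lemma tensor_ring_ind (P : tensor_ring A B -> Prop) :
  P 0 -> (forall t u, P t -> P u -> P (t + u)) -> (forall a b, P (rtens a b)) ->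
  forall t, P t.
Proof. exact: tensor_ind. Qed.

Definition rmulr_by (a : A) (b : B) : tensor_ring A B -> tensor_ring A B :=
  tensor_lift (fun (a' : zmodule A) (b' : zmodule B) =>
    rtens (a * (a' : A)) (b * (b' : B))).

Definition tmul t u : tensor_ring A B :=
  tensor_lift (fun (a : zmodule A) (b : zmodule B) => rmulr_by a b u) t.

Lemma rmulr_by_balanced a b : balanced
  (fun (a' : zmodule A) (b' : zmodule B) => rtens (a * (a' : A)) (b * (b' : B))).
Proof.
split=> [y x x'|x y y'|n x y] /=.
- by rewrite -rtensDl -mulrDr.
- by rewrite -rtensDr -mulrDr.
- have -> : a * ((n *: x : zmodule A) : A) = (a * (x : A)) *~ n by exact: mulrzAr.
  by rewrite rtensMz -mulrzAr.
Qed.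

Lemma tmul_balanced u :
  balanced (fun (a : zmodule A) (b : zmodule B) => rmulr_by a b u).
Proof.
have rD a b := tensor_liftD (rmulr_by_balanced a b).
have r0 a b := tensor_lift0 (rmulr_by_balanced a b).
have rE a b := tensor_liftE (rmulr_by_balanced a b).
split=> [b a a'|a b b'|n a b]; elim/tensor_ring_ind: u => [|u v IHu IHv|c d].
- by rewrite /rmulr_by !r0 addr0.
- rewrite /rmulr_by !rD addrACA; congr (_ + _); [exact: IHu | exact: IHv].
- by rewrite /rmulr_by !rE -rtensDl -mulrDl.
- by rewrite /rmulr_by !r0 addr0.
- rewrite /rmulr_by !rD addrACA; congr (_ + _); [exact: IHu | exact: IHv].
- by rewrite /rmulr_by !rE -rtensDr -mulrDl.
- by rewrite /rmulr_by !r0.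
- rewrite /rmulr_by !rD; congr (_ + _); [exact: IHu | exact: IHv].
- rewrite /rmulr_by !rE.
  have -> : ((n *: a : zmodule A) : A) * c = (a * c) *~ n by exact: mulrzAl.
  by rewrite rtensMz -mulrzAl.
Qed.

Lemma tmul_rtens a b a' b' :
  tmul (rtens a b) (rtens a' b') = rtens (a * a') (b * b').
Proof.
rewrite /tmul (tensor_liftE (tmul_balanced _)).
exact: (tensor_liftE (rmulr_by_balanced a b)).
Qed.

Lemma tmulDl : left_distributive tmul +%R.
Proof. by move=> t u v; exact: tensor_liftD (tmul_balanced v) t u. Qed.

Lemma tmul0t t : tmul 0 t = 0.
Proof. exact: tensor_lift0 (tmul_balanced t). Qed.

Lemma rtens_mulD a b t u :
  tmul (rtens a b) (t + u) = tmul (rtens a b) t + tmul (rtens a b) u.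
Proof.
rewrite /tmul !(tensor_liftE (tmul_balanced _)).
exact: tensor_liftD (rmulr_by_balanced a b) t u.
Qed.

Lemma rtens_mul0 a b : tmul (rtens a b) 0 = 0.
Proof.
rewrite /tmul (tensor_liftE (tmul_balanced _)).
exact: tensor_lift0 (rmulr_by_balanced a b).
Qed.

Lemma tmulC : commutative tmul.
Proof.
have m0 t : tmul t 0 = 0.
  elim/tensor_ring_ind: t => [|t u IHt IHu|a b]; rewrite ?tmul0t ?rtens_mul0 //.
  by rewrite tmulDl IHt IHu addr0.
move=> t u; elim/tensor_ring_ind: t => [|t v IHt IHv|a b].
- by rewrite tmul0t m0.
- rewrite tmulDl IHt IHv; elim/tensor_ring_ind: u {IHt IHv} => [|u w IHu IHw|c d].
  + by rewrite !tmul0t addr0.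
  + by rewrite !tmulDl addrACA IHu IHw.
  + by rewrite rtens_mulD.
- elim/tensor_ring_ind: u => [|u w IHu IHw|c d].
  + by rewrite tmul0t m0.
  + by rewrite tmulDl rtens_mulD IHu IHw.
  + by rewrite !tmul_rtens mulrC [b * d]mulrC.
Qed.

Lemma tmulDr : right_distributive tmul +%R.
Proof. by move=> t u v; rewrite tmulC tmulDl ![tmul _ t]tmulC. Qed.

Lemma tmulA : associative tmul.
Proof.
have m0 t : tmul t 0 = 0 by rewrite tmulC tmul0t.
move=> t u v; elim/tensor_ring_ind: t => [|t t' IH IH'|a b].
- by rewrite !tmul0t.
- by rewrite !tmulDl IH IH'.
elim/tensor_ring_ind: u => [|u u' IH IH'|c d].
- by rewrite !(m0, tmul0t).
- by rewrite !(tmulDl, tmulDr) IH IH'.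
elim/tensor_ring_ind: v => [|v v' IH IH'|e f].
- by rewrite !m0.
- by rewrite !tmulDr IH IH'.
- by rewrite !tmul_rtens !mulrA.
Qed.

Lemma tmul1 : left_id (rtens 1 1) tmul.
Proof.
elim/tensor_ring_ind=> [|t u IHt IHu|a b].
- by rewrite tmulC tmul0t.
- by rewrite tmulDr IHt IHu.
- by rewrite tmul_rtens !mul1r.
Qed.

HB.instance Definition _ := GRing.Zmodule_isComPzRing.Build (tensor_ring A B)
  tmulA tmulC tmul1 tmulDl.

Lemma rtensM a b a' b' : rtens a b * rtens a' b' = rtens (a * a') (b * b').
Proof. exact: tmul_rtens. Qed.

Lemma rtens1 : rtens 1 1 = 1. Proof. by []. Qed.

End TensorRing.

Section TensorRingLift.
Variables (A B C : comPzRingType).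
Variables (f : {rmorphism A -> C}) (g : {rmorphism B -> C}).

Definition tensor_ring_lift : tensor_ring A B -> C :=
  tensor_lift (fun (a : zmodule A) (b : zmodule B) => f a * g b).

Lemma tensor_ring_lift_balanced :
  balanced (fun (a : zmodule A) (b : zmodule B) => f a * g b).
Proof.
split=> [b a a'|a b b'|n a b].
- by rewrite -mulrDl -rmorphD.
- by rewrite -mulrDr -rmorphD.
- have -> : f (n *: a : zmodule A) = f a *~ n by exact: rmorphMz.
  have -> : g (n *: b : zmodule B) = g b *~ n by exact: rmorphMz.
  by rewrite mulrzAl mulrzAr.
Qed.

Lemma tensor_ring_liftE a b : tensor_ring_lift (rtens a b) = f a * g b.
Proof. exact: tensor_liftE tensor_ring_lift_balanced _ _. Qed.

Lemma tensor_ring_lift_additive : zmod_morphism tensor_ring_lift.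
Proof.
have lD := tensor_liftD tensor_ring_lift_balanced.
move=> t u; apply: (addIr (tensor_ring_lift u)).
by rewrite subrK -[LHS]lD subrK.
Qed.

HB.instance Definition _ :=
  GRing.isZmodMorphism.Build _ _ tensor_ring_lift tensor_ring_lift_additive.

Lemma tensor_ring_lift_multiplicative : monoid_morphism tensor_ring_lift.
Proof.
split=> [|t u]; first by rewrite -rtens1 tensor_ring_liftE !rmorph1 mulr1.
elim/tensor_ring_ind: t => [|t v IHt IHv|a b].
- by rewrite mul0r raddf0 mul0r.
- by rewrite mulrDl !raddfD /= IHt IHv mulrDl.
elim/tensor_ring_ind: u => [|u v IHu IHv|c d].
- by rewrite mulr0 raddf0 mulr0.
- by rewrite mulrDr !raddfD /= IHu IHv mulrDr.
- by rewrite rtensM !tensor_ring_liftE !rmorphM mulrACA.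
Qed.

HB.instance Definition _ :=
  GRing.isMonoidMorphism.Build _ _ tensor_ring_lift tensor_ring_lift_multiplicative.
End TensorRingLift.

Section TensorRingMap.
Variables A B : comPzRingType.

Definition rtensl (a : A) : tensor_ring A B := rtens a 1.
Definition rtensr (b : B) : tensor_ring A B := rtens 1 b.

Lemma rtensl_zmod : zmod_morphism rtensl.
Proof.
by move=> a a'; apply/eqP; rewrite -subr_eq opprK -rtensDl subrK.
Qed.
Lemma rtensr_zmod : zmod_morphism rtensr.
Proof.
by move=> b b'; apply/eqP; rewrite -subr_eq opprK -rtensDr subrK.
Qed.
Lemma rtensl_monoid : monoid_morphism rtensl.
Proof. by split=> // a a'; rewrite /rtensl rtensM mulr1. Qed.
Lemma rtensr_monoid : monoid_morphism rtensr.
Proof. by split=> // b b'; rewrite /rtensr rtensM mulr1. Qed.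

HB.instance Definition _ := GRing.isZmodMorphism.Build _ _ rtensl rtensl_zmod.
HB.instance Definition _ := GRing.isZmodMorphism.Build _ _ rtensr rtensr_zmod.
HB.instance Definition _ := GRing.isMonoidMorphism.Build _ _ rtensl rtensl_monoid.
HB.instance Definition _ := GRing.isMonoidMorphism.Build _ _ rtensr rtensr_monoid.
End TensorRingMap.

Definition tensor_ring_map (A A' B B' : comPzRingType)
    (f : {rmorphism A -> A'}) (g : {rmorphism B -> B'}) :
    {rmorphism tensor_ring A B -> tensor_ring A' B'} :=
  tensor_ring_lift (@rtensl A' B' \o f) (@rtensr A' B' \o g).

Lemma tensor_ring_mapE (A A' B B' : comPzRingType)
    (f : {rmorphism A -> A'}) (g : {rmorphism B -> B'}) a b :
  tensor_ring_map f g (rtens a b) = rtens (f a) (g b).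
Proof.
by rewrite [LHS]tensor_ring_liftE /= rtensM mulr1 mul1r.
Qed.

Record finTopology := FinTopology {
  fin_space :> topologicalType;
  fin_spaceP : finite_set [set: fin_space]
}.

Record opens (X : topologicalType) := Opens {
  oset :> set X;
  osetP : open oset
}.

Lemma opens_ext (X : topologicalType) (U V : opens X) :
  (U : set X) = V -> U = V.
Proof.
by case: U V => [U oU] [V oV] /= E; move: oU; rewrite E => oU; congr Opens; exact: Prop_irrelevance.
Qed.

Definition opensI (X : topologicalType) (U V : opens X) : opens X :=
  Opens (openI (osetP U) (osetP V)).

Definition opreim (X Y : topologicalType) (f : X -> Y) (cf : continuous f)
    (U : opens Y) : opens X :=
  Opens (open_comp (fun x _ => cf x) (osetP U)).

(* The smallest open neighbourhood U_p and the specialization preorder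
   p <= q iff U_q is contained in U_p. No T0 assumption: this need not be an
   order. *)
Section MinimalOpen.
Variable X : finTopology.
Implicit Types p q : X.

Lemma open_min_nbhd p : open (\bigcap_(U in [set U : set X | open U /\ U p]) U).
Proof.
set D := \bigcap_(_ in _) _.
have /choice [V VP] q : exists V : set X, [/\ open V, V p & ~ D q -> ~ V q].
  have [Dq|nDq] := pselect (D q).
    by exists setT; split=> //; exact: openT.
  suff [V [oV Vp nVq]] : exists V : set X, [/\ open V, V p & ~ V q] by exists V.
  apply: contrapT => nV; apply: nDq => V [oV Vp].
  by apply: contrapT => nVq; apply: nV; exists V.
have /finite_fsetP [F FE] := fin_spaceP X.
rewrite openE => x Dx; rewrite /interior.
have : nbhs x (\bigcap_(q in [set` F]) V q).
  apply: filter_bigI => q _; have [oV Vp _] := VP q.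
  by apply: open_nbhs_nbhs; split=> //; exact: Dx.
apply: filterS => y Vy; apply: contrapT => nDy.
have [_ _ /(_ nDy)] := VP y; apply; apply: Vy.
by rewrite -FE.
Qed.

Definition min_open p : opens X := Opens (open_min_nbhd p).

Definition spec_le p q : Prop := min_open q `<=` min_open p.

Lemma min_open_refl p : oset (min_open p) p.
Proof. by move=> U []. Qed.

Lemma min_open_sub p (U : opens X) : oset U p -> min_open p `<=` U.
Proof. by move=> Up x; apply; split=> //; exact: osetP. Qed.

Lemma spec_leP p q : spec_le p q <-> oset (min_open p) q.
Proof.
by split=> [|pq]; [apply; exact: min_open_refl | exact: min_open_sub].
Qed.

Lemma spec_le_refl p : spec_le p p.
Proof. by []. Qed.

Lemma spec_le_trans p q r : spec_le p q -> spec_le q r -> spec_le p r.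
Proof. by move=> pq qr; exact: subset_trans pq. Qed.
End MinimalOpen.

Section Sheaf.
Variables (X : topologicalType) (F : opens X -> Type).
Variable res : forall U V : opens X, V `<=` U -> F U -> F V.

(* Existence and uniqueness of gluing; I may be empty, so F is a singleton on
   the empty open set. *)
Definition sheaf_axiom : Prop :=
  forall (U : opens X) (I : Type) (W : I -> opens X)
         (sWU : forall i, W i `<=` U) (s : forall i, F (W i)),
    U `<=` \bigcup_i W i ->
    (forall i j, res (U := W i) (V := opensI (W i) (W j)) (@subIsetl _ _ _) (s i)
               = res (U := W j) (V := opensI (W i) (W j)) (@subIsetr _ _ _) (s j)) ->
    exists! t : F U, forall i, res (sWU i) t = s i.
End Sheaf.

Record finRingedSpace := FinRingedSpace {
  space :> finTopology;
  osec : opens space -> comPzRingType;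
  ores : forall U V : opens space, V `<=` U -> {rmorphism osec U -> osec V};
  ores_id : forall (U : opens space) (sUU : U `<=` U) s, ores sUU s = s;
  ores_comp : forall (U V W : opens space) (sVU : V `<=` U) (sWV : W `<=` V)
    (sWU : W `<=` U) s, ores sWV (ores sVU s) = ores sWU s;
  ores_sheaf : sheaf_axiom (fun U V sVU => ores (U := U) (V := V) sVU)
}.

Arguments osec : clear implicits.

(* On a finite space the colimit defining the stalk at p is attained at U_p. *)
Definition stalk (X : finRingedSpace) (p : X) : comPzRingType :=
  osec X (min_open p).

Record omodule (X : finRingedSpace) := OModule {
  msec : forall U : opens X, lmodType (osec X U);
  mres : forall (U V : opens X) (sVU : V `<=` U),
    {linear msec U -> msec V | ores sVU \; *:%R};
  mres_id : forall (U : opens X) (sUU : U `<=` U) s, mres sUU s = s;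
  mres_comp : forall (U V W : opens X) (sVU : V `<=` U) (sWV : W `<=` V)
    (sWU : W `<=` U) s, mres sWV (mres sVU s) = mres sWU s;
  mres_sheaf : sheaf_axiom (fun U V sVU => mres (U := U) (V := V) sVU)
}.

Definition mstalk (X : finRingedSpace) (M : omodule X) (p : X) :
  lmodType (stalk p) := msec M (min_open p).

Record ohom (X : finRingedSpace) (M N : omodule X) := OHom {
  hsec :> forall U : opens X, {linear msec M U -> msec N U};
  hsec_res : forall (U V : opens X) (sVU : V `<=` U) s,
    hsec V (mres M sVU s) = mres N sVU (hsec U s)
}.

(* Every restriction map O_p -> O_q, p <= q, is flat. *)
Definition finite_space (X : finRingedSpace) : Prop :=
  forall (p q : X) (pq : spec_le p q), flat_morphism (ores pq).

Definition quasi_coherent (X : finRingedSpace) (M : omodule X) : Prop :=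
  forall (p q : X) (pq : spec_le p q), bijective (base_change (mres M pq)).

Definition flat_omodule (X : finRingedSpace) (M : omodule X) : Prop :=
  forall p : X, flat_module (mstalk M p).

Section SheafGlue.
Variables (X : finTopology) (F : opens X -> Type).
Variable res : forall U V : opens X, V `<=` U -> F U -> F V.
Hypothesis res_comp : forall (U V W : opens X) (sVU : V `<=` U) (sWV : W `<=` V)
  (sWU : W `<=` U) s, res sWV (res sVU s) = res sWU s.
Hypothesis res_sheaf : sheaf_axiom res.

Lemma sheaf_local (U : opens X) (s t : F U) :
  (forall p (Up : oset U p),
     res (min_open_sub Up) s = res (min_open_sub Up) t) -> s = t.
Proof.
move=> st.
have [||u [_ uU]] := @res_sheaf U {p : X | oset U p} (fun i => min_open (sval i))
    (fun i => min_open_sub (proj2_sig i)) (fun i => res (min_open_sub (proj2_sig i)) s).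
- by move=> p Up; exists (exist _ p Up) => //; exact: min_open_refl.
- move=> i j.
  have sVU : opensI (min_open (sval i)) (min_open (sval j)) `<=` U.
    by move=> p [/= + _]; exact: (min_open_sub (proj2_sig i)).
  exact: etrans (res_comp _ _ sVU _) (esym (res_comp _ _ sVU _)).
by rewrite -(uU s) // -(uU t) // => i; rewrite st.
Qed.

Lemma sheaf_glue (U : opens X) (e : forall p, oset U p -> F (min_open p)) :
  (forall p q (pq : spec_le p q) (Up : oset U p) (Uq : oset U q),
     res pq (e p Up) = e q Uq) ->
  exists! t : F U, forall p (Up : oset U p), res (min_open_sub Up) t = e p Up.
Proof.
move=> ec.
have [||t [tE tU]] := @res_sheaf U {p : X | oset U p} (fun i => min_open (sval i))
    (fun i => min_open_sub (proj2_sig i)) (fun i => e (sval i) (proj2_sig i)).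
- by move=> p Up; exists (exist _ p Up) => //; exact: min_open_refl.
- move=> [p Up] [q Uq] /=; apply: sheaf_local => r pqr.
  have [pr qr] : oset (min_open p) r /\ oset (min_open q) r := pqr.
  have Ur : oset U r by exact: min_open_sub Up _ pr.
  rewrite (res_comp _ _ (min_open_sub pr)) (res_comp _ _ (min_open_sub qr)).
  by rewrite (ec _ _ _ _ Ur) (ec _ _ _ _ Ur).
exists t; split=> [p Up|t' t'E]; first exact: (tE (exist _ p Up)).
by apply: tU => -[p Up] /=; exact: t'E.
Qed.
End SheafGlue.

Section StructureModule.
Variable X : finRingedSpace.

Definition oreg_res (U V : opens X) (sVU : V `<=` U) :
  (osec X U)^o -> (osec X V)^o := ores sVU.

Lemma oreg_res_linear (U V : opens X) (sVU : V `<=` U) :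
  linear_for (ores sVU \; *:%R) (oreg_res sVU).
Proof. by move=> a s t; rewrite /oreg_res rmorphD rmorphM. Qed.

HB.instance Definition _ (U V : opens X) (sVU : V `<=` U) :=
  GRing.isLinear.Build (osec X U) (osec X U)^o (osec X V)^o
    (ores sVU \; *:%R) (oreg_res sVU) (oreg_res_linear sVU).

Definition structure_module : omodule X :=
  @OModule X (fun U => (osec X U)^o) (fun U V sVU => oreg_res sVU)
    (@ores_id X) (@ores_comp X) (@ores_sheaf X).
End StructureModule.

Section Morphisms.
Variables X Y : finRingedSpace.

Record ringed_map := RingedMap {
  rfun :> X -> Y;
  rfun_continuous : continuous rfun;
  rcomorph : forall V : opens Y,
    {rmorphism osec Y V -> osec X (opreim rfun_continuous V)};
  rcomorph_res : forall (U V : opens Y) (sVU : V `<=` U) s,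
    rcomorph V (ores sVU s)
    = @ores X (opreim rfun_continuous U) (opreim rfun_continuous V)
        (preimage_subset sVU) (rcomorph U s)
}.

Arguments rfun_continuous : clear implicits.
Arguments rcomorph : clear implicits.

Section Pushforward.
Variables (f : ringed_map) (M : omodule X).

Notation fpre := (opreim (rfun_continuous f)).

Definition push_sec (V : opens Y) : lmodType (osec Y V) :=
  restrict_scalars (rcomorph f V) (msec M (fpre V)).

Definition push_res (U V : opens Y) (sVU : V `<=` U) :
    push_sec U -> push_sec V :=
  @mres X M (fpre U) (fpre V) (preimage_subset sVU).

Lemma push_res_linear (U V : opens Y) (sVU : V `<=` U) :
  linear_for (ores sVU \; *:%R) (push_res sVU).
Proof.
move=> a s t; rewrite /push_res.
set r := mres M _; have rD := raddfD r; have rZ := linearZ_LR r.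
apply: etrans (rD _ _) _; congr (_ + _); apply: etrans (rZ _ _) _.
by rewrite /= -rcomorph_res.
Qed.

HB.instance Definition _ (U V : opens Y) (sVU : V `<=` U) :=
  GRing.isLinear.Build (osec Y U) (push_sec U) (push_sec V)
    (ores sVU \; *:%R) (push_res sVU) (push_res_linear sVU).

Lemma push_sheaf :
  sheaf_axiom (fun U V (sVU : V `<=` U) => push_res sVU).
Proof.
move=> U I W sWU s cov comp.
have := @mres_sheaf X M (fpre U) I (fun i => fpre (W i))
  (fun i => preimage_subset (sWU i)) s.
case=> [x Ux|i j|t [tE tU]].
- by have [i _ Wi] := cov _ Ux; exists i.
- have sI : opensI (fpre (W i)) (fpre (W j)) `<=` fpre (opensI (W i) (W j)) by [].
  have := congr1 (mres M sI) (comp i j); rewrite /push_res => E.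
  apply: etrans (etrans E _); last exact: mres_comp.
  by apply: esym; exact: mres_comp.
- by exists t; split.
Qed.

Definition pushforward : omodule Y :=
  @OModule Y push_sec (fun U V sVU => push_res sVU)
    (fun U sUU s => @mres_id X M (fpre U) (preimage_subset sUU) s)
    (fun U V W sVU sWV sWU s =>
       @mres_comp X M (fpre U) (fpre V) (fpre W) (preimage_subset sVU)
         (preimage_subset sWV) (preimage_subset sWU) s)
    push_sheaf.
End Pushforward.
End Morphisms.
Arguments rfun_continuous {X Y} r.
Arguments rcomorph {X Y} r V.

(* H^i(U, M) is computed by the canonical (Godement) flasque resolution of M.
   With (C F)(V) = \prod_(x in V) F_x, the n-th term of the cosimplicial
   Godement resolution is C^(n+1) F, and since (C F)_x = (C F)(U_x) on a finite
   space,
     (C^(n+1) F)(U) = \prod_(x_0 <= ... <= x_n in U) F_(x_n),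
   the k-th coface map omitting x_k. Each face of a chain ends at a point below
   the last point of that chain, so restricting to the latter treats all the
   faces uniformly; the restriction is nontrivial only for the last face. *)
Section Cohomology.
Variables (X : finRingedSpace) (M : omodule X) (U : opens X).

Record chain (n : nat) := Chain {
  chain_pt :> 'I_n.+1 -> X;
  chain_in : forall i, oset U (chain_pt i);
  chain_le : forall i j : 'I_n.+1, (i <= j)%N -> spec_le (chain_pt i) (chain_pt j)
}.

Definition chain_last n (c : chain n) : X := c ord_max.

Definition cochain (n : nat) : Type :=
  forall c : chain n, mstalk M (chain_last c).

Lemma face_le n (k : 'I_n.+2) (c : chain n.+1) (i j : 'I_n.+1) :
  (i <= j)%N -> spec_le (c (lift k i)) (c (lift k j)).
Proof. by move=> ij; apply: chain_le; rewrite /= leq_bump2. Qed.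

Definition face n (k : 'I_n.+2) (c : chain n.+1) : chain n :=
  @Chain n (fun i => c (lift k i)) (fun i => chain_in c (lift k i))
    (@face_le n k c).

Lemma face_last_le n (k : 'I_n.+2) (c : chain n.+1) :
  spec_le (chain_last (face k c)) (chain_last c).
Proof. by apply: chain_le; exact: leq_ord. Qed.

Definition coboundary n (s : cochain n) : cochain n.+1 :=
  fun c => \sum_(k < n.+2) (-1) ^+ k *: mres M (@face_last_le n k c) (s (face k c)).

(* H^i(U, M) = 0 *)
Definition cohomology_zero (i : nat) : Prop :=
  match i with
  | 0 => forall s : cochain 0, (forall c, coboundary s c = 0) -> forall c, s c = 0
  | n.+1 => forall s : cochain n.+1, (forall c, coboundary s c = 0) ->
      exists t : cochain n, forall c, coboundary t c = s c
  end.
End Cohomology.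

(* R^i f_* M is the sheaf associated with V |-> H^i(f^-1 V, M). It vanishes iff
   its stalks do, and its stalk at y is H^i(f^-1 U_y, M). *)
Definition direct_image_zero (X Y : finRingedSpace) (f : ringed_map X Y)
    (M : omodule X) (i : nat) : Prop :=
  forall y : Y,
    cohomology_zero M (opreim (rfun_continuous f) (min_open y)) i.

(* The sheaf of rings attached to stalks T p and transition maps tr: sections
   over W are the compatible families of elements of the T p, p in W. *)
Section GermSheaf.
Variables (X : finTopology) (T : X -> comPzRingType).
Variable tr : forall p q, spec_le p q -> {rmorphism T p -> T q}.

Record germs (W : opens X) := Germs {
  germ : forall p, oset W p -> T p;
  germ_compat : forall p q (pq : spec_le p q) (Wp : oset W p) (Wq : oset W q),
    tr pq (germ Wp) = germ Wq
}.

Lemma germs_ext W (s t : germs W) :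
  (forall p (Wp : oset W p), germ s Wp = germ t Wp) -> s = t.
Proof.
case: s t => [s sc] [t tc] /= st.
have E : s = t by apply: functional_extensionality_dep => p; apply: funext.
by move: sc; rewrite E => sc; congr Germs; exact: Prop_irrelevance.
Qed.

HB.instance Definition _ W := gen_eqMixin (germs W).
HB.instance Definition _ W := gen_choiceMixin (germs W).

Section Ring.
Variable W : opens X.
Implicit Types s t : germs W.

Definition germs_const (c : forall p, T p)
    (cc : forall p q (pq : spec_le p q), tr pq (c p) = c q) : germs W :=
  @Germs W (fun p _ => c p) (fun p q pq _ _ => cc p q pq).

Definition germs0 := germs_const (fun p q pq => rmorph0 (tr pq)).
Definition germs1 := germs_const (fun p q pq => rmorph1 (tr pq)).

Lemma germs_opp_compat s p q (pq : spec_le p q) (Wp : oset W p) (Wq : oset W q) :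
  tr pq (- germ s Wp) = - germ s Wq.
Proof. by rewrite rmorphN germ_compat. Qed.
Lemma germs_add_compat s t p q (pq : spec_le p q) (Wp : oset W p) (Wq : oset W q) :
  tr pq (germ s Wp + germ t Wp) = germ s Wq + germ t Wq.
Proof. by rewrite rmorphD !(germ_compat _ pq _ Wq). Qed.
Lemma germs_mul_compat s t p q (pq : spec_le p q) (Wp : oset W p) (Wq : oset W q) :
  tr pq (germ s Wp * germ t Wp) = germ s Wq * germ t Wq.
Proof. by rewrite rmorphM !(germ_compat _ pq _ Wq). Qed.

Definition germs_opp s : germs W := Germs (germs_opp_compat s).
Definition germs_add s t : germs W := Germs (germs_add_compat s t).
Definition germs_mul s t : germs W := Germs (germs_mul_compat s t).

Lemma germs_addA : associative germs_add.
Proof. by move=> s t u; apply: germs_ext => p Wp; exact: addrA. Qed.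
Lemma germs_addC : commutative germs_add.
Proof. by move=> s t; apply: germs_ext => p Wp; exact: addrC. Qed.
Lemma germs_add0 : left_id germs0 germs_add.
Proof. by move=> s; apply: germs_ext => p Wp; exact: add0r. Qed.
Lemma germs_addN : left_inverse germs0 germs_opp germs_add.
Proof. by move=> s; apply: germs_ext => p Wp; exact: addNr. Qed.
Lemma germs_mulA : associative germs_mul.
Proof. by move=> s t u; apply: germs_ext => p Wp; exact: mulrA. Qed.
Lemma germs_mulC : commutative germs_mul.
Proof. by move=> s t; apply: germs_ext => p Wp; exact: mulrC. Qed.
Lemma germs_mul1 : left_id germs1 germs_mul.
Proof. by move=> s; apply: germs_ext => p Wp; exact: mul1r. Qed.
Lemma germs_mulDl : left_distributive germs_mul germs_add.
Proof. by move=> s t u; apply: germs_ext => p Wp; exact: mulrDl. Qed.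

HB.instance Definition _ := GRing.isZmodule.Build (germs W)
  germs_addA germs_addC germs_add0 germs_addN.
HB.instance Definition _ := GRing.Zmodule_isComPzRing.Build (germs W)
  germs_mulA germs_mulC germs_mul1 germs_mulDl.
End Ring.

Section Restriction.
Variables (U V : opens X) (sVU : V `<=` U).

Definition germs_res (s : germs U) : germs V :=
  @Germs V (fun p Vp => germ s (sVU Vp))
    (fun p q pq Vp Vq => germ_compat s pq (sVU Vp) (sVU Vq)).

Lemma germs_res_zmod : zmod_morphism germs_res.
Proof. by move=> s t; exact: germs_ext. Qed.
Lemma germs_res_monoid : monoid_morphism germs_res.
Proof. by split=> [|s t]; exact: germs_ext. Qed.

HB.instance Definition _ :=
  GRing.isZmodMorphism.Build (germs U) (germs V) germs_res germs_res_zmod.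
HB.instance Definition _ :=
  GRing.isMonoidMorphism.Build (germs U) (germs V) germs_res germs_res_monoid.
End Restriction.

Lemma germ_irr W (s : germs W) p (Wp Wp' : oset W p) : germ s Wp = germ s Wp'.
Proof. by congr germ; exact: Prop_irrelevance. Qed.

Lemma germs_res_id (U : opens X) (sUU : U `<=` U) (s : germs U) :
  germs_res sUU s = s.
Proof. by apply: germs_ext => p Wp /=; exact: germ_irr. Qed.

Lemma germs_res_comp (U V W : opens X) (sVU : V `<=` U) (sWV : W `<=` V)
  (sWU : W `<=` U) (s : germs U) :
  germs_res sWV (germs_res sVU s) = germs_res sWU s.
Proof. by apply: germs_ext => p Wp /=; exact: germ_irr. Qed.

Lemma germs_sheaf : sheaf_axiom (fun U V (sVU : V `<=` U) => germs_res sVU).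
Proof.
move=> U I W sWU s cov comp.
have sE i j p (Wip : oset (W i) p) (Wjp : oset (W j) p) :
    germ (s i) Wip = germ (s j) Wjp.
  have Wijp : oset (opensI (W i) (W j)) p by split.
  have := congr1 (fun u => germ u Wijp) (comp i j) => /= E.
  by apply: etrans (germ_irr _ _ _) (etrans E (germ_irr _ _ _)).
have pick p : oset U p -> {i | oset (W i) p}.
  by move=> Up; apply: cid; have [i _ Wip] := cov p Up; exists i.
pose g p Up := germ (s (sval (pick p Up))) (proj2_sig (pick p Up)).
have gc p q (pq : spec_le p q) Up Uq : tr pq (g p Up) = g q Uq.
  have Wq : oset (W (sval (pick p Up))) q.
    apply: min_open_sub (proj2_sig (pick p Up)) _ _.
    exact/spec_leP.
  by rewrite /g (germ_compat _ pq _ Wq); exact: sE.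
exists (Germs gc); split=> [i|t tE].
  by apply: germs_ext => p Wip; exact: sE.
apply: germs_ext => p Up; rewrite /= /g.
set i := sval _; set Wip := proj2_sig _.
by rewrite -(tE i) /=; exact: germ_irr.
Qed.

Definition germ_space : finRingedSpace :=
  @FinRingedSpace X (fun W => germs W) (fun U V sVU => germs_res sVU)
    germs_res_id germs_res_comp germs_sheaf.

(* The stalks of germ_space are the T p as soon as tr is functorial. *)
Lemma germ_stalk_bij (p : X) :
  (forall q (qq : spec_le q q) a, tr qq a = a) ->
  (forall q r t (qr : spec_le q r) (rt : spec_le r t) (qt : spec_le q t) a,
     tr rt (tr qr a) = tr qt a) ->
  bijective (fun s : stalk (X := germ_space) p => germ (s : germs (min_open p)) (@min_open_refl X p)).
Proof.
move=> tr_id tr_comp.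
have gc a q r (qr : spec_le q r) (pq : oset (min_open p) q)
    (pr : oset (min_open p) r) :
    tr qr (tr (min_open_sub pq) a) = tr (min_open_sub pr) a.
  exact: tr_comp.
exists (fun a => Germs (gc a)) => [s|a] /=; last exact: tr_id.
by apply: germs_ext => q pq /=; exact: germ_compat.
Qed.
End GermSheaf.

Section Product.
Variables X Y : finRingedSpace.

Lemma prod_finite : finite_set [set: X * Y].
Proof. by rewrite -setXTT; apply: finite_setX; exact: fin_spaceP. Qed.

Definition prod_top : finTopology := @FinTopology (X * Y)%type prod_finite.

Lemma continuous_spec_le (A B : finTopology) (f : A -> B) (p q : A) :
  continuous f -> spec_le p q -> spec_le (f p) (f q).
Proof.
move=> cf /spec_leP pq; apply/spec_leP.
have sub : min_open p `<=` opreim cf (min_open (f p)).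
  by apply: min_open_sub; exact: min_open_refl.
exact: sub pq.
Qed.

Lemma spec_le_fst (z w : prod_top) : spec_le z w -> @spec_le X z.1 w.1.
Proof. by apply: continuous_spec_le => x; exact: cvg_fst. Qed.

Lemma spec_le_snd (z w : prod_top) : spec_le z w -> @spec_le Y z.2 w.2.
Proof. by apply: continuous_spec_le => x; exact: cvg_snd. Qed.

Definition prod_stalk (z : prod_top) : comPzRingType :=
  tensor_ring (stalk z.1) (stalk z.2).

Definition prod_tr (z w : prod_top) (zw : spec_le z w) :
    {rmorphism prod_stalk z -> prod_stalk w} :=
  tensor_ring_map (ores (spec_le_fst zw)) (ores (spec_le_snd zw)).

Lemma prod_trE z w (zw : spec_le z w) a b :
  prod_tr zw (rtens a b)
  = rtens (ores (spec_le_fst zw) a) (ores (spec_le_snd zw) b).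
Proof. exact: tensor_ring_mapE. Qed.

(* Functoriality of prod_tr: with germ_stalk_bij, the stalks of prod_space are
   the prod_stalk z. *)
Lemma prod_tr_id z (zz : spec_le z z) a : prod_tr zz a = a.
Proof.
elim/tensor_ring_ind: a => [|t u IHt IHu|a b]; first by rewrite rmorph0.
- by rewrite rmorphD IHt IHu.
- by rewrite prod_trE !ores_id.
Qed.

Lemma prod_tr_comp z w v (zw : spec_le z w) (wv : spec_le w v)
  (zv : spec_le z v) a : prod_tr wv (prod_tr zw a) = prod_tr zv a.
Proof.
elim/tensor_ring_ind: a => [|t u IHt IHu|a b]; first by rewrite !rmorph0.
- by rewrite !rmorphD IHt IHu.
- by rewrite !prod_trE; congr rtens; exact: ores_comp.
Qed.

(* The product topology with the sheaf of rings of stalks O_x (x)_Z O_y. *)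
Definition prod_space : finRingedSpace :=
  @germ_space prod_top prod_stalk prod_tr.
End Product.

Section Diagonal.
Variable X : finRingedSpace.

Definition diag (x : X) : prod_space X X := (x, x).

Lemma diag_continuous : continuous diag.
Proof. by move=> x; apply: cvg_pair; exact: cvg_id. Qed.

Definition diag_mult (x : X) : {rmorphism tensor_ring (stalk x) (stalk x) -> stalk x} :=
  tensor_ring_lift idfun idfun.

Lemma diag_multE x a b : diag_mult x (rtens a b) = a * b.
Proof. exact: tensor_ring_liftE. Qed.

Lemma diag_mult_compat (W : opens (prod_space X X)) (s : osec (prod_space X X) W)
  (p q : X) (pq : spec_le p q) (Wp : oset W (diag p)) (Wq : oset W (diag q)) :
  ores pq (diag_mult p (germ s Wp)) = diag_mult q (germ s Wq).
Proof.
have dpq : spec_le (diag p) (diag q).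
  exact: continuous_spec_le diag_continuous pq.
rewrite -(germ_compat s dpq Wp Wq).
elim/tensor_ring_ind: (germ s Wp) => [|t u IHt IHu|a b].
- by rewrite !rmorph0.
- by rewrite !rmorphD IHt IHu.
- rewrite prod_trE !diag_multE rmorphM.
  by rewrite (Prop_irrelevance (spec_le_fst dpq) pq)
    (Prop_irrelevance (spec_le_snd dpq) pq).
Qed.

Lemma diag_comorph_ex (W : opens (prod_space X X)) (s : osec (prod_space X X) W) :
  exists! t : osec X (opreim diag_continuous W),
    forall x (Wx : oset W (diag x)),
      @ores X (opreim diag_continuous W) (min_open x)
        (@min_open_sub X x (opreim diag_continuous W) Wx) t
      = diag_mult x (germ s Wx).
Proof.
apply: (@sheaf_glue X _ (fun U V sVU => ores sVU) (@ores_comp X) (@ores_sheaf X)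
  (opreim diag_continuous W) (fun x Wx => diag_mult x (germ s Wx))).
by move=> p q pq Wp Wq; exact: diag_mult_compat.
Qed.

(* The comorphism of the diagonal: s = (s_(x,y)) goes
   to the section with germ mult (s_(x,x)) at each x. *)
Definition diag_comorph W (s : osec (prod_space X X) W) :
  osec X (opreim diag_continuous W) := sval (cid (diag_comorph_ex s)).

Lemma diag_comorphE W (s : osec (prod_space X X) W) x (Wx : oset W (diag x)) :
  @ores X (opreim diag_continuous W) (min_open x)
    (@min_open_sub X x (opreim diag_continuous W) Wx) (diag_comorph s)
  = diag_mult x (germ s Wx).
Proof. by rewrite /diag_comorph; case: cid => t [+ _] /=; exact. Qed.

Lemma diag_comorph_uniq W (s : osec (prod_space X X) W) t :
  (forall x (Wx : oset W (diag x)),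
    @ores X (opreim diag_continuous W) (min_open x)
      (@min_open_sub X x (opreim diag_continuous W) Wx) t
    = diag_mult x (germ s Wx)) -> diag_comorph s = t.
Proof. by rewrite /diag_comorph; case: cid => u [_ +] /=; exact. Qed.

Lemma diag_comorph_zmod W : zmod_morphism (@diag_comorph W).
Proof.
move=> s t; apply: diag_comorph_uniq => x Wx.
by rewrite rmorphB !diag_comorphE -rmorphB.
Qed.

Lemma diag_comorph_monoid W : monoid_morphism (@diag_comorph W).
Proof.
split=> [|s t]; apply: diag_comorph_uniq => x Wx.
- by rewrite rmorph1 -[LHS](rmorph1 (diag_mult x)).
- by rewrite rmorphM !diag_comorphE -rmorphM.
Qed.

HB.instance Definition _ W := GRing.isZmodMorphism.Build _ _
  (@diag_comorph W) (@diag_comorph_zmod W).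
HB.instance Definition _ W := GRing.isMonoidMorphism.Build _ _
  (@diag_comorph W) (@diag_comorph_monoid W).

Lemma diag_comorph_res (U V : opens (prod_space X X)) (sVU : V `<=` U) s :
  diag_comorph (ores sVU s)
  = @ores X (opreim diag_continuous U) (opreim diag_continuous V)
      (preimage_subset sVU) (diag_comorph s).
Proof.
apply: diag_comorph_uniq => x Vx.
rewrite (ores_comp _ _ (@min_open_sub X x (opreim diag_continuous U) (sVU _ Vx))).
exact: diag_comorphE.
Qed.

Definition diagonal : ringed_map X (prod_space X X) :=
  @RingedMap X (prod_space X X) diag diag_continuous (@diag_comorph)
    diag_comorph_res.
End Diagonal.

Definition semi_separated (X : finRingedSpace) : Prop :=
  quasi_coherent (pushforward (diagonal X) (structure_module X)) /\
  forall i, (0 < i)%N -> direct_image_zero (diagonal X) (structure_module X) i.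

Section Resolution.
Variable X : finRingedSpace.

Definition ohom_exact (M N P : omodule X) (f : ohom M N) (g : ohom N P) : Prop :=
  forall (p : X) (y : mstalk N p),
    g (min_open p) y = 0 <-> exists x : mstalk M p, f (min_open p) x = y.

Definition ohom_epi (M N : omodule X) (f : ohom M N) : Prop :=
  forall (p : X) (y : mstalk N p), exists x : mstalk M p, f (min_open p) x = y.

(* ... -> P 2 -> P 1 -> P 0 -> M -> 0, where P n stands for P^-n, exact as a
   sequence of sheaves. *)
Record resolution (M : omodule X) := Resolution {
  res_obj : nat -> omodule X;
  res_diff : forall n, ohom (res_obj n.+1) (res_obj n);
  res_aug : ohom (res_obj 0) M;
  res_epi : ohom_epi res_aug;
  res_exact0 : ohom_exact (res_diff 0) res_aug;
  res_exact : forall n, ohom_exact (res_diff n.+1) (res_diff n)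
}.

End Resolution.

(* Main.v *)
From HB Require Import structures.
From mathcomp Require Import all_boot all_algebra.
From mathcomp Require Import boolp classical_sets functions cardinality filter topology.
From mathcomp Require Import zify.
Require Import Defs.

Set Implicit Arguments.
Unset Strict Implicit.
Unset Printing Implicit Defensive.

Import GRing.Theory.
Local Open Scope classical_set_scope.
Local Open Scope ring_scope.

(** The category of quasi-coherent modules has enough flats because a
    quasi-coherent module can be made flat at one more point without
    spoiling the points where it is flat already.

    Write A_p for the stalk of the structure sheaf at p, U_p for the smallest
    open neighbourhood of p and U_pq for the intersection of U_p and U_q.
    Given F quasi-coherent and a point x, let j be the inclusion of U_x and let
    L be the free A_x-module on the set F_x.  The fibre product of F and
    j_* L~ over j_* j^* F, where L~ is the quasi-coherent module defined by L
    on U_x, surjects onto F.  At x it is the stalk of j_* L~, a free module.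
    At a point p where F is flat it is the kernel of a surjection from the
    flat module F_p (+) (j_* L~)_p onto the flat module (j_* j^* F)_p, hence
    flat (step_flat_at, step_flat_new).  Repeating this for all the points of
    X yields a flat cover (flat_cover), and covering the successive kernels
    yields the resolution (flat_resolution).

    The stalk of j_* j^* F at p is F(U_px), so all of this requires that
    F(U_px) is F_x (x) O(U_px) over A_x, that it is F_p (x) O(U_px) over A_p,
    and that O(U_px) is flat over both rings (mult_bij, tensor_universal_O).
    These facts come from the vanishing of the cohomology of O on U_px, by a
    general statement (acyclic_tensor_universal): if a diagram of flat
    A-modules over a finite preorder is acyclic, then its module of global
    sections is flat and commutes with tensor products.  Its proof embeds the
    diagram into a diagram with easy sections, the Godement diagram, the
    quotient being again flat and acyclic and vanishing at more points; one
    concludes by induction on the support.  Finiteness is used here: for an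
    unbounded exact complex of flat modules the conclusion would fail.

    The quasi-coherence of the direct image of O under the diagonal says that
    O(U_px) (x) A_q is O(U_qx) for p <= q (push_O_qc).  It shows that j_* L~
    is quasi-coherent, and that base change of j_* j^* F is injective
    (push_base_change_inj), which is what quasi-coherence of a kernel
    requires from the target (stalk_ker_qc).

    The argument is carried out with families of stalks and their transition
    maps; sheaves are only assembled at the end. *)

(** * Linear maps, products and submodules *)

Section Linear.
Variables (A : pzRingType) (U : lmodType A).

Definition lin (V : lmodType A) (f : U -> V) (fl : linear f) : {linear U -> V} :=
  HB.pack f (GRing.isLinear.Build A U V *:%R f fl).

Variables (B : pzRingType) (phi : {rmorphism A -> B}) (W : lmodType B).

Definition slin (f : U -> W) (fl : linear_for (phi \; *:%R) f) :
    {linear U -> W | phi \; *:%R} :=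
  HB.pack f (GRing.isLinear.Build A U W (phi \; *:%R) f fl).
End Linear.

Section Restrict.
Variables (A B : pzRingType) (phi : {rmorphism A -> B}) (M : lmodType B).

(** Named identities: two nested restrictions of scalars along different
    morphisms are convertible only through their common underlying module,
    which is best not left to unification. *)
Definition to_restr (m : M) : restrict_scalars phi M := m.
Definition of_restr (m : restrict_scalars phi M) : M := m.

Lemma to_restrK : cancel to_restr of_restr. Proof. by []. Qed.
Lemma of_restrK : cancel of_restr to_restr. Proof. by []. Qed.
Lemma to_restrD : {morph to_restr : m n / m + n}. Proof. by []. Qed.
Lemma of_restrD : {morph of_restr : m n / m + n}. Proof. by []. Qed.
Lemma of_restrP a (m n : restrict_scalars phi M) :
  of_restr (a *: m + n) = phi a *: of_restr m + of_restr n.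
Proof. by []. Qed.
Lemma to_restrP a (m n : M) : to_restr (phi a *: m + n) = a *: to_restr m + to_restr n.
Proof. by []. Qed.
End Restrict.
Arguments to_restr {A B} phi {M} m.

Section Regular.
Variables (A B : pzRingType) (phi : {rmorphism A -> B}).

Definition to_reg (b : B) : restrict_scalars phi B^o := b.
Definition of_reg (b : restrict_scalars phi B^o) : B := b.

Lemma of_regK : cancel of_reg to_reg. Proof. by []. Qed.
Lemma to_reg0 : to_reg 0 = 0. Proof. by []. Qed.
Lemma to_regD : {morph to_reg : b c / b + c}. Proof. by []. Qed.
Lemma to_regMz b n : to_reg (b *~ n) = to_reg b *~ n. Proof. by []. Qed.
Lemma to_regZ a b : to_reg (phi a * b) = a *: to_reg b. Proof. by []. Qed.
Lemma of_regP a b c : of_reg (a *: b + c) = phi a * of_reg b + of_reg c.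
Proof. by []. Qed.
End Regular.
Arguments to_reg {A B} phi b.

Section Dprod.
Variables (A : pzRingType) (I : Type) (F : I -> lmodType A).

Definition dprod : Type := forall i, F i.
Implicit Types f g : dprod.

HB.instance Definition _ := gen_eqMixin dprod.
HB.instance Definition _ := gen_choiceMixin dprod.

Lemma dprod_ext f g : (forall i, f i = g i) -> f = g.
Proof. exact: functional_extensionality_dep. Qed.

Fact dprod_addA : associative (fun f g : dprod => (fun i => f i + g i) : dprod).
Proof. by move=> f g h; apply: dprod_ext => i; exact: addrA. Qed.
Fact dprod_addC : commutative (fun f g : dprod => (fun i => f i + g i) : dprod).
Proof. by move=> f g; apply: dprod_ext => i; exact: addrC. Qed.
Fact dprod_add0 :
  left_id ((fun i => 0) : dprod) (fun f g : dprod => (fun i => f i + g i) : dprod).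
Proof. by move=> f; apply: dprod_ext => i; exact: add0r. Qed.
Fact dprod_addN : left_inverse ((fun i => 0) : dprod)
  (fun f : dprod => (fun i => - f i) : dprod)
  (fun f g : dprod => (fun i => f i + g i) : dprod).
Proof. by move=> f; apply: dprod_ext => i; exact: addNr. Qed.

HB.instance Definition _ :=
  GRing.isZmodule.Build dprod dprod_addA dprod_addC dprod_add0 dprod_addN.

Fact dprod_scaleA (a b : A) f :
  ((fun i => a *: (b *: f i)) : dprod) = (fun i => (a * b) *: f i).
Proof. by apply: dprod_ext => i; exact: scalerA. Qed.
Fact dprod_scale1 : left_id 1 (fun (a : A) f => (fun i => a *: f i) : dprod).
Proof. by move=> f; apply: dprod_ext => i; exact: scale1r. Qed.
Fact dprod_scaleDr :
  right_distributive (fun (a : A) f => (fun i => a *: f i) : dprod) +%R.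
Proof. by move=> a f g; apply: dprod_ext => i; exact: scalerDr. Qed.
Fact dprod_scaleDl f :
  {morph (fun a : A => (fun i => a *: f i) : dprod) : a b / a + b}.
Proof. by move=> a b; apply: dprod_ext => i; exact: scalerDl. Qed.

HB.instance Definition _ := GRing.Zmodule_isLmodule.Build A dprod
  dprod_scaleA dprod_scale1 dprod_scaleDr dprod_scaleDl.

Definition dpr (i : I) : {linear dprod -> F i} :=
  @lin A dprod (F i) (fun f => f i) (fun a f g => erefl).

(** Equality of indices is decided classically, so that every index type is
    allowed. *)
Definition dinj_fun (i : I) (x : F i) : dprod := fun j =>
  match pselect (i = j) with left e => ecast k (F k) e x | right _ => 0 end.

Lemma dinj_linear i : linear (@dinj_fun i).
Proof.
move=> a x y; apply: dprod_ext => j /=; rewrite /dinj_fun.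
have -> : (a *: ((fun j => match pselect (i = j) with left e => ecast k (F k) e x
    | right _ => 0 end) : dprod) + (fun j => match pselect (i = j) with
    left e => ecast k (F k) e y | right _ => 0 end)) j =
  a *: (match pselect (i = j) with left e => ecast k (F k) e x | right _ => 0 end)
   + match pselect (i = j) with left e => ecast k (F k) e y | right _ => 0 end by [].
by case: pselect => [e|_]; [case: _ / e | rewrite scaler0 addr0].
Qed.

Definition dinj i : {linear F i -> dprod} := lin (@dinj_linear i).

Lemma dinjE i x : dinj i x i = x.
Proof.
rewrite /= /dinj_fun; case: pselect => // e.
by rewrite (Prop_irrelevance e erefl).
Qed.

Lemma dinjN i j x : i <> j -> dinj i x j = 0.
Proof. by rewrite /= /dinj_fun; case: pselect. Qed.
End Dprod.

Section Submodule.
Variables (A : pzRingType) (V : lmodType A) (P : V -> Prop).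

Definition submod_pred : Prop := P 0 /\ forall a x y, P x -> P y -> P (a *: x + y).

Hypothesis Pcl : submod_pred.

Record submod_of : Type := SubmodOf { subval : V; subvalP : P subval }.
(** The carrier does not depend on the closure proof; the alias carries it so
    that the module structure can be inferred from the type. *)
Definition submod (_ : submod_pred) : Type := submod_of.
Local Notation S := (submod Pcl).

Lemma subval_inj (x y : submod_of) : subval x = subval y -> x = y.
Proof.
by case: x y => [x Px] [y Py] /= E; case: _ / E in Py *; congr SubmodOf;
  exact: Prop_irrelevance.
Qed.

HB.instance Definition _ := gen_eqMixin S.
HB.instance Definition _ := gen_choiceMixin S.

Fact submodD x y : P x -> P y -> P (x + y).
Proof. by move=> Px Py; rewrite -[x]scale1r; apply: Pcl.2. Qed.
Fact submodZ a x : P x -> P (a *: x).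
Proof. by move=> Px; rewrite -[_ *: _]addr0; apply: Pcl.2 => //; exact: Pcl.1. Qed.
Fact submodN x : P x -> P (- x).
Proof. by move=> Px; rewrite -scaleN1r; exact: submodZ. Qed.

Definition sub0 : S := SubmodOf Pcl.1.
Definition subD (x y : S) : S := SubmodOf (submodD (subvalP x) (subvalP y)).
Definition subN (x : S) : S := SubmodOf (submodN (subvalP x)).
Definition subZ a (x : S) : S := SubmodOf (submodZ a (subvalP x)).

Fact sub_addA : associative subD.
Proof. by move=> x y z; apply: subval_inj; exact: addrA. Qed.
Fact sub_addC : commutative subD.
Proof. by move=> x y; apply: subval_inj; exact: addrC. Qed.
Fact sub_add0 : left_id sub0 subD.
Proof. by move=> x; apply: subval_inj; exact: add0r. Qed.
Fact sub_addN : left_inverse sub0 subN subD.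
Proof. by move=> x; apply: subval_inj; exact: addNr. Qed.
HB.instance Definition _ := GRing.isZmodule.Build S sub_addA sub_addC sub_add0 sub_addN.

Fact sub_scaleA a b (x : S) : subZ a (subZ b x) = subZ (a * b) x.
Proof. by apply: subval_inj; exact: scalerA. Qed.
Fact sub_scale1 : left_id 1 subZ.
Proof. by move=> x; apply: subval_inj; exact: scale1r. Qed.
Fact sub_scaleDr : right_distributive subZ +%R.
Proof. by move=> a x y; apply: subval_inj; exact: scalerDr. Qed.
Fact sub_scaleDl (x : S) : {morph subZ^~ x : a b / a + b}.
Proof. by move=> a b; apply: subval_inj; exact: scalerDl. Qed.
HB.instance Definition _ := GRing.Zmodule_isLmodule.Build A S
  sub_scaleA sub_scale1 sub_scaleDr sub_scaleDl.

Definition sincl : {linear S -> V} := @lin A S V (@subval) (fun a x y => erefl).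

Lemma sincl_inj : injective sincl.
Proof. exact: subval_inj. Qed.

Lemma lin_corestrict_linear (W : lmodType A) (f : {linear W ->
  V}) (Pf : forall w, P (f w)) :
  linear ((fun w => SubmodOf (Pf w)) : W -> S).
Proof. by move=> a u v; apply: subval_inj; rewrite /= linearP. Qed.

Definition lin_corestrict (W : lmodType A) (f : {linear W -> V}) (Pf : forall w, P (f w)) :
  {linear W -> S} := lin (lin_corestrict_linear Pf).
End Submodule.

Lemma ker_submod (A : pzRingType) (V W : lmodType A) (f : {linear V -> W}) :
  submod_pred (fun x => f x = 0).
Proof. by split=> [|a x y fx fy]; rewrite ?linear0 // linearP fx fy scaler0 addr0. Qed.

Definition lin_ker (A : pzRingType) (V W : lmodType A) (f : {linear V -> W}) : lmodType A :=
  submod (ker_submod f).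

Lemma lin_kerP (A : pzRingType) (V W : lmodType A) (f : {linear V -> W}) (x : lin_ker f) :
  f (sincl _ x) = 0.
Proof. exact: subvalP x. Qed.

Lemma lin_ker_lift (A : pzRingType) (V W : lmodType A) (f : {linear V -> W}) (y : V) :
  f y = 0 -> exists x : lin_ker f, sincl (ker_submod f) x = y.
Proof. by move=> y0; exists (@SubmodOf A V (fun x => f x = 0) y y0). Qed.

(** * Functoriality and right exactness of tensor products *)

Section TensorKit.
Variable A : comPzRingType.

Lemma tensor_ext (M N : lmodType A) (P : zmodType) (f g : tensor M N -> P) :
  {morph f : t u / t + u} -> {morph g : t u / t + u} ->
  (forall x y, f (tens x y) = g (tens x y)) -> f =1 g.
Proof.
move=> fD gD fg t; have f0 : f 0 = 0 by apply: (addrI (f 0)); rewrite -fD !addr0.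
have g0 : g 0 = 0 by apply: (addrI (g 0)); rewrite -gD !addr0.
by elim/tensor_ind: t => [|t u IHt IHu|//]; rewrite ?f0 ?g0 ?fD ?gD ?IHt ?IHu.
Qed.

Section LiftLinear.
Variables (M N P : lmodType A) (f : M -> N -> P).
Hypotheses (fl : forall y, linear (f^~ y)) (fr : forall x, linear (f x)).

Lemma bilinear_balanced : balanced f.
Proof.
split=> [y x x'|x y y'|a x y].
- by have := fl y 1 x x'; rewrite !scale1r.
- by have := fr x 1 y y'; rewrite !scale1r.
- have l0 : f 0 y = 0.
    by have := fl y 1 0 0; rewrite !scale1r addr0 => /esym/eqP;
      rewrite -subr_eq0 addrK => /eqP.
  have r0 : f x 0 = 0.
    by have := fr x 1 0 0; rewrite !scale1r addr0 => /esym/eqP;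
      rewrite -subr_eq0 addrK => /eqP.
  have := fl y a x 0; have := fr x a y 0; rewrite !addr0 r0 l0 !addr0 => -> ->.
  by [].
Qed.

Lemma tensor_lin_linear : linear (tensor_lift f).
Proof.
have fb := bilinear_balanced.
move=> a t u; rewrite (tensor_liftD fb); congr (_ + _).
elim/tensor_ind: t => [|t v IHt IHv|x y].
- by rewrite scaler0 (tensor_lift0 fb) scaler0.
- by rewrite scalerDr !(tensor_liftD fb) IHt IHv scalerDr.
rewrite tensZl !(tensor_liftE fb).
have l0 : f 0 y = 0 by have := tensor_lift0 fb; rewrite -(tens0l _ y) (tensor_liftE fb).
by have := fl y a x 0; rewrite !addr0 l0 addr0.
Qed.

Definition tensor_lin : {linear tensor M N -> P} := lin tensor_lin_linear.

Lemma tensor_linE x y : tensor_lin (tens x y) = f x y.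
Proof. exact: tensor_liftE bilinear_balanced x y. Qed.
End LiftLinear.

Lemma tens_linl (M N : lmodType A) (y : N) : linear (fun x : M => tens x y).
Proof. by move=> a x x'; rewrite tensDl tensZl. Qed.
Lemma tens_linr (M N : lmodType A) (x : M) : linear (fun y : N => tens x y).
Proof. by move=> a y y'; rewrite tensDr tensZr. Qed.

Lemma tensBr (M N : lmodType A) (x : M) (y y' : N) :
  tens x (y - y') = tens x y - tens x y'.
Proof. exact: (raddfB (lin (tens_linr x))). Qed.

Lemma tensMzl (M N : lmodType A) (x : M) (y : N) n : tens (x *~ n) y = tens x y *~ n.
Proof. exact: (raddfMz (lin (tens_linl y))). Qed.
Lemma tensMzr (M N : lmodType A) (x : M) (y : N) n : tens x (y *~ n) = tens x y *~ n.
Proof. exact: (raddfMz (lin (tens_linr x))). Qed.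

Section Tmap.
Variables (M M' N N' : lmodType A) (f : {linear M -> M'}) (g : {linear N -> N'}).

Fact tmap_linl (y : N) : linear (fun x : M => tens (f x) (g y)).
Proof. by move=> a x x'; rewrite linearP tensDl tensZl. Qed.
Fact tmap_linr (x : M) : linear (fun y : N => tens (f x) (g y)).
Proof. by move=> a y y'; rewrite linearP tensDr tensZr. Qed.

Definition tmap : {linear tensor M N -> tensor M' N'} := tensor_lin tmap_linl tmap_linr.

Lemma tmapE x y : tmap (tens x y) = tens (f x) (g y).
Proof. exact: tensor_linE. Qed.
End Tmap.

Definition rmap (M N N' : lmodType A) (g : {linear N -> N'}) :
  {linear tensor M N -> tensor M N'} := tmap (idfun : {linear M -> M}) g.
Definition lmap (N M M' : lmodType A) (f : {linear M -> M'}) :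
  {linear tensor M N -> tensor M' N} := tmap f (idfun : {linear N -> N}).

Lemma rmapE (M N N' : lmodType A) (g : {linear N -> N'}) (x : M) y :
  rmap M g (tens x y) = tens x (g y).
Proof. exact: tmapE. Qed.
Lemma lmapE (N M M' : lmodType A) (f : {linear M -> M'}) x (y : N) :
  lmap N f (tens x y) = tens (f x) y.
Proof. exact: tmapE. Qed.

Lemma tmap_sq (M M1 M2 M' N N1 N2 N' : lmodType A)
  (f1 : {linear M -> M1}) (f1' : {linear M1 -> M'})
  (f2 : {linear M -> M2}) (f2' : {linear M2 -> M'})
  (g1 : {linear N -> N1}) (g1' : {linear N1 -> N'})
  (g2 : {linear N -> N2}) (g2' : {linear N2 -> N'}) :
  (forall x, f1' (f1 x) = f2' (f2 x)) -> (forall y, g1' (g1 y) = g2' (g2 y)) ->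
  forall t, tmap f1' g1' (tmap f1 g1 t) = tmap f2' g2' (tmap f2 g2 t).
Proof.
move=> ff gg; apply: tensor_ext => [t u|t u|x y]; rewrite ?linearD //.
by rewrite !tmapE ff gg.
Qed.

Lemma tmap_comp (M M1 M' N N1 N' : lmodType A)
  (f1 : {linear M -> M1}) (f1' : {linear M1 -> M'}) (f2 : {linear M -> M'})
  (g1 : {linear N -> N1}) (g1' : {linear N1 -> N'}) (g2 : {linear N -> N'}) :
  (forall x, f1' (f1 x) = f2 x) -> (forall y, g1' (g1 y) = g2 y) ->
  forall t, tmap f1' g1' (tmap f1 g1 t) = tmap f2 g2 t.
Proof.
move=> ff gg; apply: tensor_ext => [t u|t u|x y]; rewrite ?linearD //.
by rewrite !tmapE ff gg.
Qed.

Lemma tmap_id (M N : lmodType A) (f : {linear M -> M}) (g : {linear N -> N}) :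
  f =1 id -> g =1 id -> tmap f g =1 id.
Proof.
move=> ff gg; apply: tensor_ext => [t u|t u|x y]; rewrite ?linearD //.
by rewrite tmapE ff gg.
Qed.

Lemma rmap0 (M N N' : lmodType A) (g : {linear N -> N'}) :
  (forall y, g y = 0) -> forall t : tensor M N, rmap M g t = 0.
Proof.
move=> g0; apply: tensor_ext => [t u|t u|x y]; rewrite ?linearD ?addr0 //.
by rewrite rmapE g0 tens0r.
Qed.

Definition tswap (M N : lmodType A) : {linear tensor M N -> tensor N M} :=
  tensor_lin (fun y : N => tens_linr y) (fun x : M => tens_linl x).

Lemma tswapE (M N : lmodType A) (x : M) (y : N) : tswap M N (tens x y) = tens y x.
Proof. exact: tensor_linE. Qed.

Lemma tswapK (M N : lmodType A) : cancel (tswap M N) (tswap N M).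
Proof.
apply: tensor_ext => [t u|t u|x y]; rewrite ?linearD //.
by rewrite !tswapE.
Qed.

Lemma tswap_map (M M' N N' : lmodType A) (f : {linear M -> M'}) (g : {linear N -> N'}) t :
  tswap M' N' (tmap f g t) = tmap g f (tswap M N t).
Proof.
move: t; apply: tensor_ext => [t u|t u|x y]; rewrite ?linearD //.
by rewrite !(tmapE, tswapE).
Qed.

Section RightExact.
Variables (M N' N N'' : lmodType A) (f : {linear N' -> N}) (g : {linear N -> N''}).
Hypothesis (g_surj : forall y, exists x, g x = y).
Hypothesis (fg_exact : forall y, g y = 0 -> exists x, f x = y).

Let im (t : tensor M N) := exists u, rmap M f u = t.
Let gg (x : M * N) : M * N'' := (x.1, g x.2).

Let im0 : im 0. Proof. by exists 0; rewrite linear0. Qed.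
Let imD t u : im t -> im u -> im (t + u).
Proof. by move=> [x <-] [y <-]; exists (x + y); rewrite linearD. Qed.
Let imN t : im t -> im (- t).
Proof. by move=> [x <-]; exists (- x); rewrite linearN. Qed.
Let im_tens (x : M) y y' : g y = g y' -> im (tens x y - tens x y').
Proof.
move=> E; have [|z zE] := fg_exact (y := y - y'); first by rewrite linearB E subrr.
by exists (tens x z); rewrite rmapE zE tensBr.
Qed.

Let im_refl l l' : map gg l = map gg l' -> im (tclass l - tclass l').
Proof.
elim: l l' => [|[x y] l IH] [|[x' y'] l'] //= => [_|]; first by rewrite subrr.
case=> <- E /IH il; rewrite -(cat1s _ l) -(cat1s _ l') !tclass_cat opprD addrACA.
by apply: imD => //; exact: im_tens.
Qed.

Let lift_seq (s : seq (M * N'')) : exists l, map gg l = s.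
Proof.
elim: s => [|[x y] s [l <-]]; first by exists [::].
by have [z <-] := g_surj y; exists ((x, z) :: l).
Qed.

Let split_map (l : seq (M * N)) s t : map gg l = s ++ t ->
  exists l1 l2, [/\ l = l1 ++ l2, map gg l1 = s & map gg l2 = t].
Proof.
move=> E; exists (take (size s) l), (drop (size s) l).
by rewrite cat_take_drop map_take map_drop E take_size_cat // drop_size_cat.
Qed.

Let im_eq s s' : tens_eq s s' -> forall l l',
  map gg l = s -> map gg l' = s' -> im (tclass l - tclass l').
Proof.
elim=> {s s'} [s|s t _ IH|s t u _ IH _ IH'|s s' t t' _ IH _ IH'|s t|x x' y|x y y'|a x
  y|y] l l'.
- by move=> <- /esym; exact: im_refl.
- by move=> E E'; rewrite -opprB; apply: imN; exact: IH.
- move=> E E'; have [m Em] := lift_seq t.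
  by rewrite -(subrKA (tclass m)); apply: imD; [exact: IH | exact: IH'].
- move=> /split_map[l1 [l2 [-> E1 E2]]] /split_map[k1 [k2 [-> E1' E2']]].
  by rewrite !tclass_cat opprD addrACA; apply: imD; [exact: IH | exact: IH'].
- move=> /split_map[l1 [l2 [-> E1 E2]]] /split_map[k1 [k2 [-> E1' E2']]].
  rewrite !tclass_cat [tclass k1 + _]addrC opprD addrACA.
  by apply: imD; apply: im_refl; rewrite ?E1 ?E2.
- case: l => [|[z n] []] //= [-> En]; case: l' =>
  [|[z1 n1] [|[z2 n2] []]] //= [-> E1 -> E2].
  rewrite -[[:: _; _]]cat1s tclass_cat -!/(tens _ _) tensDl opprD addrACA.
  by apply: imD; apply: im_tens; rewrite ?E1 ?E2.
- case: l => [|[z n] []] //= [-> En]; case: l' =>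
  [|[z1 n1] [|[z2 n2] []]] //= [-> E1 -> E2].
  rewrite -[[:: _; _]]cat1s tclass_cat -!/(tens _ _) -tensDr.
  by apply: im_tens; rewrite linearD E1 E2.
- case: l => [|[z n] []] //= [-> En]; case: l' => [|[z1 n1] []] //= [-> E1].
  by rewrite -!/(tens _ _) tensZ; apply: im_tens; rewrite linearZ /= En E1.
- case: l => [|[z n] []] //= [-> En]; case: l' => [|//] _.
  by rewrite -!/(tens _ _) tens0l subr0.
Qed.

(** Instead of forming a quotient of M (x) N, one lifts formal sums along g:
    two liftings of congruent formal sums differ by an element of the image of
    id (x) f, by induction on the derivation of the congruence (im_eq). *)
Lemma tensor_right_exact t : rmap M g t = 0 -> exists u, rmap M f u = t.
Proof.
rewrite -(tclassK t); set l := repr t => E.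
have E' : rmap M g (tclass l) = tclass (map gg l).
  by rewrite !tclassE linear_sum big_map; apply: eq_bigr => x _; rewrite rmapE.
rewrite E' in E; have /tclassP lE : tclass (map gg l) = tclass [::] by [].
have := im_eq lE (l := l) (l' := [::]) erefl erefl.
have -> : tclass [::] = 0 :> tensor M N by [].
by rewrite subr0.
Qed.

Lemma rmap_surj t : exists u, rmap M g u = t.
Proof.
elim/tensor_ind: t => [|t t' [u <-] [u' <-]|x y]; first by exists 0; rewrite linear0.
  by exists (u + u'); rewrite linearD.
by have [z <-] := g_surj y; exists (tens x z); rewrite rmapE.
Qed.
End RightExact.

Lemma lmap_surj (N M M' : lmodType A) (g : {linear M -> M'}) :
  (forall y, exists x, g x = y) -> forall t, exists u, lmap N g u = t.
Proof.
move=> gs t; have [u uE] := rmap_surj gs (tswap _ _ t).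
by exists (tswap _ _ u); rewrite /lmap -tswap_map -/(rmap _ _) uE tswapK.
Qed.

Lemma tensor_left_exact (N M' M M'' : lmodType A) (f : {linear M' -> M})
  (g : {linear M -> M''}) :
  (forall y, exists x, g x = y) -> (forall y, g y = 0 -> exists x, f x = y) ->
  forall t, lmap N g t = 0 -> exists u, lmap N f u = t.
Proof.
move=> gs ex t t0; have [|u uE] := tensor_right_exact gs ex (t := tswap _ _ t).
  by rewrite /rmap -tswap_map -/(lmap _ _) t0 linear0.
by exists (tswap _ _ u); rewrite /lmap -tswap_map -/(rmap _ _) uE tswapK.
Qed.
End TensorKit.

(** * Direct sums and flat modules *)

Lemma lin_injP (A : pzRingType) (V W : lmodType A) (f : {linear V -> W}) :
  injective f <-> forall x, f x = 0 -> x = 0.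
Proof.
split=> [fi x fx|f0 x y E]; first by apply: fi; rewrite linear0.
by apply/eqP; rewrite -subr_eq0; apply/eqP/f0; rewrite linearB E subrr.
Qed.

Definition finite_type (I : Type) : Prop :=
  exists s : seq {classic I}, forall i : I, (i : {classic I}) \in s.

Section DirectSum.
Variables (A : pzRingType) (I : Type) (V : lmodType A) (F : I -> lmodType A).
Variables (inj : forall i, {linear F i -> V}) (pr : forall i, {linear V -> F i}).

(** A common description of finite products and of direct sums: the components
    of v outside a finite list contribute nothing. It is stated for all large
    enough lists, so that finitely many elements can be decomposed along the
    same list. *)
Definition is_dsum : Prop := forall v, exists s : seq {classic I},
  forall s', uniq s' -> {subset s <= s'} -> v = \sum_(i <- s') inj i (pr i v).
End DirectSum.

Section FlatKit.
Variable A : comPzRingType.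

(** Flatness is defined with M on the left of the tensor product; below,
    coefficients stand on the left and M on the right. *)
Lemma flatP (M : lmodType A) : flat_module M <->
  forall (N N' : lmodType A) (f : {linear N -> N'}), injective f -> injective (lmap M f).
Proof.
have swl (N N' : lmodType A) (f : {linear N -> N'}) t : lmap M f t =
  tswap _ _ (rmap M f (tswap _ _ t)).
  by rewrite tswap_map tswapK.
have swr (N N' : lmodType A) (f : {linear N -> N'}) t : rmap M f t =
  tswap _ _ (lmap M f (tswap _ _ t)).
  by rewrite tswap_map tswapK.
split=> fM N N' f fi.
  have ri : injective (rmap M f) by exact: fM.
  move=> t u; rewrite !swl => /(can_inj (@tswapK _ _ _))/ri.
  exact: (can_inj (@tswapK _ _ _)).
suff ri : injective (rmap M f) by [].
move=> t u; rewrite !swr => /(can_inj (@tswapK _ _ _))/(fM _ _ _ fi).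
exact: (can_inj (@tswapK _ _ _)).
Qed.

Section Sum.
Variables (I : Type) (V : lmodType A) (F : I -> lmodType A).
Variables (inj : forall i, {linear F i -> V}) (pr : forall i, {linear V -> F i}).
Hypothesis dec : is_dsum inj pr.

Lemma tensor_dsum (N : lmodType A) :
  is_dsum (fun i => rmap N (inj i)) (fun i => rmap N (pr i)).
Proof.
elim/tensor_ind=> [|t u [s sE] [s' s'E]|n v].
- by exists [::] => s _ _; rewrite big1 // => i _; rewrite !linear0.
- exists (s ++ s') => r ur sr.
  have tE : t = \sum_(i <- r) rmap N (inj i) (rmap N (pr i) t).
    by apply: sE => // i si; apply: sr; rewrite mem_cat si.
  have uE : u = \sum_(i <- r) rmap N (inj i) (rmap N (pr i) u).
    by apply: s'E => // i si; apply: sr; rewrite mem_cat si orbT.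
  rewrite [LHS](congr2 +%R tE uE) -big_split.
  by apply: eq_bigr => i _; rewrite !linearD.
- have [s sE] := dec v; exists s => r ur sr.
  rewrite [LHS](congr1 (lin (tens_linr n)) (sE r ur sr)) linear_sum.
  by apply: eq_bigr => i _; rewrite !rmapE.
Qed.

(** An element of N (x) V is the sum of its components, as this holds for pure
    tensors. *)
Lemma tensor_dsum_inj (N : lmodType A) (t : tensor N V) :
  (forall i, rmap N (pr i) t = 0) -> t = 0.
Proof.
move=> t0; have [s /(_ (undup s) (undup_uniq _)) ->] := tensor_dsum t.
  by rewrite big1 // => i _; rewrite t0 linear0.
by move=> i; rewrite mem_undup.
Qed.

Lemma tensor_dsum_eq (N : lmodType A) (t u : tensor N V) :
  (forall i, rmap N (pr i) t = rmap N (pr i) u) -> t = u.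
Proof.
move=> tu; apply/eqP; rewrite -subr_eq0; apply/eqP; apply: tensor_dsum_inj => i.
by rewrite linearB tu subrr.
Qed.

Lemma flat_dsum : (forall i, flat_module (F i)) -> flat_module V.
Proof.
move=> fF; apply/flatP => N N' f fi; apply/lin_injP => t t0.
apply: tensor_dsum_inj => i; have /flatP/(_ _ _ f fi)/lin_injP := fF i; apply.
rewrite /rmap (tmap_sq (f2 := f) (f2' := idfun) (g2 := idfun) (g2' := pr i)) //.
by rewrite -/(lmap V f) t0 linear0.
Qed.
End Sum.

Lemma flat_regular : flat_module (A^o : lmodType A).
Proof.
apply/flatP => N N' f fi.
have ll (M : lmodType A) (a : A^o) : linear (fun x : M => (a : A) *: x).
  by move=> b x y; rewrite scalerDr !scalerA mulrC.
have lr (M : lmodType A) (x : M) : linear (fun a : A^o => (a : A) *: x).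
  by move=> b a a'; rewrite scalerDl -scalerA.
pose th (M : lmodType A) := tensor_lin (ll M) (lr M).
have thK (M : lmodType A) : forall t, tens (th M t) (1 : A^o) = t.
  apply: tensor_ext => [t u|t u|x a] //; first by rewrite linearD tensDl.
  by rewrite tensor_linE tensZ; congr tens; exact: mulr1.
have thf t : th N' (lmap _ f t) = f (th N t).
  move: t; apply: tensor_ext => [t u|t u|x a]; rewrite ?linearD //.
  by rewrite lmapE !tensor_linE linearZ.
apply/lin_injP => t t0; rewrite -(thK _ t).
have -> : th N t = 0 by apply: fi; rewrite -thf t0 !linear0.
by rewrite tens0l.
Qed.

Lemma flat_retract (V W : lmodType A) (i : {linear V -> W}) (r : {linear W -> V}) :
  cancel i r -> flat_module W -> flat_module V.
Proof.
move=> iK /flatP fW; apply/flatP => N N' f fi; apply/lin_injP => t t0.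
have /lin_injP/(_ (rmap N i t)) := fW _ _ f fi.
rewrite /lmap /rmap (tmap_sq (f2 := f) (f2' := idfun) (g2 := idfun) (g2' := i)) //.
rewrite -/(lmap _ _) t0 linear0 => /(_ erefl) E.
rewrite -[t](tmap_id (f := idfun) (g := idfun)) //.
rewrite -(tmap_comp (f1 := idfun) (f1' := idfun) (g1 := i) (g1' := r)) //.
by rewrite E linear0.
Qed.

Lemma flat_iso (V W : lmodType A) (f : {linear V -> W}) :
  bijective f -> flat_module V <-> flat_module W.
Proof.
case=> g fK gK; have gl : linear g by exact: can2_linear fK gK.
by split; [exact: (@flat_retract _ _ (lin gl) f) | exact: (@flat_retract _ _ f (lin gl))].
Qed.

Section Dsum.
Variables (I : Type) (F : I -> lmodType A).

Definition fin_supp (f : dprod F) : Prop :=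
  exists s : seq {classic I}, forall i, i \notin s -> f i = 0.

Lemma fin_supp_submod : submod_pred fin_supp.
Proof.
split=> [|a f g [s fs] [s' gs]]; first by exists [::].
exists (s ++ s') => i; rewrite mem_cat negb_or => /andP[si s'i].
by rewrite -[LHS]/(a *: f i + g i) fs // gs // scaler0 addr0.
Qed.

Definition dsum : lmodType A := submod fin_supp_submod.

Definition dsum_pr i : {linear dsum -> F i} := dpr F i \o sincl fin_supp_submod.

Lemma dinj_supp i (x : F i) : fin_supp (dinj F i x).
Proof. by exists [:: (i : {classic I})] => j; rewrite inE => /eqP ij;
  apply: dinjN => /esym. Qed.

Definition dsum_inj i : {linear F i -> dsum} := lin_corestrict fin_supp_submod
  (@dinj_supp i).

Lemma dprod_dec (f : dprod F) (s : seq {classic I}) : uniq s ->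
  (forall i, i \notin s -> f i = 0) -> f = \sum_(i <- s) dinj F i (dpr F i f).
Proof.
move=> us fs; apply: dprod_ext => j; rewrite -[RHS]/(dpr F j _) linear_sum.
have [js|js] := boolP ((j : {classic I}) \in s).
  rewrite (bigD1_seq (j : {classic I})) //= -[dinj_fun _ _]/(dinj F j (f j) j).
  rewrite dinjE big1 ?addr0 // => i /eqP ij; exact: dinjN.
rewrite fs // big1_seq // => i /andP[_ si] /=; apply: dinjN => ij.
by move: js; rewrite -ij si.
Qed.

Lemma dsum_is_dsum : is_dsum dsum_inj dsum_pr.
Proof.
move=> v; have [s vs] := subvalP v; exists s => s' us' ss'.
apply: (@sincl_inj _ _ _ fin_supp_submod); rewrite linear_sum.
rewrite [LHS](@dprod_dec _ s') // => i; apply: contraNeq => /eqP vi; apply: ss'.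
by apply: contra_notT vi => /vs.
Qed.

Lemma dsum_prE i j (x : F i) : i <> j -> dsum_pr j (dsum_inj i x) = 0.
Proof. exact: dinjN. Qed.
Lemma dsum_prK i (x : F i) : dsum_pr i (dsum_inj i x) = x.
Proof. exact: dinjE. Qed.

Lemma dsum_ext (x y : dsum) : (forall i, dsum_pr i x = dsum_pr i y) -> x = y.
Proof. by move=> E; apply: subval_inj; apply: dprod_ext. Qed.

Lemma dprod_is_dsum : finite_type I -> is_dsum (dinj F) (dpr F).
Proof.
move=> [s sT] f; exists s => s' us' ss'; apply: dprod_dec => // i.
by rewrite ss' // sT.
Qed.
End Dsum.

Definition free_module (I : Type) : lmodType A := dsum (fun _ : I => (A^o : lmodType A)).

Lemma flat_free (I : Type) : flat_module (free_module I).
Proof. by apply: flat_dsum (@dsum_is_dsum _ _) _ => _; exact: flat_regular. Qed.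

Lemma sum_widen (I : Type) (V : zmodType) (g : I -> V) (s s' : seq {classic I}) :
  uniq s -> uniq s' -> {subset s <= s'} -> (forall i, i \notin s -> g i = 0) ->
  \sum_(i <- s') g i = \sum_(i <- s) g i.
Proof.
move=> us us' ss' g0; rewrite (bigID (mem s)) /= [X in _ + X]big1 ?addr0 // -big_filter.
apply: perm_big; apply: uniq_perm; rewrite ?filter_uniq // => i.
by rewrite mem_filter andb_idr //; exact: ss'.
Qed.

Section DsumOut.
Variables (I : Type) (F : I -> lmodType A) (N : lmodType A) (g : forall i, {linear F i ->
  N}).

(** The sum runs over some list containing the support, and does not depend on
    its choice (dsum_outE). *)
Definition dsum_out_fun (x : dsum F) : N :=
  \sum_(i <- undup (sval (cid (subvalP x)))) g i (dsum_pr F i x).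

Lemma dsum_outE (x : dsum F) (s : seq {classic I}) : uniq s ->
  (forall i, i \notin s -> dsum_pr F i x = 0) ->
  dsum_out_fun x = \sum_(i <- s) g i (dsum_pr F i x).
Proof.
rewrite /dsum_out_fun; case: cid => r /= xr us xs.
have g0 (t : seq {classic I}) : (forall i, i \notin t -> dsum_pr F i x = 0) ->
    forall i : I, (i : {classic I}) \notin undup t -> g i (dsum_pr F i x) = 0.
  by move=> xt i; rewrite mem_undup => /xt ->; rewrite linear0.
rewrite -(@sum_widen _ _ (fun i => g i (dsum_pr F i x)) (undup r) (undup (r ++ s)));
  first last.
- exact: g0.
- by move=> i; rewrite !mem_undup mem_cat => ->.
- exact: undup_uniq.
- exact: undup_uniq.
rewrite -{2}(undup_id us).
apply: (@sum_widen _ _ (fun i => g i (dsum_pr F i x))); rewrite ?undup_uniq //.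
- by move=> i; rewrite !mem_undup mem_cat => ->; rewrite orbT.
- exact: g0.
Qed.

Lemma dsum_out_linear : linear dsum_out_fun.
Proof.
move=> a x y; have [s xs] := subvalP x; have [s' ys] := subvalP y.
pose r := undup (s ++ s').
have xr i : i \notin r -> dsum_pr F i x = 0.
  by rewrite mem_undup mem_cat negb_or => /andP[/xs].
have yr i : i \notin r -> dsum_pr F i y = 0.
  by rewrite mem_undup mem_cat negb_or => /andP[_ /ys].
rewrite !(@dsum_outE _ r) ?undup_uniq //; last first.
  by move=> i ir; rewrite linearP xr // yr // scaler0 addr0.
rewrite scaler_sumr -big_split; apply: eq_bigr => i _.
by rewrite !linearP.
Qed.

Definition dsum_out : {linear dsum F -> N} := lin dsum_out_linear.

Lemma dsum_out_inj i (x : F i) : dsum_out (dsum_inj F i x) = g i x.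
Proof.
rewrite [LHS](@dsum_outE _ [:: (i : {classic I})]) //; last first.
  by move=> j; rewrite inE => /eqP ij; apply: dsum_prE => /esym.
by rewrite big_seq1 dsum_prK.
Qed.
End DsumOut.

Lemma dsum_out_ext (I : Type) (F : I -> lmodType A) (N : zmodType)
    (f g : dsum F -> N) :
  {morph f : x y / x + y} -> {morph g : x y / x + y} ->
  (forall i x, f (dsum_inj F i x) = g (dsum_inj F i x)) -> f =1 g.
Proof.
move=> fD gD fg x; have f0 : f 0 = 0 by apply: (addrI (f 0)); rewrite -fD !addr0.
have g0 : g 0 = 0 by apply: (addrI (g 0)); rewrite -gD !addr0.
have [s /(_ (undup s) (undup_uniq _)) ->] := dsum_is_dsum x; last first.
  by move=> i; rewrite mem_undup.
by elim: (undup s) => [|i r IH]; rewrite ?big_nil ?f0 ?g0 // !big_cons fD gD fg IH.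
Qed.

(** The canonical map from the free module on the underlying set of N, sending
    the basis vector of y to y. *)
Definition free_out (N : lmodType A) : {linear free_module N -> N}.
Proof.
refine (dsum_out (fun x : N => lin (f := fun a : A^o => (a : A) *: x) _)).
by move=> b a a'; rewrite scalerDl -scalerA.
Defined.

Lemma free_out_surj (N : lmodType A) (y : N) : exists x, free_out N x = y.
Proof.
exists (dsum_inj _ y (1 : A^o)); rewrite /free_out dsum_out_inj /=.
exact: scale1r.
Qed.

Section ShortExact.
Variables (K' K K'' : lmodType A) (f : {linear K' -> K}) (g : {linear K -> K''}).
Hypothesis (f_inj : injective f) (g_surj : forall y, exists x, g x = y).
Hypothesis (gf0 : forall x, g (f x) = 0) (fg_exact : forall y, g y = 0 -> exists x, f x =
  y).
Hypothesis (flatK'' : flat_module K'').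

(** The vanishing of Tor_1(N, K''), by a diagram chase with a free cover of N:
    an element killed by N (x) K' -> N (x) K lifts to the cover, and its
    lifting is corrected by an element coming from the kernel of the cover,
    since this kernel tensored with the flat module K'' embeds. *)
Lemma flat_pure (N : lmodType A) : injective (rmap N f).
Proof.
pose p := free_out N; pose q := sincl (ker_submod p).
apply/lin_injP => u u0.
have [v vE] := lmap_surj (@free_out_surj N) u.
have qP y : p y = 0 -> exists x, q x = y by exact: lin_ker_lift.
have [|w wE] := tensor_left_exact (@free_out_surj N) qP (t := rmap _ f v).
  rewrite /lmap /rmap (tmap_sq (f2 := p) (f2' := idfun) (g2 := idfun) (g2' := f)) //.
  by rewrite -/(lmap _ _) vE -/(rmap _ _) u0.
have w0 : rmap _ g w = 0.
  have /lin_injP : injective (lmap K'' q).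
    by have /flatP := flatK''; apply; exact: sincl_inj.
  apply; rewrite /lmap /rmap (tmap_sq (f2 := q) (f2' := idfun) (g2 := idfun) (g2' := g)) //.
  rewrite -/(lmap _ _) wE /rmap (tmap_comp (f2 := idfun) (g2 := g \o f)) //.
  by rewrite -/(rmap _ _) rmap0.
have [w' w'E] := tensor_right_exact g_surj fg_exact w0.
have vE' : v = lmap _ q w'.
  have : injective (rmap (free_module N) f) by apply: flat_free; exact: f_inj.
  apply; rewrite -wE -w'E.
  rewrite /lmap /rmap (tmap_sq (f2 := q) (f2' := idfun) (g2 := idfun) (g2' := f)) //.
rewrite -vE vE' /lmap (tmap_comp (f2 := p \o q) (g2 := idfun)) //.
move: w' {w'E vE'}; apply: (@tensor_ext _ _ _ _ _ (fun=> 0)) => [t t'|t t'|x y].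
- exact: linearD.
- by rewrite addr0.
- by rewrite tmapE [X in tens X _]lin_kerP tens0l.
Qed.

(** For an injection N -> N', both N (x) K' -> N (x) K and N (x) K -> N' (x) K
    are injective, hence so is N (x) K' -> N' (x) K'. *)
Lemma flat_ker : flat_module K -> flat_module K'.
Proof.
move=> /flatP fK; apply/flatP => N N' h hi; apply/lin_injP => t t0.
have /lin_injP := @flat_pure N; apply.
have /lin_injP := fK _ _ h hi; apply.
rewrite /lmap /rmap (tmap_sq (f2 := h) (f2' := idfun) (g2 := idfun) (g2' := f)) //.
by rewrite -/(lmap _ _) t0 linear0.
Qed.
End ShortExact.

Lemma flat_tensor (M H : lmodType A) :
  flat_module M -> flat_module H -> flat_module (tensor M H).
Proof.
move=> /flatP fM /flatP fH; apply/flatP => N N' f fi.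
pose al1 (N : lmodType A) (n : N) : {linear tensor M H -> tensor (tensor N M) H} :=
  lmap H (lin (tens_linr n)).
have al1E (L : lmodType A) (n : L) m h : al1 L n (tens m h) = tens (tens n m) h.
  exact: lmapE.
have al_l (L : lmodType A) t a x y : al1 L (a *: x + y) t = a *: al1 L x t + al1 L y t.
  elim/tensor_ind: t => [|t u IHt IHu|m h].
  - by rewrite !linear0 addr0.
  - by rewrite !linearD IHt IHu addrACA.
  - by rewrite !al1E tensDl -tensZl tensDl -tensZl.
pose al L := tensor_lin (al_l L) (fun n => linearP (al1 L n)).
pose be1 (L : lmodType A) (h : H) : {linear tensor L M -> tensor L (tensor M H)} :=
  rmap L (lin (tens_linl h)).
have be1E (L : lmodType A) h n m : be1 L h (tens n m) = tens n (tens m h).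
  exact: rmapE.
have be_r (L : lmodType A) t a x y : be1 L (a *: x + y) t = a *: be1 L x t + be1 L y t.
  elim/tensor_ind: t => [|t u IHt IHu|n m].
  - by rewrite !linear0 addr0.
  - by rewrite !linearD IHt IHu addrACA.
  - by rewrite !be1E tensDr -tensZr tensDr -tensZr.
pose be L := tensor_lin (fun h => linearP (be1 L h)) (be_r L).
have alK L : cancel (al L) (be L).
  apply: tensor_ext => [t u|t u|n t]; rewrite ?linearD //.
  move: t; apply: tensor_ext => [t u|t u|m h]; rewrite ?tensDr ?linearD //.
  by rewrite tensor_linE al1E [LHS]tensor_linE; exact: be1E.
have alf t : al N' (lmap _ f t) = lmap H (lmap M f) (al N t).
  move: t; apply: tensor_ext => [t u|t u|n t]; rewrite ?linearD //.
  rewrite lmapE !tensor_linE.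
  move: t; apply: tensor_ext => [t u|t u|m h]; rewrite ?linearD //.
  by rewrite !al1E !lmapE.
apply/lin_injP => t t0; apply: (can_inj (alK N)); rewrite linear0.
have /lin_injP := fH _ _ _ (fM _ _ f fi); apply.
by rewrite -alf t0 linear0.
Qed.
End FlatKit.

(** * Diagrams of modules over a preorder and their cohomology *)

(** The combinatorial core of d d = 0: passing from m to m + 1 adds a row and
    a column which cancel. *)
Lemma alternating_sum0 (A : pzRingType) (V : lmodType A) (f : nat -> nat -> V) m :
  (forall k j, (j < k)%N -> (k <= m)%N -> f k j = f j k.-1) ->
  \sum_(k < m.+1) \sum_(j < m) (-1) ^+ (k + j) *: f k j = 0.
Proof.
elim: m => [|m IH] fE; first by rewrite big_ord1 big_ord0.
rewrite big_ord_recr /=.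
under eq_bigr => k _ do rewrite big_ord_recr /=.
rewrite big_split /= IH ?add0r; last by move=> k j jk km; apply: fE => //; exact: leqW.
rewrite -big_split big1 // => k _ /=.
rewrite (fE m.+1 k) // /= -scalerDl addSn exprS mulN1r [(m + k)%N]addnC.
by rewrite addrN scale0r.
Qed.

Section Functors.
Variables (A : comPzRingType) (T : Type) (le : T -> T -> Prop).
Hypotheses (le_refl : forall i, le i i).
Hypothesis (le_trans : forall i j k, le i j -> le j k -> le i k).

Record diagram := Diagram {
  diagram_ob :> T -> lmodType A;
  dtr : forall i j, le i j -> {linear diagram_ob i -> diagram_ob j};
  dtr_id : forall i (h : le i i) x, dtr h x = x;
  dtr_comp : forall i j k (ij : le i j) (jk : le j k) (ik : le i k) x,
    dtr jk (dtr ij x) = dtr ik x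
}.

Record diagram_hom (F G : diagram) := DiagramHom {
  dnt :> forall i, {linear F i -> G i};
  dnatural : forall i j (h : le i j) x, dnt j (dtr F h x) = dtr G h (dnt i x)
}.

Section Sections.
Variable F : diagram.

Definition compatible (f : dprod F) : Prop :=
  forall i j (h : le i j), dtr F h (f i) = f j.

Lemma compatible_submod : submod_pred compatible.
Proof.
split=> [i j h|a f g fc gc i j h]; first exact: linear0.
by rewrite -[LHS]/(dtr F h (a *: f i + g i)) linearP fc gc.
Qed.

Definition sections : lmodType A := submod compatible_submod.

Definition ev i : {linear sections -> F i} := dpr F i \o sincl compatible_submod.

Lemma ev_compat i j (h : le i j) (x : sections) : dtr F h (ev i x) = ev j x.
Proof. exact: (subvalP x). Qed.

Lemma sections_ext (x y : sections) : (forall i, ev i x = ev i y) -> x = y.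
Proof. by move=> E; apply: subval_inj; apply: dprod_ext. Qed.

Definition mk_sections (f : dprod F) (fc : compatible f) : sections := SubmodOf fc.
End Sections.

Lemma sections_map_compat F G (f : diagram_hom F G) (x : sections F) :
  compatible ((fun i => f i (ev F i x)) : dprod G).
Proof. by move=> i j h; rewrite -dnatural ev_compat. Qed.

Lemma sections_map_linear F G (f : diagram_hom F G) :
  linear (fun x : sections F => mk_sections (sections_map_compat f x)).
Proof.
by move=> a x y; apply: sections_ext => i; rewrite linearP; exact: (linearP (f i)).
Qed.

Definition sections_map F G (f : diagram_hom F G) : {linear sections F -> sections G} :=
  lin (sections_map_linear f).

Lemma ev_sections_map F G (f : diagram_hom F G) i x : ev G i (sections_map f x) =
  f i (ev F i x).
Proof. by []. Qed.

(** Chains need not be strict, as in the Godement resolution; le is only a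
    preorder, so strict chains would not be bounded either. *)
Record tchain (n : nat) := Tchain {
  tpt :> 'I_n.+1 -> T;
  tpt_le : forall i j : 'I_n.+1, (i <= j)%N -> le (tpt i) (tpt j)
}.

Lemma tchain_ext n (c c' : tchain n) : (forall i, c i = c' i) -> c = c'.
Proof.
case: c c' => [c cl] [c' cl'] /= /funext E; case: _ / E in cl' *.
by congr Tchain; exact: Prop_irrelevance.
Qed.

Definition tlast n (c : tchain n) : T := c ord_max.

Lemma tface_le n (k : 'I_n.+2) (c : tchain n.+1) (i j : 'I_n.+1) :
  (i <= j)%N -> le (c (lift k i)) (c (lift k j)).
Proof. by move=> ij; apply: tpt_le; rewrite /= leq_bump2. Qed.

Definition tface n (k : 'I_n.+2) (c : tchain n.+1) : tchain n :=
  @Tchain n (fun i => c (lift k i)) (@tface_le n k c).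

Lemma tface_last_le n (k : 'I_n.+2) (c : tchain n.+1) : le (tlast (tface k c)) (tlast c).
Proof. exact: (@tpt_le n.+1 c (lift k ord_max) ord_max (leq_ord _)). Qed.

Definition tcochain (F : diagram) n : Type := forall c : tchain n, F (tlast c).

Definition cob (F : diagram) n (s : tcochain F n) : tcochain F n.+1 :=
  fun c => \sum_(k < n.+2) (-1) ^+ k *: dtr F (tface_last_le k c) (s (tface k c)).

Definition acyclic (F : diagram) : Prop := forall n (s : tcochain F n.+1),
  (forall c, cob s c = 0) -> exists t : tcochain F n, forall c, cob t c = s c.

Lemma dtr_at (F : diagram) n (s : tcochain F n) c c' j (h : le (tlast c) j)
  (h' : le (tlast c') j) : c = c' -> dtr F h (s c) = dtr F h' (s c').
Proof. by move=> E; case: _ / E in h' *; rewrite (Prop_irrelevance h h'). Qed.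

Lemma tface_tface n (c : tchain n.+2) (k j : nat) : (j < k)%N -> (k <= n.+2)%N ->
  tface (inord j) (tface (inord k) c) = tface (inord k.-1) (tface (inord j) c).
Proof.
case: k => // k jk kn; apply: tchain_ext => i /=; congr (c _); apply: val_inj => /=.
rewrite !inordK; try by lia.
by rewrite /bump; lia.
Qed.

(** The double sum is that of alternating_sum0; inord extends the faces of a
    chain to functions of natural numbers. *)
Lemma cob_cob (F : diagram) n (s : tcochain F n) c : cob (cob s) c = 0.
Proof.
have le2 j k : le (tlast (tface j (tface k c))) (tlast c).
  exact: le_trans (tface_last_le _ _) (tface_last_le _ _).
pose f k j := dtr F (le2 (inord j) (inord k)) (s (tface (inord j) (tface (inord k) c))).
rewrite -[RHS](@alternating_sum0 _ _ f n.+2); last first.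
  by move=> k j jk kn; apply: dtr_at; exact: tface_tface.
apply: eq_bigr => k _; rewrite linear_sum scaler_sumr; apply: eq_bigr => j _.
by rewrite linearZ scalerA -exprD (dtr_comp _ _ (le2 j k)) /f !inord_val.
Qed.

Lemma cob_nt F G (f : diagram_hom F G) n (s : tcochain F n) c :
  f _ (cob s c) = cob (fun c' => f _ (s c')) c.
Proof.
rewrite linear_sum; apply: eq_bigr => k _.
by rewrite linearZ dnatural.
Qed.

Lemma cobB F n (s t : tcochain F n) c :
  cob (fun c' => s c' - t c') c = cob s c - cob t c.
Proof.
rewrite -sumrB; apply: eq_bigr => k _.
by rewrite -scalerBr linearB.
Qed.

Lemma cob_sections F (x : sections F) c : cob (fun c' : tchain 0 =>
  ev F (tlast c') x) c = 0.
Proof.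
rewrite /cob !big_ord_recl big_ord0 addr0 !ev_compat expr0 expr1.
by rewrite scale1r scaleN1r subrr.
Qed.

Definition tpoint (i : T) : tchain 0 := @Tchain 0 (fun _ => i) (fun _ _ _ => le_refl i).

Lemma tarrow_le i j (h : le i j) (k l : 'I_2) : (k <= l)%N ->
  le (if k == ord0 then i else j) (if l == ord0 then i else j).
Proof.
by case: eqP => [_|/eqP k0]; case: eqP => // -> ; rewrite leqn0 => k00;
  rewrite -val_eqE k00 in k0.
Qed.

Definition tarrow i j (h : le i j) : tchain 1 := Tchain (tarrow_le h).

(** The coboundary of a 0-cochain on the chain i <= j is the difference of its
    value at j and the image of its value at i. *)
Lemma cocycle0_compat F (s : tcochain F 0) : (forall c, cob s c = 0) ->
  compatible ((fun i => s (tpoint i)) : dprod F).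
Proof.
move=> s0 i j h; have := s0 (tarrow h); rewrite /cob !big_ord_recl big_ord0 addr0.
rewrite expr0 expr1 scale1r scaleN1r => /eqP; rewrite subr_eq0 => /eqP E.
have e1 : tpoint i = tface (lift ord0 ord0) (tarrow h).
  by apply: tchain_ext => k; rewrite [k]ord1.
have e0 : tface ord0 (tarrow h) = tpoint j.
  by apply: tchain_ext => k; rewrite [k]ord1.
have E1 := @dtr_at F 0 s (tpoint i) _ j h (tface_last_le (lift ord0 ord0) (tarrow h)) e1.
have E0 := @dtr_at F 0 s _ (tpoint j) j (tface_last_le ord0 (tarrow h)) (le_refl j) e0.
by apply: etrans E1 _; apply: etrans (esym E) _; apply: etrans E0 _; exact: dtr_id.
Qed.

Section SplitQuotient.
Variables (F C : diagram) (eta : diagram_hom F C) (e : forall i, {linear C i -> F i}).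
Hypothesis eK : forall i x, e i (eta i x) = x.

(** As e splits eta at each point, though not naturally, C/F can be realised
    inside C as the kernel of e; this projection replaces the quotient map,
    and no quotient module is needed. *)
Definition sq_proj_lin i : {linear C i -> C i} := idfun \- (eta i \o e i).

Lemma sq_proj_ker i x : e i (sq_proj_lin i x) = 0.
Proof. by rewrite /= linearB /= eK subrr. Qed.

Definition sq_ob i : lmodType A := lin_ker (e i).

Definition sq_pi i : {linear C i -> sq_ob i} := lin_corestrict (ker_submod (e i))
  (@sq_proj_ker i).
Definition sq_inc i : {linear sq_ob i -> C i} := sincl (ker_submod (e i)).

Lemma sq_incK i x : sq_pi i (sq_inc i x) = x.
Proof.
by apply: (@sincl_inj _ _ _ (ker_submod (e i))); rewrite /= lin_kerP linear0 subr0.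
Qed.

Lemma sq_inc_pi i x : sq_inc i (sq_pi i x) = x - eta i (e i x).
Proof. by []. Qed.

Lemma sq_pi_eta i x : sq_pi i (eta i x) = 0.
Proof.
by apply: (@sincl_inj _ _ _ (ker_submod (e i))); rewrite linear0 /= eK subrr.
Qed.

Lemma sq_pi0 i x : sq_pi i x = 0 -> x = eta i (e i x).
Proof.
by move=> /(congr1 (sq_inc i)); rewrite linear0 sq_inc_pi => /eqP; rewrite subr_eq0 => /eqP.
Qed.

Definition sq_tr i j (h : le i j) : {linear sq_ob i -> sq_ob j} :=
  sq_pi j \o (dtr C h \o sq_inc i).

Lemma sq_tr_pi i j (h : le i j) x : sq_tr h (sq_pi i x) = sq_pi j (dtr C h x).
Proof.
rewrite -[LHS]/(sq_pi j (dtr C h (sq_inc i (sq_pi i x))))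
  sq_inc_pi !linearB -dnatural sq_pi_eta.
by rewrite subr0.
Qed.

Lemma sq_tr_id i (h : le i i) x : sq_tr h x = x.
Proof. by rewrite -{1}(sq_incK x) sq_tr_pi dtr_id sq_incK. Qed.

Lemma sq_tr_comp i j k (ij : le i j) (jk : le j k) (ik : le i k) x :
  sq_tr jk (sq_tr ij x) = sq_tr ik x.
Proof. by rewrite -(sq_incK x) !sq_tr_pi (dtr_comp _ _ ik). Qed.

Definition split_quot : diagram := Diagram sq_tr_id sq_tr_comp.

Definition sq_hom : diagram_hom C split_quot :=
  @DiagramHom C split_quot sq_pi (fun i j h x => esym (sq_tr_pi h x)).

(** Half of the connecting homomorphism: q lifts pointwise to C, the
    coboundary of this lifting is a cocycle of F, hence a coboundary, and
    subtracting its primitive makes the lifting a cocycle. *)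
Lemma lift_cocycle n (q : tcochain split_quot n) :
  acyclic F -> (forall c, cob q c = 0) ->
  exists2 s : tcochain C n, forall c, cob s c = 0 & forall c, sq_hom _ (s c) = q c.
Proof.
move=> aF q0; pose s0 : tcochain C n := fun c => sq_inc _ (q c).
pose f : tcochain F n.+1 := fun c => e _ (cob s0 c).
have s0E c : cob s0 c = eta _ (f c).
  apply: sq_pi0; apply: etrans (cob_nt sq_hom s0 c) _; rewrite -[RHS](q0 c).
  by congr (cob _ c); apply: functional_extensionality_dep => c'; exact: sq_incK.
have [|g gE] := aF _ f.
  move=> c; rewrite -[LHS]eK.
rewrite cob_nt.
  have -> : (fun c' => eta _ (f c')) = cob s0.
    by apply: functional_extensionality_dep => c'; rewrite s0E.
  by rewrite cob_cob linear0.
exists (fun c => s0 c - eta _ (g c)) => c.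
  by rewrite cobB -cob_nt gE s0E subrr.
by rewrite linearB [X in _ - X]sq_pi_eta subr0; exact: sq_incK.
Qed.

Lemma split_quot_acyclic : acyclic F -> acyclic C -> acyclic split_quot.
Proof.
move=> aF aC n q q0; have [s s0 sq] := lift_cocycle aF q0.
have [t tE] := aC _ s s0; exists (fun c => sq_hom _ (t c)) => c.
by rewrite -cob_nt tE sq.
Qed.

Lemma sections_map_split_surj : acyclic F -> forall y, exists x, sections_map sq_hom x = y.
Proof.
move=> aF y; have [s s0 sq] := lift_cocycle aF (cob_sections y).
exists (mk_sections (cocycle0_compat s0)); apply: sections_ext => i.
by rewrite ev_sections_map; exact: (sq (tpoint i)).
Qed.

Lemma sections_map_split_exact y : sections_map sq_hom y =
  0 -> exists x, sections_map eta x = y.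
Proof.
move=> y0; have yE i : ev _ i y = eta i (e i (ev _ i y)).
  by apply: sq_pi0; have := congr1 (ev _ i) y0; rewrite linear0.
have xc : compatible ((fun i => e i (ev _ i y)) : dprod F).
  move=> i j h; rewrite -[LHS]eK; congr (e j _).
  by rewrite dnatural -yE ev_compat.
by exists (mk_sections xc); apply: sections_ext => i; rewrite ev_sections_map [RHS]yE.
Qed.

Lemma sections_map_split_inj : injective (sections_map eta).
Proof.
move=> x y E; apply: sections_ext => i.
by rewrite -[LHS]eK -[RHS]eK -!ev_sections_map E.
Qed.

Lemma sections_map_split0 x : sections_map sq_hom (sections_map eta x) = 0.
Proof. by apply: sections_ext => i; rewrite linear0 !ev_sections_map; exact: sq_pi_eta. Qed.

End SplitQuotient.
End Functors.

(** * The Godement diagram *)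

Lemma finite_type_sub (T : Type) (P : T -> Prop) : finite_type T ->
  finite_type {x : T | P x}.
Proof.
move=> [s sT].
pose g (x : {classic T}) : option {classic {x : T | P x}} :=
  match pselect (P x) with left h => Some (exist _ (x : T) h) | right _ => None end.
exists (pmap g s) => -[x Px]; rewrite mem_pmap; apply/mapP; exists (x : {classic T}) => //.
by rewrite /g; case: pselect => // h; congr (Some (exist _ _ _)); exact: Prop_irrelevance.
Qed.

Section Godement.
Variables (A : comPzRingType) (T : Type) (le : T -> T -> Prop).
Hypotheses (le_refl : forall i, le i i).
Hypothesis (le_trans : forall i j k, le i j -> le j k -> le i k).
Variable rho : T -> T.
Hypotheses (rho_ge : forall i, le i (rho i)) (rho_le : forall i, le (rho i) i).
Hypothesis rho_eq : forall i j, le i j -> le j i -> rho i = rho j.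

(** Only one representative of each class of equivalent points (i <= j <= i)
    is kept. Otherwise the quotient of the Godement diagram by F would not
    vanish at more points than F. *)
Definition above i : Type := {r : T | rho r = r /\ le i r}.

Definition godement_ob (F : diagram A le) i : lmodType A :=
  dprod (fun r : above i => F (sval r)).

Definition above_sub i j (h : le i j) (r : above j) : above i :=
  exist _ (sval r) (conj (proj1 (svalP r)) (le_trans h (proj2 (svalP r)))).

Lemma godement_at (F : diagram A le) i (x : godement_ob F i) (r : T) (h h' : rho r =
  r /\ le i r) :
  x (exist _ r h) = x (exist _ r h') :> F r.
Proof. by rewrite (Prop_irrelevance h h'). Qed.

Section Ob.
Variable F : diagram A le.

Definition godement_tr i j (h : le i j) : {linear godement_ob F i -> godement_ob F j} :=
  @lin A (godement_ob F i) (godement_ob F j) (fun x => (fun r =>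
    x (above_sub h r)) : godement_ob F j)
    (fun a x y => erefl).

Lemma godement_tr_id i (h : le i i) x : godement_tr h x = x.
Proof. by apply: dprod_ext => -[r p]; exact: (godement_at (x : godement_ob F _)). Qed.
Lemma godement_tr_comp i j k (ij : le i j) (jk : le j k) (ik : le i k) x :
  godement_tr jk (godement_tr ij x) = godement_tr ik x.
Proof. by apply: dprod_ext => -[r p]; exact: (godement_at (x : godement_ob F _)). Qed.

Definition godement : diagram A le := Diagram godement_tr_id godement_tr_comp.

Lemma godement_eta_linear i :
  linear (fun x : F i => (fun r : above i => dtr F (proj2 (svalP r)) x) : godement i).
Proof. by move=> a x y; apply: dprod_ext => r; exact: linearP. Qed.

Definition godement_eta : diagram_hom F godement.
Proof.
refine (@DiagramHom _ _ _ F godement (fun i => lin (@godement_eta_linear i)) _).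
by move=> i j h x; apply: dprod_ext => r; exact: dtr_comp.
Defined.

Definition above_rho i : above i :=
  exist _ (rho i) (conj (esym (rho_eq (rho_ge i) (rho_le i))) (rho_ge i)).

Definition godement_e i : {linear godement i -> F i} :=
  dtr F (rho_le i) \o dpr (fun r : above i => F (sval r)) (above_rho i).

Lemma godement_etaK i x : godement_e i (godement_eta i x) = x.
Proof.
by apply: etrans (dtr_comp _ _ (le_refl i) _) _; exact: dtr_id.
Qed.

Lemma tsnoc_le n (c : tchain le n) r (h : le (tlast c) r) (i j : 'I_n.+2) : (i <= j)%N ->
  le (if unlift ord_max i is Some i' then c i' else r)
     (if unlift ord_max j is Some j' then c j' else r).
Proof.
case: (unliftP ord_max j) => [j' ->|->]; case: (unliftP ord_max i) => [i' ->|->] //.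
- move=> ij; apply: tpt_le; move: ij (ltn_ord i') (ltn_ord j'); rewrite /= /bump; lia.
- by rewrite /= /bump; have := ltn_ord j'; rewrite /=; lia.
- by move=> _; apply: le_trans h; apply: (tpt_le c); exact: leq_ord.
Qed.

Definition tsnoc n (c : tchain le n) r (h : le (tlast c) r) : tchain le n.+1 :=
  Tchain (tsnoc_le h).

Lemma tsnoc_last n (c : tchain le n) r (h : le (tlast c) r) : tlast (tsnoc h) = r.
Proof. by rewrite /tlast /= unlift_none. Qed.

Lemma tsnoc_above n (c : tchain le n) (r : above (tlast c)) :
  rho (sval r) = sval r /\ le (tlast (tsnoc (proj2 (svalP r)))) (sval r).
Proof. by split; [exact: (proj1 (svalP r)) | rewrite tsnoc_last]. Qed.

Lemma tface_tsnoc_max n (c : tchain le n) r (h : le (tlast c) r) :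
  tface ord_max (tsnoc h) = c.
Proof. by apply: tchain_ext => i; rewrite /= liftK. Qed.

Lemma tface_tsnoc n (c : tchain le n.+1) r (h : le (tlast c) r) (k : 'I_n.+2)
  (h' : le (tlast (tface k c)) r) :
  tface (lift ord_max k) (tsnoc h) = tsnoc h'.
Proof.
apply: tchain_ext => i /=; case: (unliftP ord_max i) => [i' ->|->].
  have -> : lift (lift ord_max k) (lift ord_max i') = lift ord_max (lift k i').
    apply: val_inj; rewrite /= /bump; move: (ltn_ord k) (ltn_ord i') => /=; lia.
  by rewrite liftK.
have -> : lift (lift ord_max k) ord_max = ord_max.
  by apply: val_inj; rewrite /= /bump; move: (ltn_ord k) => /=; lia.
by rewrite unlift_none.
Qed.

(** The Godement complex has a contraction, given by extending chains: up to
    sign, the primitive of s has at a chain c the component at r of the value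
    of s at c extended by r. In the coboundary of s at the extended chain, the
    face omitting r gives back the value of s at c. *)
Lemma godement_acyclic : acyclic godement.
Proof.
move=> n s s0.
pose t (c : tchain le n) : godement (tlast c) := fun r : above (tlast c) =>
  (-1) ^+ n.+1 *: s (tsnoc (proj2 (svalP r))) (exist _ (sval r) (tsnoc_above r)).
exists t => c; apply: dprod_ext => -[r [rr rc]].
have sat c1 c2 (E : c1 = c2) (h1 : rho r = r /\ le (tlast c1) r) h2 :
    s c1 (exist _ r h1) = s c2 (exist _ r h2) :> F r.
  by case: _ / E in h2 *; exact: godement_at.
pose r' : above (tlast (tsnoc rc)) := exist _ r (tsnoc_above (exist _ r (conj rr rc))).
pose P := @dpr A (above (tlast (tsnoc rc))) (fun r => F (sval r)) r'.
have := congr1 P (s0 (tsnoc rc)).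
rewrite linear0 linear_sum big_ord_recr /= => /eqP.
rewrite addr_eq0 => /eqP E.
pose Q := @dpr A (above (tlast c)) (fun r => F (sval r)) (exist _ r (conj rr rc)).
rewrite -[LHS]/(Q _) linear_sum.
have h' k : le (tlast (tface k c)) r by exact: le_trans (tface_last_le _ _) rc.
transitivity ((-1) ^+ n.+1 *: \sum_(k < n.+2) P ((-1) ^+ k *:
   dtr godement (tface_last_le (widen_ord (leqnSn _) k) (tsnoc rc))
     (s (tface (widen_ord (leqnSn _) k) (tsnoc rc))))).
  rewrite scaler_sumr; apply: eq_bigr => k _.
  have Z (a b : A) (u v : F r) : u = v -> a *: (b *: u) = b *: (a *: v).
    by move=> ->; rewrite !scalerA mulrC.
  rewrite -[LHS]/((-1) ^+ k *: (t (tface k c) (above_sub (tface_last_le k c)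
    (exist _ r (conj rr rc))))).
  rewrite -[X in _ = _ *: X]/((-1) ^+ k *: (s (tface (widen_ord (leqnSn n.+2) k) (tsnoc rc))
    (above_sub (tface_last_le (widen_ord (leqnSn n.+2) k) (tsnoc rc)) r'))).
  rewrite /t; apply: (Z); apply: sat; rewrite -(tface_tsnoc rc).
  by congr tface; apply: val_inj; rewrite /= /bump; have := ltn_ord k; lia.
rewrite E scalerN -scaleN1r !scalerA -exprS -exprD -signr_odd.
have -> : odd (n.+2 + n.+2) = false by rewrite addnn odd_double.
rewrite scale1r; apply: sat; exact: tface_tsnoc_max.
Qed.

Section Fin.
Hypothesis finT : finite_type T.

Lemma godement_ob_dsum i :
  is_dsum (dinj (fun r : above i => F (sval r))) (dpr (fun r : above i => F (sval r))).
Proof. by apply: dprod_is_dsum; exact: finite_type_sub. Qed.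

Definition reps : Type := {r : T | rho r = r}.
Definition repF (r : reps) : lmodType A := F (sval r).

Definition rep_above i (r : above i) : reps := exist _ (sval r) (proj1 (svalP r)).
Definition rep_self (r : reps) : above (sval r) :=
  exist _ (sval r) (conj (svalP r) (le_refl _)).

Definition sections_godement_pr (r : reps) : {linear sections godement -> repF r} :=
  dpr (fun r' : above (sval r) => F (sval r')) (rep_self r) \o ev godement (sval r).

Definition sections_godement_fam (r : reps) (x : repF r) : dprod godement :=
  fun i => fun r' : above i => dinj repF r x (rep_above r').

Lemma rep_at (x : dprod repF) (r : T) (h h' : rho r = r) :
  x (exist _ r h) = x (exist _ r h') :> F r.
Proof. by rewrite (Prop_irrelevance h h'). Qed.

Lemma sections_godement_compat (r : reps) x : compatible (@sections_godement_fam r x).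
Proof. by move=> i j h; apply: dprod_ext => r'; exact: rep_at. Qed.

Lemma sections_godement_inj_linear (r : reps) : linear (fun x =>
  mk_sections (@sections_godement_compat r x)).
Proof.
move=> a x y; apply: sections_ext => i; apply: dprod_ext => r'.
by rewrite -[LHS]/(dinj repF r (a *: x + y) (rep_above r')) linearP.
Qed.

Definition sections_godement_inj (r : reps) : {linear repF r -> sections godement} :=
  lin (@sections_godement_inj_linear r).

Lemma ev_sections_godement i (x : sections godement) (r : above i) : ev godement i x r =
  sections_godement_pr (rep_above r) x.
Proof.
rewrite /= /dpr /=; case: x => x xc; case: r => r [rr ir] /=.
by rewrite -(xc i r ir); exact: godement_at.
Qed.

Lemma sections_godement_pr_inj (r r' : reps) x : sections_godement_pr r'
  (sections_godement_inj r x) = dinj repF r x r'.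
Proof. by case: r' => r' h; exact: rep_at. Qed.

(** A section of the Godement diagram is determined by its values at the
    representatives, which are arbitrary: the global sections are the product
    of the F r. *)
Lemma sections_godement_dsum : is_dsum sections_godement_inj sections_godement_pr.
Proof.
have [s sT] : finite_type reps by exact: finite_type_sub.
move=> v; exists s => s' us' ss'.
apply: sections_ext => i; apply: dprod_ext => r; rewrite !ev_sections_godement linear_sum.
under eq_bigr do rewrite sections_godement_pr_inj.
have := @dprod_dec _ _ repF (fun r => sections_godement_pr r v) s' us'.
move=> /(_ _)/(congr1 (fun f => f (rep_above r))) -> //; last first.
  by move=> j; rewrite ss' // sT.
rewrite -[LHS]/(dpr repF (rep_above r) _) linear_sum.
by apply: eq_bigr.
Qed.
End Fin.
End Ob.
End Godement.

(** * Sections of acyclic diagrams and tensor products *)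

Lemma count_lt (T : eqType) (p q : pred T) (s : seq T) (x : T) :
  subpred p q -> x \in s -> q x -> ~~ p x -> (count p s < count q s)%N.
Proof.
move=> pq + qx px; elim: s => //= y s IH; rewrite inE => /predU1P[<-|/IH lt].
  by rewrite qx (negPf px) add0n add1n ltnS; exact: sub_count.
by have := pq y; case: (p y) => [->|_] //; case: (q y) => //=; rewrite ?add0n ?add1n 1?ltnW.
Qed.

Section AcyclicFlat.
Variables (A : comPzRingType) (T : Type) (le : T -> T -> Prop).
Hypotheses (le_refl : forall i, le i i).
Hypothesis (le_trans : forall i j k, le i j -> le j k -> le i k).
Hypothesis finT : finite_type T.

Lemma representatives : exists rho : T -> T,
  [/\ forall i, le i (rho i), forall i, le (rho i) i &
      forall i j, le i j -> le j i -> rho i = rho j].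
Proof.
have [s sT] := finT.
pose p (i : {classic T}) : pred {classic T} := fun j => `[< le i j /\ le j i >].
pose rho (i : {classic T}) : {classic T} := nth i s (find (p i) s).
have has_p i : has (p i) s.
  by apply/hasP; exists (i : {classic T}); [exact: sT | apply/asboolP].
have rhoP i : p i (rho i) by apply: nth_find.
exists rho; split=> [i|i|i j ij ji].
- by have /asboolP[] := rhoP i.
- by have /asboolP[] := rhoP i.
have pE : p i = p j.
  apply: funext => k; apply/asboolP/asboolP => -[] le1 le2; split.
  - exact: le_trans ji le1.
  - exact: le_trans le2 ij.
  - exact: le_trans ij le1.
  - exact: le_trans le2 ji.
by rewrite /rho pE; apply: set_nth_default; rewrite -has_find.
Qed.

Definition tensor_compatible (F : diagram A le) (N : lmodType A)
    (t : forall i, tensor N (F i)) : Prop :=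
  forall i j (h : le i j), rmap N (dtr F h) (t i) = t j.

(** The second part says that N (x) - commutes with global sections: a
    compatible family of elements of the N (x) F i comes from exactly one
    element of N (x) sections F. This formulation does not require the
    tensored diagram. *)
Definition tensor_universal (F : diagram A le) : Prop :=
  flat_module (sections F) /\ forall N : lmodType A,
    (forall u, (forall i, rmap N (ev F i) u = 0) -> u = 0) /\
    (forall t, @tensor_compatible F N t -> exists u, forall i, rmap N (ev F i) u = t i).

Lemma tensor_universal_trivial (F : diagram A le) :
  (forall i (x : F i), x = 0) -> tensor_universal F.
Proof.
move=> F0; have G0 (x : sections F) : x = 0 by apply: sections_ext => i;
  rewrite [LHS]F0 linear0.
have tens_trivial (N V : lmodType A) (V0 : forall x : V, x =
  0) : forall t : tensor N V, t = 0.
  by apply: (@tensor_ext _ _ _ _ id (fun=> 0)) => // [t u|x y];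
    rewrite ?addr0 // (V0 y) tens0r.
split.
  by apply/flatP => N N' f fi; apply/lin_injP => t _; exact: tens_trivial.
move=> N; split=> [u _|t _]; first exact: tens_trivial.
by exists 0 => i; rewrite linear0; apply: esym; exact: tens_trivial.
Qed.

Section Step.
Variable rho : T -> T.
Hypotheses (rho_ge : forall i, le i (rho i)) (rho_le : forall i, le (rho i) i).
Hypothesis rho_eq : forall i j, le i j -> le j i -> rho i = rho j.
Variable F : diagram A le.
Hypotheses (flatF : forall i, flat_module (F i)) (aF : acyclic F).

Let G : diagram A le := godement le_trans rho F.
Let eta : diagram_hom F G := godement_eta le_trans rho F.
Let e : forall i, {linear G i -> F i} := godement_e le_trans rho_ge rho_le rho_eq F.
Let eK : forall i x, e i (eta i x) = x :=
  fun i x => godement_etaK le_refl le_trans rho_ge rho_le rho_eq x.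
Let Q : diagram A le := split_quot eK.
Let pi : diagram_hom G Q := sq_hom eK.

(** For the exact sequence 0 -> F -> G -> Q -> 0, with G the Godement diagram,
    sections remain exact since F is acyclic, and stay exact after tensoring
    since the sections of Q are flat. A compatible family in F is lifted to
    the sections of G, where the statement is clear, and its image in the
    sections of Q vanishes by uniqueness for Q. *)
Lemma tensor_universal_step : tensor_universal Q -> tensor_universal F.
Proof.
move=> [flatQ uQ].
have dG := sections_godement_dsum le_refl (le_trans := le_trans) (rho := rho) (F := F) finT.
have flatG : flat_module (sections G) by apply: flat_dsum dG _ => r; exact: flatF.
have surj := sections_map_split_surj le_refl le_trans (eK := eK) aF.
have ex y := @sections_map_split_exact _ _ _ _ _ eta e eK y.
have inj := @sections_map_split_inj _ _ _ _ _ eta e eK.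
have zero := @sections_map_split0 _ _ _ _ _ eta e eK.
have etainj N := flat_pure inj surj zero ex flatQ (N := N).
split; first exact: flat_ker inj surj zero ex flatQ flatG.
move=> N; split=> [u u0|t tc].
  apply: etainj; rewrite linear0; apply: (tensor_dsum_inj dG) => r.
  rewrite /rmap (tmap_sq (f2 := idfun) (f2' := idfun) (g2 := ev F (sval r))
    (g2' := dpr (fun r' : above le rho (sval r) =>
      F (sval r')) (rep_self le_refl r) \o eta (sval r))) //.
  by rewrite -/(rmap _ _) u0 linear0.
have [s sT] : finite_type (reps rho) by exact: finite_type_sub.
pose v := \sum_(r <- undup s) rmap N (sections_godement_inj le_trans F r) (t (sval r)).
have vE i : rmap N (ev G i) v = rmap N (eta i) (t i).
  apply: (tensor_dsum_eq (godement_ob_dsum (rho := rho) (F := F) finT (i := i))) => r.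
  pose r0 := rep_above r.
  rewrite /rmap (tmap_comp (f2 := idfun) (g2 := sections_godement_pr le_refl le_trans F
    r0)) //; last first.
    by move=> x; exact: ev_sections_godement.
  rewrite [RHS](tmap_comp (f2 := idfun) (g2 := dtr F (proj2 (svalP r)))) //.
  rewrite -/(rmap _ _) tc -/(rmap _ _) linear_sum (bigD1_seq (r0 : {classic (reps
    rho)})); first last.
  - exact: undup_uniq.
  - by rewrite mem_undup.
  rewrite big1 => [|r1 /eqP r1r0].
    rewrite [LHS]addr0 /rmap (tmap_comp (f2 := idfun) (g2 := idfun)) ?tmap_id // => x.
    by rewrite sections_godement_pr_inj dinjE.
  rewrite /rmap (tmap_comp (f2 := idfun) (g2 := sections_godement_pr le_refl le_trans F
    r0 \o sections_godement_inj le_trans F r1)) //.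
  by apply: rmap0 => x; apply: etrans (sections_godement_pr_inj le_refl le_trans r0 x) _;
    exact: dinjN.
have v0 : rmap N (sections_map pi) v = 0.
  apply: (uQ N).1 => i.
  rewrite /rmap (tmap_sq (f2 := idfun) (f2' := idfun) (g2 := ev G i) (g2' := pi i)) //.
  rewrite -/(rmap _ _) vE /rmap (tmap_comp (f2 := idfun) (g2 := pi i \o eta i)) //.
  by apply: rmap0 => x; exact: sq_pi_eta.
have [u uE] := tensor_right_exact surj ex v0.
exists u => i; have ei : injective (rmap N (eta i)).
  apply: (can_inj (g := rmap N (e i))) => x.
  by rewrite /rmap (tmap_comp (f2 := idfun) (g2 := idfun)) ?tmap_id.
apply: ei; rewrite -vE -uE.
by rewrite /rmap (tmap_sq (f2 := idfun) (f2' := idfun) (g2 := sections_map eta) (g2' :=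
  ev G i)).
Qed.

(** At a representative equivalent to i the kernel of the retraction has no
    component, so only the points strictly above i matter. *)
Lemma quotient_trivial i : (forall j, le i j -> ~ le j i -> forall x : F j, x = 0) ->
  forall x : Q i, x = 0.
Proof.
move=> F0 x; apply: (@sincl_inj _ _ _ (ker_submod (e i))); rewrite linear0.
apply: dprod_ext => -[r [rr ir]]; have [ri|nri] := pselect (le r i); last exact: F0.
have E : rho i = r by rewrite -rr; exact: rho_eq.
(* r is the representative of the class of i *)
case: _ / E in rr ir ri *.
have x0 : dtr F (rho_le i) (sincl (ker_submod (e i))
  x (above_rho rho_ge rho_le rho_eq i)) = 0.
  exact: lin_kerP x.
have := congr1 (dtr F ir) x0; rewrite linear0 (dtr_comp _ _ (le_refl _)) dtr_id => x1.
apply: etrans _ x1; exact: (godement_at (sincl (ker_submod (e i)) x : godement_ob rho F i)).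
Qed.

Lemma quotient_flat i : flat_module (Q i).
Proof.
apply: (@flat_retract _ _ _ (sq_inc e i) (sq_pi eK i)); first exact: sq_incK.
by apply: flat_dsum (godement_ob_dsum (rho := rho) (F := F) finT (i := i)) _ => r;
  exact: flatF.
Qed.

Lemma quotient_acyclic : acyclic Q.
Proof. by apply: split_quot_acyclic => //; exact: godement_acyclic. Qed.
End Step.

(** If every point of the support of F has at least n points above it, then
    every point of the support of the quotient of the Godement diagram by F
    has at least n + 1. Hence the diagram vanishes after finitely many steps. *)
Theorem acyclic_tensor_universal (F : diagram A le) :
  (forall i, flat_module (F i)) -> acyclic F -> tensor_universal F.
Proof.
move=> flatF aF; have [rho [rho_ge rho_le rho_eq]] := representatives.
have [s sT] := finT.
pose p (i : T) : pred {classic T} := fun j => `[< le i j >].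
pose cnt i := count (p i) s.
suff key k : forall F : diagram A le, (forall i, flat_module (F i)) -> acyclic F ->
    (forall i, (cnt i + k <= size s)%N -> forall x : F i, x = 0) -> tensor_universal F.
  (* with k greater than the number of points, the condition on the support
     is empty *)
  apply: (key (size s).+1) => // i; by rewrite addnS ltnNge leq_addl.
elim: k => {F flatF aF} [|k IH] F flatF aF F0.
  apply: tensor_universal_trivial => i; apply: F0; rewrite addn0; exact: count_size.
apply: (@tensor_universal_step rho rho_ge rho_le rho_eq) => //; apply: IH.
- by move=> i; exact: quotient_flat.
- exact: quotient_acyclic.
- move=> i ik; apply: quotient_trivial => j ij nji; apply: F0.
  rewrite addnS; apply: leq_trans ik; rewrite ltn_add2r.
  apply: (@count_lt _ _ _ s (i : {classic T})) => //.
  + by move=> l /asboolP jl; apply/asboolP; exact: le_trans ij jl.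
  + exact/asboolP.
  + by apply/asboolP.
Qed.
End AcyclicFlat.

(** * Base change along a pushout square of rings *)

Section Pushout.
Variables (A B C : comPzRingType) (phi : {rmorphism A -> B}) (gam : {rmorphism A -> C}).
Variables (D : lmodType B).
Variable k : {linear restrict_scalars gam C^o -> restrict_scalars phi D}.

Let B' : lmodType A := restrict_scalars phi B^o.
Let C' : lmodType A := restrict_scalars gam C^o.

Definition po_fun (b : B') (c : C') : restrict_scalars phi D := (b : B) *: (k c : D).

Lemma po_linl c : linear (po_fun^~ c).
Proof.
move=> a b b'; rewrite /po_fun -[a *: b + b' : B']/(phi a * (b : B) + (b' : B)).
by rewrite scalerDl -scalerA.
Qed.
Lemma po_linr b : linear (po_fun b).
Proof.
move=> a c c'; rewrite /po_fun linearP -[RHS]/(phi a *: (b *: (k c : D)) + b *: (k c' : D)).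
rewrite -[LHS]/((b : B) *: (phi a *: (k c : D) + (k c' : D))).
by rewrite scalerDr !scalerA [_ * phi a]mulrC.
Qed.

Definition po_map : {linear tensor B' C' -> restrict_scalars phi D} :=
  tensor_lin po_linl po_linr.

Lemma po_mapE b c : po_map (tens b c) = (b : B) *: (k c : D).
Proof. exact: tensor_linE. Qed.

Hypothesis po_bij : bijective po_map.
Variable N : lmodType B.
Let N' : lmodType A := restrict_scalars phi N.

Definition po_N_fun (n : N') (c : C') : restrict_scalars phi (tensor N D) :=
  tens (n : N) (k c : D).
Lemma po_N_linl c : linear (po_N_fun^~ c).
Proof. move=> a n n'; exact: (tens_linl (k c : D) (phi a) (n : N) n'). Qed.
Lemma po_N_linr n : linear (po_N_fun n).
Proof.
move=> a c c'; rewrite /po_N_fun linearP.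
exact: (tens_linr (n : N) (phi a) (k c : D) (k c' : D)).
Qed.

Definition po_N : {linear tensor N' C' -> restrict_scalars phi (tensor N D)} :=
  tensor_lin po_N_linl po_N_linr.

Lemma po_NE n c : po_N (tens n c) = tens (n : N) (k c : D).
Proof. exact: tensor_linE. Qed.

(** N (x)_A C = N (x)_B (B (x)_A C) = N (x)_B D; the inverse sends n (x) d to
    the image under b (x) c |-> b n (x) c of the preimage of d. *)
Lemma pushout_bij : bijective po_N.
Proof.
have [g gK Kg] := po_bij.
have gl : linear g by exact: can2_linear gK Kg.
pose gL : {linear restrict_scalars phi D -> tensor B' C'} := lin gl.
have mulL n : linear (fun b : B' => (b : B) *: (n : N) : N').
  by move=> a b b'; rewrite scalerDl -scalerA.
pose m n : {linear B' -> N'} := lin (mulL n).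
pose inv0 (n : N) (d : D) : tensor N' C' := lmap C' (m n) (gL d).
have mbL b : linear (fun b' : B' => b * (b' : B) : B').
  move=> a x y; rewrite -[a *: x + y : B']/(phi a * (x : B) + (y : B)).
  by rewrite mulrDr mulrCA.
pose mb b : {linear B' -> B'} := lin (mbL b).
have mbE b t : b *: (po_map t : D) = po_map (lmap C' (mb b) t).
  move: t; apply: tensor_ext => [t u|t u|b' c].
  - by rewrite linearD; exact: scalerDr.
  - by rewrite !linearD.
  - by rewrite lmapE !po_mapE; exact: scalerA.
have ib : balanced inv0.
  split=> [d n n'|n d d'|b n d]; last 1 first.
  - rewrite /inv0 -(Kg d); move: (g d) => t.
    rewrite -[gL (po_map t)]/(g (po_map t)) gK mbE.
    rewrite -[gL (po_map _)]/(g (po_map (lmap C' (mb b) t))) gK.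
    rewrite /lmap (tmap_comp (f2 := m (b *: n)) (g2 := idfun)) // => b'.
    by rewrite -[LHS]/((b * (b' : B)) *: n) mulrC -scalerA.
  - rewrite /inv0; move: (gL d); apply: tensor_ext => [t u|t u|b c].
    + exact: linearD.
    + by rewrite !linearD addrACA.
    + by rewrite !lmapE -tensDl; congr tens; exact: (scalerDr (b : B) (n : N) (n' : N)).
  - by rewrite /inv0 -linearD; congr (lmap C' (m n) _); exact: (linearD gL).
pose one : B' := (1 : B).
exists (tensor_lift inv0).
  apply: tensor_ext => [t u|t u|n c] //.
    by rewrite linearD; exact: (tensor_liftD ib).
  rewrite po_NE (tensor_liftE ib) /inv0.
  have -> : (k c : D) = po_map (tens one c) by rewrite po_mapE; exact: esym (scale1r _).
  rewrite -[gL (po_map _)]/(g (po_map (tens one c))) gK lmapE.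
  by congr tens; exact: (scale1r (n : N)).
apply: (@tensor_ext _ _ _ _ (po_N \o tensor_lift inv0) id) => [t u|t u //|n d] /=.
  by rewrite (tensor_liftD ib); exact: (linearD po_N).
rewrite (tensor_liftE ib) /inv0 -{2}(Kg d) -[gL d]/(g d); move: (g d).
apply: tensor_ext => [t u|t u|b c].
- by rewrite linearD; exact: (linearD po_N).
- by rewrite linearD; exact: tensDr.
- rewrite lmapE; apply: etrans (po_NE _ _) _; rewrite po_mapE.
  exact: tensZ.
Qed.
End Pushout.

(** * Modules given by their stalks *)

Section StalkModules.
Variable X : finRingedSpace.

(** The data of a sheaf of modules on a finite space: transition maps are
    semilinear along the restriction maps of the structure sheaf. *)
Record stalk_mod := StalkMod {
  stob :> forall p : X, lmodType (stalk p);
  str : forall (p q : X) (pq : spec_le p q), {linear stob p -> stob q | ores pq \; *:%R};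
  str_id : forall (p : X) (pp : spec_le p p) x, str pp x = x;
  str_comp : forall (p q r : X) (pq : spec_le p q) (qr : spec_le q r) (pr : spec_le p r) x,
    str qr (str pq x) = str pr x
}.

Lemma str_semi (F : stalk_mod) (p q : X) (pq : spec_le p q) a x y :
  str F pq (a *: x + y) = ores pq a *: str F pq x + str F pq y.
Proof. by rewrite linearP. Qed.
Lemma strD (F : stalk_mod) (p q : X) (pq : spec_le p q) x y :
  str F pq (x + y) = str F pq x + str F pq y.
Proof. exact: raddfD. Qed.
Lemma str0 (F : stalk_mod) (p q : X) (pq : spec_le p q) : str F pq 0 = 0.
Proof. exact: raddf0. Qed.
Lemma strZ (F : stalk_mod) (p q : X) (pq : spec_le p q) a x :
  str F pq (a *: x) = ores pq a *: str F pq x.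
Proof. exact: linearZ. Qed.

Definition stalks (M : omodule X) : stalk_mod :=
  @StalkMod (mstalk M) (fun p q pq => mres M pq)
   (fun p pp x => mres_id pp x) (fun p q r pq qr pr x => mres_comp pq qr pr x).

Definition stalk_O : stalk_mod := stalks (structure_module X).

Definition stalk_qc (F : stalk_mod) : Prop :=
  forall (p q : X) (pq : spec_le p q), bijective (base_change (str F pq)).

Definition flat_at (F : stalk_mod) (p : X) : Prop := flat_module (F p).

Record stalk_hom (F G : stalk_mod) := StalkHom {
  stnt :> forall p : X, {linear F p -> G p};
  stalk_natural : forall (p q : X) (pq : spec_le p q) x, stnt q (str F pq x) =
    str G pq (stnt p x)
}.

Definition pts (U : opens X) : Type := {y : X | oset U y}.
Definition pts_le (U : opens X) (i j : pts U) : Prop := spec_le (sval i) (sval j).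

Lemma pts_le_refl U (i : pts U) : pts_le i i. Proof. exact: spec_le_refl. Qed.
Lemma pts_le_trans U (i j k : pts U) : pts_le i j -> pts_le j k -> pts_le i k.
Proof. exact: spec_le_trans. Qed.

Lemma finite_points : finite_type (space X).
Proof.
have /finite_seqP[s sE] := fin_spaceP X.
exists s => p; have : [set` s] (p : X) by rewrite -sE.
by move=> /(nthP p)[i ilt <-]; exact: (@mem_nth {classic X}).
Qed.

Lemma finite_pts U : finite_type (pts U).
Proof. by apply: finite_type_sub; exact: finite_points. Qed.

Section Restr.
Variables (W U : opens X) (sub : U `<=` W) (F : stalk_mod).

Definition pts_sub (i : pts U) : min_open (sval i) `<=` W :=
  subset_trans (min_open_sub (svalP i)) sub.

Arguments pts_sub : clear implicits.

Definition restr_ob (i : pts U) : lmodType (osec X W) :=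
  restrict_scalars (ores (pts_sub i)) (F (sval i)).

Lemma restr_tr_linear (i j : pts U) (h : pts_le i j) :
  linear (str F h : restr_ob i -> restr_ob j).
Proof.
move=> a x y; apply: etrans (str_semi _ _ _ _) _; congr (_ + _).
by congr (_ *: _); exact: ores_comp.
Qed.

(** The stalks over U as a diagram of modules over the single ring O(W); its
    sections are those of F over U, with scalars in O(W). *)
Definition restr : diagram (osec X W) (@pts_le U) :=
  @Diagram (osec X W) (pts U) (@pts_le U) restr_ob (fun i j h =>
    lin (@restr_tr_linear i j h))
   (fun i h x => str_id h x) (fun i j k ij jk ik x => str_comp ij jk ik x).

Definition sections_on : lmodType (osec X W) := sections restr.

End Restr.
Arguments pts_sub [W U] sub i _ _.

Lemma rebase_compat (W W' U : opens X) (sub : U `<=` W) (sub' : U `<=` W') (F : stalk_mod)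
  (x : sections_on sub F) : compatible ((fun i =>
    ev (restr sub F) i x) : dprod (restr sub' F)).
Proof. by move=> i j h; exact: (ev_compat h x). Qed.

(** The same sections over U, seen over another ring: those over U_px are
    modules over A_p and over A_x alike. *)
Definition rebase (W W' U : opens X) (sub : U `<=` W) (sub' : U `<=` W') (F : stalk_mod)
  (x : sections_on sub F) : sections_on sub' F :=
    mk_sections (@rebase_compat W W' U sub sub' F x).

Lemma rebaseK (W W' U : opens X) (sub : U `<=` W) (sub' : U `<=` W') (F : stalk_mod) :
  cancel (rebase sub' (F := F) (sub := sub)) (rebase sub (F := F) (sub := sub')).
Proof. by move=> x; apply: sections_ext. Qed.

Section Push.
Variables (V : opens X) (F : stalk_mod).

Definition push_sub (p : X) : opensI (min_open p) V `<=` min_open p := @subIsetl _ _ _.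

Arguments push_sub : clear implicits.

(** The stalk at p of j_* j^* F, for j the inclusion of V, is the module of
    sections over the intersection of U_p and V. *)
Definition push_ob (p : X) : lmodType (stalk p) := sections_on (push_sub p) F.

Definition push_pt (p q : X) (pq : spec_le p q) (i : pts (opensI (min_open q) V)) :
  pts (opensI (min_open p) V) :=
  exist _ (sval i) (conj (pq _ (proj1 (svalP i))) (proj2 (svalP i))).

Lemma push_compat (p q : X) (pq : spec_le p q) (x : push_ob p) :
  compatible ((fun i => ev (restr (push_sub p) F) (push_pt pq i) x)
    : dprod (restr (push_sub q) F)).
Proof.
move=> i j h.
exact: (@ev_compat _ _ _ (restr (push_sub p) F) (push_pt pq i) (push_pt pq j) h x).
Qed.

Lemma restr_scaleE (W U : opens X) (sub : U `<=` W) (G : stalk_mod) i (a : osec X W)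
  (x : restr sub G i) :
  a *: x = (ores (pts_sub sub i) a *: (x : G (sval i))).
Proof. by []. Qed.

Lemma push_tr_linear (p q : X) (pq : spec_le p q) :
  linear_for (ores pq \; *:%R) (fun x => mk_sections (@push_compat p q pq x) : push_ob q).
Proof.
move=> a x y; apply: sections_ext => i.
apply: etrans (linearP (ev (restr (push_sub p) F) (push_pt pq i)) _ _ _) _.
apply: etrans _ (esym (linearP (ev (restr (push_sub q) F) i) _ _ _)).
congr (_ + _).
have E : ores (pts_sub (push_sub p) (push_pt pq i)) a =
  ores (pts_sub (push_sub q) i) (ores pq a).
  by apply: esym; exact: ores_comp.
exact: (congr1 (fun c : stalk (sval i) =>
  c *: (ev (restr (push_sub p) F) (push_pt pq i) x : F (sval i))) E).
Qed.

Definition push_tr (p q : X) (pq : spec_le p q) :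
  {linear push_ob p -> push_ob q | ores pq \; *:%R} := slin (@push_tr_linear p q pq).

Definition pev (p : X) (i : pts (opensI (min_open p) V)) (x : push_ob p) : F (sval i) :=
  ev (restr (push_sub p) F) i x.

Lemma pts_ext (U : opens X) (i j : pts U) : sval i = sval j -> i = j.
Proof.
case: i j => [i h] [j h'] /= E; case: _ / E in h' *.
by congr exist; exact: Prop_irrelevance.
Qed.

Lemma pev_at (p y : X) (x : push_ob p) h h' :
  pev (exist _ y h) x = pev (exist _ y h') x :> F y.
Proof. by rewrite (Prop_irrelevance h h'). Qed.

Lemma push_tr_id (p : X) (pp : spec_le p p) x : push_tr pp x = x.
Proof. by apply: sections_ext => -[y h]; exact: pev_at. Qed.
Lemma push_tr_comp (p q r : X) (pq : spec_le p q) (qr : spec_le q r) (pr : spec_le p r) x :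
  push_tr qr (push_tr pq x) = push_tr pr x.
Proof. by apply: sections_ext => -[y h]; exact: pev_at. Qed.

Definition push : stalk_mod := StalkMod push_tr_id push_tr_comp.

Lemma push_ext (p : X) (x y : push p) : (forall i, pev i x = pev i y) -> x = y.
Proof. by move=> E; apply: (@sections_ext _ _ _ (restr (push_sub p) F)). Qed.

End Push.
Arguments push_sub : clear implicits.

Section Mult.
Variables (b : X) (U : opens X) (sub : U `<=` min_open b) (F : stalk_mod).

Definition base_le (i : pts U) : spec_le b (sval i) := pts_sub sub i.
Arguments base_le : clear implicits.

Lemma mult_compat (f : F b) (s : sections_on sub stalk_O) :
  compatible ((fun i => (ev (restr sub stalk_O) i s : stalk (sval i))
    *: str F (base_le i) f)
    : dprod (restr sub F)).
Proof.
move=> i j h; apply: etrans (strZ _ _ _) _.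
have -> : ores h (ev (restr sub stalk_O) i s : stalk (sval i)) = ev (restr sub stalk_O) j s.
  exact: (ev_compat h s).
by congr (_ *: _); exact: str_comp.
Qed.

Definition mult_fun (f : F b) (s : sections_on sub stalk_O) : sections_on sub F :=
  mk_sections (mult_compat f s).

Lemma mult_linl s : linear (mult_fun^~ s).
Proof.
move=> a f f'; apply: sections_ext => i.
apply: etrans _ (esym (linearP (ev (restr sub F) i) _ _ _)).
rewrite restr_scaleE; rewrite -[LHS]/((ev (restr sub stalk_O) i s : stalk (sval i))
  *: str F (base_le i) (a *: f + f')).
by rewrite str_semi scalerDr !scalerA mulrC.
Qed.
Lemma mult_linr f : linear (mult_fun f).
Proof.
move=> a s s'; apply: sections_ext => i.
apply: etrans _ (esym (linearP (ev (restr sub F) i) _ _ _)).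
rewrite restr_scaleE; rewrite -[LHS]/((ev (restr sub stalk_O) i (a *: s +
  s') : stalk (sval i)) *: str F (base_le i) f).
rewrite linearP -[X in X *: _]/((ores (pts_sub sub i) a : stalk (sval i))
  * (ev (restr sub stalk_O) i s : stalk (sval i)) + ev (restr sub stalk_O) i s').
by rewrite scalerDl scalerA.
Qed.

Definition mult : {linear tensor (F b) (sections_on sub stalk_O) -> sections_on sub F} :=
  tensor_lin mult_linl mult_linr.

Lemma multE f s i : ev (restr sub F) i (mult (tens f s)) =
  (ev (restr sub stalk_O) i s : stalk (sval i)) *: str F (base_le i) f.
Proof. by rewrite /mult tensor_linE. Qed.

Lemma base_changeD (A B : comPzRingType) (phi : {rmorphism A -> B}) (M : lmodType A)
  (N : lmodType B) (f : {linear M -> N | phi \;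
    *:%R}) : {morph base_change f : t u / t + u}.
Proof. exact: tensor_liftD (base_change_balanced f). Qed.

Lemma ev_mult t i : ev (restr sub F) i (mult t) =
  base_change (str F (base_le i)) (rmap (F b) (ev (restr sub stalk_O) i) t).
Proof.
move: t; apply: tensor_ext => [t u|t u|f s].
- by rewrite !linearD.
- by rewrite linearD base_changeD.
- by rewrite multE rmapE base_changeE.
Qed.

Hypothesis qcF : stalk_qc F.
Hypothesis uO : tensor_universal (restr sub stalk_O).

(** The stalk of F at y is F_b (x) A_y by quasi-coherence, so the sections of
    F over U are the compatible families in the F_b (x) A_y, to which the
    universal property of the sections of O applies. *)
Lemma mult_bij : bijective mult.
Proof.
have [_ /(_ (F b))[u0 uex]] := uO.
have bc_inj i : injective (base_change (str F (base_le i))) by exact: bij_inj.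
have inj : injective mult.
  apply/lin_injP => t t0; apply: u0 => i; apply: bc_inj.
  rewrite -ev_mult t0 linear0.
  by apply: esym; apply: (addrI (base_change (str F (base_le i)) 0));
    rewrite -base_changeD !addr0.
have surj y : {x | mult x = y}.
  apply: cid.
  have tP i : {t | base_change (str F (base_le i)) t = ev (restr sub F) i y}.
    apply: cid; have [g gK Kg] := qcF (base_le i).
    by exists (g (ev (restr sub F) i y)).
  pose t i := sval (tP i).
  have tE i : base_change (str F (base_le i)) (t i) = ev (restr sub F) i y := svalP (tP i).
  have [i j h|x xE] := uex t; last first.
    by exists x; apply: sections_ext => i; rewrite ev_mult xE tE.
  apply: bc_inj; rewrite tE -(ev_compat h y) -tE; move: (t i).
  apply: tensor_ext => [v w|v w|f c].
  - by rewrite linearD base_changeD.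
  - by rewrite base_changeD linearD.
  - rewrite rmapE !base_changeE; apply: esym; apply: etrans (strZ _ _ _) _.
    by congr (_ *: _); exact: str_comp.
exists (fun y => sval (surj y)) => [x|y]; last exact: (svalP (surj y)).
by apply: inj; exact: (svalP (surj _)).
Qed.
End Mult.
Arguments base_le [b U] sub i _ _.
End StalkModules.
Arguments pts_sub {X W U} sub i _ _.
Arguments base_le {X b U} sub i _ _.
Arguments push_sub {X} V p _ _.

(** * Base change of sections over intersections of basic open sets *)

Lemma tensor_dsum_injl (A : comPzRingType) (I : Type) (V : lmodType A) (F : I -> lmodType A)
  (inj : forall i, {linear F i -> V}) (pr : forall i, {linear V -> F i})
  (dec : is_dsum inj pr) (N : lmodType A) (t : tensor V N) :
  (forall i, lmap N (pr i) t = 0) -> t = 0.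
Proof.
move=> t0; apply: (can_inj (@tswapK _ _ _)); rewrite linear0.
apply: (tensor_dsum_inj dec) => i.
by rewrite /rmap -tswap_map -/(lmap N (pr i)) t0 linear0.
Qed.

Lemma lmap_bij (A : comPzRingType) (M M' N : lmodType A) (f : {linear M -> M'}) :
  bijective f -> bijective (lmap N f).
Proof.
case=> g fK gK; have gl : linear g by exact: can2_linear fK gK.
exists (lmap N (lin gl)) => t; rewrite /lmap.
  by rewrite (tmap_comp (f2 := idfun) (g2 := idfun)) ?tmap_id.
by rewrite (tmap_comp (f2 := idfun) (g2 := idfun)) ?tmap_id.
Qed.

Lemma base_change0 (A B : comPzRingType) (phi : {rmorphism A -> B}) (M : lmodType A)
  (N : lmodType B) (f : {linear M -> N | phi \; *:%R}) : base_change f 0 = 0.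
Proof. by apply: (addrI (base_change f 0)); rewrite -base_changeD !addr0. Qed.

Lemma base_change_inj (A B : comPzRingType) (phi : {rmorphism A -> B}) (M : lmodType A)
  (N : lmodType B) (f : {linear M -> N | phi \; *:%R}) :
  injective (base_change f) <-> forall t, base_change f t = 0 -> t = 0.
Proof.
split=> [bi t t0|b0 t u E]; first by apply: bi; rewrite t0 base_change0.
apply/eqP; rewrite -subr_eq0; apply/eqP/b0; apply: (addIr (base_change f u)).
by rewrite -base_changeD subrK add0r.
Qed.

Section SemiSeparated.
Variable X : finRingedSpace.
Hypothesis finX : finite_space X.
Hypothesis acyO : forall (p x : X) (W : opens X)
  (sub : opensI (min_open p) (min_open x) `<=` W), acyclic (restr sub (stalk_O X)).
Hypothesis qcO : forall x : X, stalk_qc (push (min_open x) (stalk_O X)).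

Local Notation O := (stalk_O X).

Lemma tensor_universal_O (b p x : X) (sub : opensI (min_open p) (min_open x)
  `<=` min_open b) :
  tensor_universal (restr sub O).
Proof.
apply: acyclic_tensor_universal.
- exact: pts_le_refl.
- exact: pts_le_trans.
- exact: finite_pts.
- move=> i; have H := @finX b (sval i) (base_le sub i).
refine H.
- exact: acyO.
Qed.

Section PairBaseChange.
Variables (p y q : X) (py : spec_le p y) (pq : spec_le p q).
Local Notation V := (min_open q).
Local Notation Aq := (restrict_scalars (ores pq) (stalk q)^o).

Lemma diag_sec_compat (z : X) (c : stalk q) : compatible
  ((fun i : pts (opensI (min_open z) V) => ores (min_open_sub (proj2 (svalP i))) c)
   : dprod (restr (push_sub V z) O)).
Proof. by move=> i j h; exact: ores_comp. Qed.

Definition sec_restr (z : X) (c : stalk q) : push V O z :=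
  mk_sections (@diag_sec_compat z c).

Lemma sec_restr_linear : linear (sec_restr p : Aq -> push V O p).
Proof.
move=> a c c'; apply: push_ext => i.
apply: etrans _ (esym (linearP (ev (restr (push_sub V p) O) i) _ _ _)).
rewrite -[LHS]/(ores (min_open_sub (proj2 (svalP i))) (ores pq a * (c : stalk q) +
  (c' : stalk q))).
rewrite rmorphD rmorphM; congr (_ * _ + _).
by apply: ores_comp.
Qed.

Definition sec_lin : {linear Aq -> push V O p} := lin sec_restr_linear.

Lemma pt_q : oset (opensI (min_open p) V) q.
Proof. by split; [exact: (proj1 (spec_leP p q) pq) | exact: min_open_refl]. Qed.

(** The intersection of U_p and U_q is U_q, since p <= q. *)
Lemma sec_bij : bijective sec_lin.
Proof.
exists (fun s : push V O p => pev (exist _ q pt_q) s : stalk q) => [c|s];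
  first exact: ores_id.
apply: push_ext => -[z h].
have qz : spec_le q z by exact: min_open_sub (proj2 h).
apply: etrans (ev_compat (F := restr (push_sub V p) O) (i := exist _ q pt_q) (j :=
  exist _ z h) qz s).
by congr (ores _ _); exact: Prop_irrelevance.
Qed.

Lemma sec_y_linear :
  linear ((fun c => str (push V O) py (sec_lin c)) : Aq ->
    restrict_scalars (ores py) (push V O y)).
Proof. by move=> a c c'; rewrite linearP; exact: str_semi. Qed.

Definition sec_y : {linear Aq -> restrict_scalars (ores py) (push V O y)} :=
  lin sec_y_linear.

(** Together with the identification of A_q with O(U_pq), the base change of
    O(U_pq) from p to y reads A_y (x)_{A_p} A_q = O(U_yq). *)
Lemma sec_po_bij : bijective (po_map sec_y).
Proof.
pose By := restrict_scalars (ores py) (stalk y)^o.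
pose w t := lmap By sec_lin (tswap By Aq t).
have wb : bijective w.
  apply: (@bij_comp _ _ _ (lmap By sec_lin) (tswap By Aq)); first exact: lmap_bij sec_bij.
  by exists (tswap _ _); exact: tswapK.
apply: (@eq_bij _ _ (base_change (str (push V O) py) \o w)).
  by apply: bij_comp wb; exact: qcO.
apply: tensor_ext => [t u|t u|b c]; rewrite -?[LHS]/(base_change _ (w _)).
- by rewrite /w !linearD base_changeD.
- exact: linearD.
- rewrite po_mapE /w tswapE lmapE; exact: base_changeE.
Qed.

Variable F : stalk_mod X.
Hypothesis qcF : stalk_qc F.

Definition pair_map : tensor (restrict_scalars (ores py) (F y)) Aq -> push V F y :=
  fun t => mult (push_sub V y) F (po_N sec_y (F y) t).

Lemma pair_mapD : {morph pair_map : t u / t + u}.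
Proof. by move=> t u; rewrite /pair_map (linearD (po_N _ _)); exact: linearD. Qed.

Lemma pair_mapE (f : F y) (c : Aq) i : pev i (pair_map (tens (f : restrict_scalars (ores
  py) (F y)) c)) =
  ores (min_open_sub (proj2 (svalP i))) (c : stalk q) *: str F (base_le (push_sub V y) i) f.
Proof.
rewrite /pair_map po_NE; apply: etrans (multE _ _ _) _.
have E : ores (min_open_sub (proj2 (svalP (push_pt py i)))) (c : stalk q) =
    ores (min_open_sub (proj2 (svalP i))) (c : stalk q).
  by congr (ores _ _); exact: Prop_irrelevance.
exact: (congr1 (fun a : stalk (sval i) => a *: str F (base_le (push_sub V y) i) f) E).
Qed.

(** F_y (x)_{A_p} A_q = F_y (x)_{A_y} O(U_yq) = F(U_yq), combining pushout_bij
    with mult_bij. *)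
Lemma pair_map_inj : injective pair_map.
Proof.
have [_ mb _ _] : [/\ True, injective (mult (push_sub V y) F), True & True].
  split=> //; apply: bij_inj; apply: mult_bij => //; exact: tensor_universal_O.
by move=> t u /mb; apply: bij_inj; apply: pushout_bij; exact: sec_po_bij.
Qed.
End PairBaseChange.

(** F(U_px) embeds into the product of the F_y for y in U_px; as A_q is flat
    over A_p, it is enough to see that the component of t in F_y (x) A_q
    vanishes, and this module embeds into F(U_yq) by pair_map_inj. *)
Lemma push_base_change_inj (F : stalk_mod X) (x : X) (p q : X) (pq : spec_le p q) :
  stalk_qc F -> injective (base_change (str (push (min_open x) F) pq)).
Proof.
move=> qcF; apply/base_change_inj => t t0.
pose V := min_open x; pose R := restr (push_sub V p) F.
have ty (y : pts (opensI (min_open p) V)) : lmap _ (ev R y) t = 0.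
  have py : spec_le p (sval y) := base_le (push_sub V p) y.
  have /(_ _ _) inj := @pair_map_inj p (sval y) q (base_le (push_sub V p) y) pq F qcF.
  apply: inj.
  pose pm := @pair_map p (sval y) q (base_le (push_sub V p) y) pq F.
  rewrite -[LHS]/(pm _) -[RHS]/(pm 0).
  have pmD : {morph pm : t u / t + u} by exact: pair_mapD.
  have -> : pm 0 = 0 by apply: (addrI (pm 0)); rewrite -pmD !addr0.
  apply: push_ext => -[z [yz qz]].
  have /spec_leP xz : spec_le x z by apply: (spec_le_trans (q := sval y));
    apply/spec_leP; [exact: (proj2 (svalP y)) | exact: yz].
  have h : oset (opensI (min_open q) V) z by [].
  transitivity (pev (exist _ z h) (base_change (str (push V F) pq) t)); last first.
    by rewrite t0; exact: (linear0 (ev (restr (push_sub V q) F) (exist _ z h))).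
  move: t {t0}; apply: tensor_ext => [t u|t u|f c].
  - by rewrite linearD pmD; exact: linearD.
  - by rewrite base_changeD; exact: (linearD (ev (restr (push_sub V q) F) (exist _ z h))).
  - rewrite lmapE base_changeE.
    have E := @pair_mapE p (sval y) q (base_le (push_sub V p) y) pq F (ev R y f) c
      (exist _ z (conj yz qz)).
    apply: etrans E _; apply: esym.
    have E' := linearZ_LR (ev (restr (push_sub V q) F) (exist _ z h)) (c : stalk q)
      (str (push V F) pq f).
    apply: etrans E' _.
    have E2 := @ev_compat _ _ _ R y (push_pt pq (exist _ z h))
      (base_le (push_sub (min_open q) (sval y)) (exist _ z (conj yz qz))) f.
    pose i : pts (opensI (min_open (sval y)) (min_open q)) := exist _ z (conj yz qz).
    have E1 : ores (pts_sub (push_sub V q) (exist _ z h)) c =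
      ores (min_open_sub (proj2 (svalP i))) (c : stalk q).
      by congr (ores _ _); exact: Prop_irrelevance.
    exact: (congr2 (fun (a : stalk z) (g : F z) => a *: g) E1 (esym E2)).
have fl : flat_module (restrict_scalars (ores pq) (stalk q)^o) by exact: finX.
have /lin_injP := proj1 (flatP _) fl _ _ (sincl (@compatible_submod _ _ _ R))
  (@sincl_inj _ _ _ _).
apply; apply: (tensor_dsum_injl (dprod_is_dsum (F := R) (finite_pts _))) => y.
by rewrite /lmap (tmap_comp (f2 := ev R y) (g2 := idfun)).
Qed.
End SemiSeparated.

(** * Direct sums and kernels of stalk modules *)

Section StalkModConstructions.
Variable X : finRingedSpace.

Section Dsum.
Variables (I : Type) (F : I -> stalk_mod X).

Definition stalk_dsum_ob (p : X) : lmodType (stalk p) := dsum (fun i => F i p).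

Lemma stalk_dsum_supp (p q : X) (pq : spec_le p q) (x : stalk_dsum_ob p) :
  fin_supp ((fun i => str (F i) pq (dsum_pr _ i x)) : dprod (fun i => F i q)).
Proof.
have [s xs] := subvalP x; exists s => i /xs x0.
by rewrite -[RHS](str0 (F i) pq); congr (str _ _ _).
Qed.

Definition stalk_dsum_tr_fun (p q : X) (pq : spec_le p q) (x : stalk_dsum_ob p)
  : stalk_dsum_ob q :=
  SubmodOf (stalk_dsum_supp pq x).

Lemma stalk_dsum_trE (p q : X) (pq : spec_le p q) (x : stalk_dsum_ob p) i :
  dsum_pr _ i (stalk_dsum_tr_fun pq x) = str (F i) pq (dsum_pr _ i x).
Proof. by []. Qed.

Lemma stalk_dsum_tr_linear (p q : X) (pq : spec_le p q) :
  linear_for (ores pq \; *:%R) (@stalk_dsum_tr_fun p q pq).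
Proof.
move=> a x y; apply: dsum_ext => i.
apply: etrans _ (esym (linearP (dsum_pr _ i) _ _ _)).
exact: (str_semi (F := F i) pq a (dsum_pr _ i x) (dsum_pr _ i y)).
Qed.

Definition stalk_dsum_tr (p q : X) (pq : spec_le p q) :
  {linear stalk_dsum_ob p -> stalk_dsum_ob q | ores pq \;
    *:%R} := slin (@stalk_dsum_tr_linear p q pq).

Lemma stalk_dsum_tr_id (p : X) (pp : spec_le p p) x : stalk_dsum_tr pp x = x.
Proof. by apply: dsum_ext => i; exact: str_id. Qed.
Lemma stalk_dsum_tr_comp (p q r : X) (pq : spec_le p q) (qr : spec_le q r)
  (pr : spec_le p r) x :
  stalk_dsum_tr qr (stalk_dsum_tr pq x) = stalk_dsum_tr pr x.
Proof. by apply: dsum_ext => i; exact: str_comp. Qed.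

Definition stalk_dsum : stalk_mod X := StalkMod stalk_dsum_tr_id stalk_dsum_tr_comp.

Lemma str_dsum_inj (p q : X) (pq : spec_le p q) i (x : F i p) :
  str stalk_dsum pq (dsum_inj (fun i => F i p) i x) = dsum_inj (fun i =>
    F i q) i (str (F i) pq x).
Proof.
apply: dsum_ext => j; rewrite [LHS]stalk_dsum_trE.
have [ij|ij] := pselect (i = j); last by rewrite !dsum_prE // str0.
by case: _ / ij; rewrite !dsum_prK.
Qed.

Lemma stalk_dsum_qc : (forall i, stalk_qc (F i)) -> stalk_qc stalk_dsum.
Proof.
move=> qcF p q pq.
pose bc := base_change (str stalk_dsum pq); pose bci i := base_change (str (F i) pq).
have bc_pr i t : dsum_pr _ i (bc t) = bci i (lmap _ (dsum_pr _ i) t).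
  move: t; apply: tensor_ext => [t u|t u|x c].
  - by rewrite /bc base_changeD; exact: (linearD (dsum_pr _ i)).
  - by rewrite linearD /bci base_changeD.
  - rewrite lmapE /bc /bci !base_changeE; exact: (linearZ_LR (dsum_pr _ i)).
have bc_inj i t : bc (lmap _ (dsum_inj (fun i => F i p) i) t) = dsum_inj _ i (bci i t).
  move: t; apply: tensor_ext => [t u|t u|x c].
  - by rewrite linearD /bc base_changeD.
  - by rewrite /bci base_changeD; exact: (linearD (dsum_inj _ i)).
  - rewrite lmapE /bc /bci !base_changeE str_dsum_inj; apply: esym.
    exact: (linearZ_LR (dsum_inj _ i)).
have inj : injective bc.
  apply/base_change_inj => t t0; apply: (tensor_dsum_injl (dsum_is_dsum (F := fun i =>
    F i p))) => i.
  have /base_change_inj := bij_inj (qcF i p q pq); apply.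
  by rewrite -[LHS]bc_pr /bc t0; exact: (linear0 (dsum_pr _ i)).
have surj y : {t | bc t = y}.
  apply: cid; have [s /(_ (undup s) (undup_uniq _))] := dsum_is_dsum y.
  move=> -> => [|i]; last by rewrite mem_undup.
  elim: (undup s) => [|i r [t tE]]; first by exists 0; rewrite big_nil /bc base_change0.
  have [g gK Kg] := qcF i p q pq.
  exists (lmap _ (dsum_inj (fun i => F i p) i) (g (dsum_pr (fun i => F i q) i y)) + t).
  by rewrite big_cons /bc base_changeD -[base_change _ t]/(bc t)
    tE -[base_change _ _]/(bc _) bc_inj /bci Kg.
exists (fun y => sval (surj y)) => [x|y]; last exact: (svalP (surj y)).
by apply: inj; exact: (svalP (surj _)).
Qed.

Section Out.
Variables (G : stalk_mod X) (g : forall i, stalk_hom (F i) G).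

Lemma stalk_dsum_out_natural (p q : X) (pq : spec_le p q) x :
  dsum_out (fun i => g i q) (str stalk_dsum pq x) = str G pq (dsum_out (fun i => g i p) x).
Proof.
move: x; apply: (@dsum_out_ext _ _ (fun i => F i p)) => [x y|x y|i x].
- by rewrite strD linearD.
- by rewrite linearD strD.
- by rewrite str_dsum_inj !dsum_out_inj stalk_natural.
Qed.

Definition stalk_dsum_out : stalk_hom stalk_dsum G := StalkHom stalk_dsum_out_natural.
End Out.
End Dsum.

Section Kernel.
Variables (E H : stalk_mod X) (f : stalk_hom E H).

Definition stalk_ker_ob (p : X) : lmodType (stalk p) := lin_ker (f p).
Definition stalk_ker_inc (p : X) : {linear stalk_ker_ob p -> E p} :=
  sincl (ker_submod (f p)).

Lemma stalk_ker_tr_ker (p q : X) (pq : spec_le p q) (x : stalk_ker_ob p) :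
  f q (str E pq (stalk_ker_inc p x)) = 0.
Proof. by rewrite stalk_natural lin_kerP str0. Qed.

Definition stalk_ker_tr_fun (p q : X) (pq : spec_le p q) (x : stalk_ker_ob p)
  : stalk_ker_ob q :=
  SubmodOf (stalk_ker_tr_ker pq x).

Lemma stalk_ker_tr_linear (p q : X) (pq : spec_le p q) :
  linear_for (ores pq \; *:%R) (@stalk_ker_tr_fun p q pq).
Proof.
move=> a x y; apply: subval_inj; apply: etrans (str_semi pq a _ _) _.
by [].
Qed.

Definition stalk_ker_tr (p q : X) (pq : spec_le p q) :
  {linear stalk_ker_ob p -> stalk_ker_ob q | ores pq \;
    *:%R} := slin (@stalk_ker_tr_linear p q pq).

Lemma stalk_ker_tr_id (p : X) (pp : spec_le p p) x : stalk_ker_tr pp x = x.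
Proof. by apply: subval_inj; exact: str_id. Qed.
Lemma stalk_ker_tr_comp (p q r : X) (pq : spec_le p q) (qr : spec_le q r)
  (pr : spec_le p r) x :
  stalk_ker_tr qr (stalk_ker_tr pq x) = stalk_ker_tr pr x.
Proof. by apply: subval_inj; exact: str_comp. Qed.

Definition stalk_ker : stalk_mod X := StalkMod stalk_ker_tr_id stalk_ker_tr_comp.

Definition stalk_ker_hom : stalk_hom stalk_ker E :=
  @StalkHom X stalk_ker E stalk_ker_inc (fun p q pq x => erefl).
End Kernel.

Lemma base_change_nat (F G : stalk_mod X) (g : stalk_hom F G) (p q : X)
  (pq : spec_le p q) t :
  g q (base_change (str F pq) t) = base_change (str G pq) (lmap _ (g p) t).
Proof.
move: t; apply: tensor_ext => [t u|t u|x c].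
- by rewrite base_changeD linearD.
- by rewrite linearD base_changeD.
- by rewrite lmapE !base_changeE linearZ stalk_natural.
Qed.

Definition stalk_epi (F G : stalk_mod X) (g : stalk_hom F G) : Prop :=
  forall p y, exists x, g p x = y.

(** Flatness makes the kernel commute with - (x) A_q. Surjectivity of base
    change on the kernel is where injectivity for the target is used. *)
Lemma stalk_ker_qc (E H : stalk_mod X) (f : stalk_hom E H) : finite_space X ->
  stalk_epi f -> stalk_qc E ->
  (forall (p q : X) (pq : spec_le p q), injective (base_change (str H pq))) ->
  stalk_qc (stalk_ker f).
Proof.
move=> finX fs qcE injH p q pq; set C := restrict_scalars (ores pq) (stalk q)^o.
have fl : flat_module C by exact: finX.
have ki := proj1 (flatP _) fl _ _ (stalk_ker_inc f p) (@sincl_inj _ _ _ _).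
have [g gK Kg] := qcE p q pq.
have inj : injective (base_change (str (stalk_ker f) pq)).
  move=> t u tu; apply: ki; apply: (can_inj gK).
  by have := congr1 (stalk_ker_hom f q) tu; rewrite !base_change_nat.
have surj y : {t | base_change (str (stalk_ker f) pq) t = y}.
  apply: cid; have y0 : lmap C (f p) (g (stalk_ker_inc f q y)) = 0.
    apply: (injH p q pq); rewrite -base_change_nat Kg base_change0.
    exact: lin_kerP.
  have [t tE] := tensor_left_exact (fs p) (@lin_ker_lift _ _ _ _) y0.
  exists t; apply: (@sincl_inj _ _ _ (ker_submod (f q))).
  have tE' : base_change (str E pq) (lmap C (stalk_ker_inc f p) t) = stalk_ker_inc f q y.
    by rewrite [lmap C _ t]tE Kg.
  by rewrite -[RHS]tE'; exact: (base_change_nat (stalk_ker_hom f) t).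
exists (fun y => sval (surj y)) => [x|y]; last exact: (svalP (surj y)).
by apply: inj; exact: (svalP (surj _)).
Qed.

Section PushMaps.
Variables (V : opens X) (F : stalk_mod X).

Lemma unit_compat (p : X) (a : F p) :
  compatible ((fun i => str F (base_le (push_sub V p) i) a) : dprod (restr (push_sub V p)
    F)).
Proof. by move=> i j h; exact: str_comp. Qed.

Lemma unit_linear (p : X) : linear (fun a : F p =>
  mk_sections (unit_compat a) : push V F p).
Proof.
move=> c a a'; apply: push_ext => i.
apply: etrans _ (esym (linearP (ev (restr (push_sub V p) F) i) _ _ _)).
exact: str_semi.
Qed.

Lemma unit_natural (p q : X) (pq : spec_le p q) (a : F p) :
  lin (@unit_linear q) (str F pq a) = str (push V F) pq (lin (@unit_linear p) a).
Proof. by apply: push_ext => i; exact: str_comp. Qed.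

(** The adjunction map F -> j_* j^* F. *)
Definition push_unit : stalk_hom F (push V F) := StalkHom unit_natural.
End PushMaps.

Section Act.
Variables (x : X) (F : stalk_mod X) (m : F x).
Local Notation V := (min_open x).
Local Notation O := (stalk_O X).

Definition pt_ge (p : X) (i : pts (opensI (min_open p) V)) : spec_le x (sval i) :=
  min_open_sub (proj2 (svalP i)).
Arguments pt_ge [p] i _ _.

Lemma act_compat (p : X) (s : push V O p) :
  compatible ((fun i => (pev i s : stalk (sval i)) *: str F (pt_ge i) m)
    : dprod (restr (push_sub V p) F)).
Proof.
move=> i j h; apply: etrans (strZ _ _ _) _.
have -> : ores h (pev i s : stalk (sval i)) = pev j s.
  exact: (ev_compat (F := restr (push_sub V p) O) h s).
by congr (_ *: _); exact: str_comp.
Qed.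

Lemma act_linear (p : X) : linear (fun s : push V O p =>
  mk_sections (act_compat s) : push V F p).
Proof.
move=> a s s'; apply: push_ext => i.
apply: etrans _ (esym (linearP (ev (restr (push_sub V p) F) i) _ _ _)).
rewrite restr_scaleE.
have E : pev i (a *: s + s') = (ores (pts_sub (push_sub V p) i)
  a * (pev i s : stalk (sval i)) + (pev i s' : stalk (sval i)) : stalk (sval i)).
  exact: (linearP (ev (restr (push_sub V p) O) i)).
apply: etrans (congr1 (fun c : stalk (sval i) => c *: str F (pt_ge i) m) E) _.
by rewrite scalerDl scalerA.
Qed.

Lemma act_natural (p q : X) (pq : spec_le p q) (s : push V O p) :
  lin (@act_linear q) (str (push V O) pq s) = str (push V F) pq (lin (@act_linear p) s).
Proof.
apply: push_ext => i.
have E : str F (pt_ge i) m = str F (pt_ge (push_pt pq i)) m.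
  by congr (str _ _ _); exact: Prop_irrelevance.
exact: (congr1 (fun y => (pev i (str (push V O) pq s) : stalk (sval i)) *: y) E).
Qed.

(** The map j_* O -> j_* j^* F given by a section m of F over V = U_x. *)
Definition push_act : stalk_hom (push V O) (push V F) := StalkHom act_natural.
End Act.
End StalkModConstructions.
Arguments pt_ge {X x p} i _ _.

(** * Flat covers *)

Section FlatCover.
Variable X : finRingedSpace.
Hypothesis finX : finite_space X.
Hypothesis acyO : forall (p x : X) (W : opens X)
  (sub : opensI (min_open p) (min_open x) `<=` W), acyclic (restr sub (stalk_O X)).
Hypothesis qcO : forall x : X, stalk_qc (push (min_open x) (stalk_O X)).

Local Notation O := (stalk_O X).

Section Step.
Variables (F : stalk_mod X) (x : X).
Hypothesis qcF : stalk_qc F.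
Local Notation V := (min_open x).

(** One index set for F and for the copies of j_* O, one for each element of
    F_x, so that their sum is a single direct sum: None stands for F. *)
Definition step_summand (o : option (F x)) : stalk_mod X :=
  if o is Some _ then push V O else F.

Definition step_part (o : option (F x)) : stalk_hom (step_summand o) (push V F) :=
  match o with Some m => push_act m | None => push_unit V F end.

Definition step_sum : stalk_mod X := stalk_dsum step_summand.
(** Its kernel is the fibre product of F and j_* L~ over j_* j^* F, with L
    free on F_x (up to the sign of one component). *)
Definition step_map : stalk_hom step_sum (push V F) := stalk_dsum_out step_part.
Definition step_ob : stalk_mod X := stalk_ker step_map.

Let inj (p : X) o : {linear step_summand o p -> step_sum p} :=
  dsum_inj (fun o => step_summand o p) o.
Let pr (p : X) o : {linear step_sum p -> step_summand o p} :=
  dsum_pr (fun o => step_summand o p) o.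

Lemma step_map_inj (p : X) o y : step_map p (inj p o y) = step_part o p y.
Proof. exact: dsum_out_inj. Qed.

(** Already the copies of j_* O generate: F(U_px) is F_x (x) O(U_px) by
    mult_bij over A_x. *)
Lemma step_lift (p : X) (h : push V F p) : exists2 e, pr p None e = 0 & step_map p e = h.
Proof.
have subx : opensI (min_open p) V `<=` V by exact: subIsetr.
have [g _ Kg] := mult_bij qcF (tensor_universal_O finX acyO subx).
rewrite -(rebaseK subx h) -(Kg (rebase subx h)).
move: (g _) => t; elim/tensor_ind: t => [|t u [e e0 eE] [e' e'0 e'E]|m s].
- by exists 0; rewrite !linear0 //; apply: push_ext.
- exists (e + e'); first by rewrite linearD e0 e'0 addr0.
  rewrite linearD eE e'E; apply: push_ext => i; rewrite (linearD (mult subx F)).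
  exact: (linearD (ev (restr (push_sub V p) F) i)).
- exists (inj p (Some m) (rebase (push_sub V p) s)).
    by apply: (@dsum_prE _ _ (fun o => step_summand o p)).
  rewrite step_map_inj; apply: push_ext => i.
  apply: esym; apply: etrans (multE (F := F) m s i) _.
  have E : str F (base_le subx i) m = str F (pt_ge i) m.
    by congr (str _ _ _); exact: Prop_irrelevance.
  exact: (congr1 (fun y => (ev (restr subx O) i s : stalk (sval i)) *: y) E).
Qed.

Definition step_proj_fun (p : X) : {linear step_ob p -> F p} :=
  pr p None \o stalk_ker_inc step_map p.

Lemma step_proj_natural (p q : X) (pq : spec_le p q) y :
  step_proj_fun q (str step_ob pq y) = str F pq (step_proj_fun p y).
Proof. by []. Qed.

Definition step_proj : stalk_hom step_ob F := StalkHom step_proj_natural.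

Lemma step_proj_epi : stalk_epi step_proj.
Proof.
move=> p y; have [e e0 eE] := step_lift (- step_map p (inj p None y)).
have k0 : step_map p (inj p None y + e) = 0 by rewrite linearD eE subrr.
have [k kE] := lin_ker_lift k0; exists k.
rewrite -[LHS]/(pr p None (stalk_ker_inc step_map p k))
  [stalk_ker_inc _ _ _]kE linearD e0 addr0.
exact: (@dsum_prK _ _ (fun o => step_summand o p) None y).
Qed.

Lemma step_map_epi : stalk_epi step_map.
Proof. by move=> p h; have [e _ eE] := step_lift h; exists e. Qed.

Lemma step_qc : stalk_qc step_ob.
Proof.
apply: stalk_ker_qc => //; first exact: step_map_epi.
- by apply: stalk_dsum_qc => -[m|] //=.
- by move=> p q pq; exact: push_base_change_inj.
Qed.

Lemma flat_push_O (p : X) : flat_at (push V O) p.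
Proof. by have [] := tensor_universal_O finX acyO (push_sub V p). Qed.

Lemma flat_push (p : X) : flat_at F p -> flat_at (push V F) p.
Proof.
move=> fF; have mb := mult_bij qcF (tensor_universal_O finX acyO (push_sub V p)).
have [+ _] := flat_iso mb; apply; apply: flat_tensor => //.
exact: flat_push_O.
Qed.

(** The kernel of a surjection between flat modules; F(U_px) is flat as it is
    F_p (x) O(U_px). *)
Lemma step_flat_at (p : X) : flat_at F p -> flat_at step_ob p.
Proof.
move=> fF; apply: (flat_ker (f := stalk_ker_inc step_map p) (g := step_map p)).
- exact: sincl_inj.
- exact: step_map_epi.
- by move=> y; exact: lin_kerP.
- by move=> y; exact: lin_ker_lift.
- exact: flat_push.
- apply: flat_dsum (@dsum_is_dsum _ _ (fun o => step_summand o p)) _ => -[m|] //=.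
  exact: flat_push_O.
Qed.

Lemma unit_bij : bijective (push_unit V F x).
Proof.
have xx : oset (opensI (min_open x) V) x by split; exact: min_open_refl.
exists (fun s : push V F x => pev (exist _ x xx) s : F x) => [a|s]; first exact: str_id.
apply: push_ext => -[z h].
have xz : spec_le x z by exact: min_open_sub (proj2 h).
apply: etrans (ev_compat (F := restr (push_sub V x) F) (i := exist _ x xx) (j :=
  exist _ z h) xz s).
by congr (str _ _ _); exact: Prop_irrelevance.
Qed.

(** At x the adjunction map F_x -> F(U_xx) is bijective, so the component in F
    of an element of the kernel is determined by the others, and the kernel is
    a retract of a sum of copies of O(U_xx). *)
Lemma step_flat_new : flat_at step_ob x.
Proof.
have [u uK Ku] := unit_bij.
have ul : linear u by exact: can2_linear uK Ku.
pose D := dsum (fun _ : F x => push V O x).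
have flatD : flat_module D.
  by apply: flat_dsum (@dsum_is_dsum _ _ _) _ => _; exact: flat_push_O.
pose i0 : {linear step_sum x -> D} := dsum_out (F := fun o => step_summand o x)
  (fun o => match o return {linear step_summand o x -> D} with
    | Some m => dsum_inj (fun _ : F x => push V O x) m | None => \0 end).
pose k : {linear D -> step_sum x} := dsum_out (F := fun _ : F x => push V O x)
  (fun m => inj x (Some m)).
have dec e : e = inj x None (pr x None e) + k (i0 e).
  apply: esym; move: e; apply: (@dsum_out_ext _ _ (fun o => step_summand o x)) => //.
  - by move=> y z; rewrite !linearD addrACA.
  - move=> [m|] y.
    + rewrite /i0 dsum_out_inj /k dsum_out_inj /pr /inj dsum_prE //.
      by rewrite linear0 add0r.
    + rewrite /i0 dsum_out_inj /pr /inj dsum_prK.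
      by rewrite [X in k X](_ : _ = 0) // linear0 addr0.
(* the component in F is recovered through the inverse u of the adjunction
   map at x *)
pose r0 : {linear D -> step_sum x} := k \- (inj x None \o (lin ul \o (step_map x \o k))).
have r0k d : step_map x (r0 d) = 0.
  rewrite -[r0 d]/(k d - inj x None (u (step_map x (k d)))) linearB step_map_inj.
  by rewrite -[X in _ - X]/(push_unit V F x (u (step_map x (k d)))) Ku subrr.
pose r := lin_corestrict (ker_submod (step_map x)) r0k.
apply: (@flat_retract _ _ _ (i0 \o stalk_ker_inc step_map x) r) => // y.
apply: (@sincl_inj _ _ _ (ker_submod (step_map x))).
have y0 := lin_kerP y; set e := sincl _ y in y0 *.
rewrite -[LHS]/(k (i0 e) - inj x None (u (step_map x (k (i0 e))))).
have -> : step_map x (k (i0 e)) = - push_unit V F x (pr x None e).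
  (* the equation of the kernel, solved for the component in F *)
  have E := y0; rewrite (dec e) linearD step_map_inj in E.
  by apply/eqP; rewrite -addr_eq0 addrC; apply/eqP.
have uN a : u (- push_unit V F x a) = - a by rewrite -linearN uK.
by rewrite uN (linearN (inj x None)) opprK [RHS](dec e) addrC.
Qed.
End Step.

Lemma id_natural (F : stalk_mod X) (p q : X) (pq : spec_le p q) (a : F p) :
  (idfun : {linear F q -> F q}) (str F pq a) = str F pq ((idfun : {linear F p -> F p}) a).
Proof. by []. Qed.
Definition stalk_hom_id (F : stalk_mod X) : stalk_hom F F := StalkHom (@id_natural F).

Lemma comp_natural (F G H : stalk_mod X) (g : stalk_hom G H) (f : stalk_hom F G) (p q : X)
  (pq : spec_le p q) (a : F p) : (g q \o f q) (str F pq a) = str H pq ((g p \o f p) a).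
Proof. by rewrite /= !stalk_natural. Qed.
Definition stalk_hom_comp (F G H : stalk_mod X) (g : stalk_hom G H) (f : stalk_hom F G)
  : stalk_hom F H :=
  StalkHom (comp_natural g f).

Lemma flat_cover_on (s : seq {classic X}) (F : stalk_mod X) : stalk_qc F ->
  exists (P : stalk_mod X) (h : stalk_hom P F),
    [/\ stalk_qc P, stalk_epi h & forall p : X, (p : {classic X}) \in s -> flat_at P p].
Proof.
elim: s => [|x s IH] qcF.
  by exists F, (stalk_hom_id F); split=> // p y; exists y.
have [P [h [qcP hs flP]]] := IH qcF.
exists (step_ob P x), (stalk_hom_comp h (step_proj P x)); split.
- exact: step_qc.
- move=> p y; have [z <-] := hs p y; have [w <-] := step_proj_epi x qcP z.
  by exists w.
- move=> p; rewrite inE => /predU1P[->|ps]; first exact: step_flat_new.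
  by apply: step_flat_at => //; exact: flP.
Qed.

Theorem flat_cover (F : stalk_mod X) : stalk_qc F ->
  exists (P : stalk_mod X) (h : stalk_hom P F),
  [/\ stalk_qc P, stalk_epi h & forall p : X, flat_at P p].
Proof.
move=> qcF; have [s sX] := finite_points X.
have [P [h [qcP hs flP]]] := flat_cover_on s qcF.
by exists P, h; split=> // p; exact: flP.
Qed.
End FlatCover.

(** * From stalks to sheaves, and resolutions *)

Section Sheafify.
Variable X : finRingedSpace.

Lemma bij_of_comp (A B C : Type) (g : B -> C) (f : A -> B) :
  bijective g -> bijective (g \o f) -> bijective f.
Proof.
case=> g' gK Kg [h hK Kh]; exists (h \o g) => [a|b]; first exact: hK.
by apply: (can_inj gK); exact: Kh.
Qed.

Section Transfer.
Variables (G F : stalk_mod X) (g : stalk_hom G F).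
Hypothesis g_bij : forall p, bijective (g p).

(** Used for the map from the stalks of the sheaf attached to F to F, which is
    bijective without being an identity. *)
Lemma qc_transfer : stalk_qc F -> stalk_qc G.
Proof.
move=> qcF p q pq; apply: (bij_of_comp (g_bij q)).
apply: (@eq_bij _ _ (base_change (str F pq) \o lmap _ (g p))).
  by apply: bij_comp; [exact: qcF | exact: lmap_bij].
by move=> t; rewrite /= -(base_change_nat g).
Qed.

Lemma flat_transfer p : flat_at F p -> flat_at G p.
Proof. by have [_ +] := flat_iso (g_bij p). Qed.
End Transfer.

Section Sheaf.
Variable F : stalk_mod X.

Definition sh_sec (W : opens X) : lmodType (osec X W) := sections_on (@subset_refl _ W) F.

Definition sh_at (W : opens X) (x : sh_sec W) (p : X) (Wp : oset W p) : F p :=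
  ev (restr (@subset_refl _ W) F) (exist _ p Wp) x.

Lemma sh_ext (W : opens X) (x y : sh_sec W) :
  (forall p (Wp : oset W p), sh_at x Wp = sh_at y Wp) -> x = y.
Proof.
move=> E; apply: (@sections_ext _ _ _ (restr (@subset_refl _ W) F)) => -[p Wp].
exact: E.
Qed.

Lemma sh_irr (W : opens X) (x : sh_sec W) p (h h' : oset W p) : sh_at x h = sh_at x h'.
Proof. by rewrite (Prop_irrelevance h h'). Qed.

Lemma sh_str (W : opens X) (x : sh_sec W) p q (pq : spec_le p q) (Wp : oset W p)
  (Wq : oset W q) : str F pq (sh_at x Wp) = sh_at x Wq.
Proof.
exact: (ev_compat (F := restr (@subset_refl _ W) F) (i := exist _ p Wp) (j :=
  exist _ q Wq) pq x).
Qed.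

Lemma sh_mk_compat (W : opens X) (e : forall p, oset W p -> F p)
  (ec : forall p q (pq : spec_le p q) (Wp : oset W p) (Wq : oset W q),
    str F pq (e p Wp) = e q Wq) :
  compatible ((fun i : pts W => e (sval i) (proj2_sig i))
    : dprod (restr (@subset_refl _ W) F)).
Proof. by move=> i j h; exact: ec. Qed.

Definition sh_mk (W : opens X) (e : forall p, oset W p -> F p) ec : sh_sec W :=
  mk_sections (@sh_mk_compat W e ec).

Lemma sh_lin (W : opens X) (a : osec X W) (x y : sh_sec W) p (Wp : oset W p) :
  sh_at (a *: x + y) Wp = ores (min_open_sub Wp) a *: sh_at x Wp + sh_at y Wp.
Proof.
rewrite [LHS](linearP (ev (restr (@subset_refl _ W) F) (exist _ p Wp))).
have E : ores (pts_sub (@subset_refl _ W) (exist _ p Wp)) a = ores (min_open_sub Wp) a.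
  by congr (ores _ _); exact: Prop_irrelevance.
exact: (congr1 (fun c : stalk p => c *: sh_at x Wp + sh_at y Wp) E).
Qed.

Section Res.
Variables (U V : opens X) (sVU : V `<=` U).

Definition sh_res (x : sh_sec U) : sh_sec V :=
  @sh_mk V (fun p Vp => sh_at x (sVU Vp))
    (fun p q pq Vp Vq => sh_str x pq (sVU Vp) (sVU Vq)).

Lemma sh_res_linear : linear_for (ores sVU \; *:%R) sh_res.
Proof.
move=> a x y; apply: sh_ext => p Vp.
apply: etrans (sh_lin a x y (sVU Vp)) _.
apply: etrans _ (esym (sh_lin (ores sVU a) (sh_res x) (sh_res y) Vp)).
congr (_ *: _ + _); apply: esym; exact: ores_comp.
Qed.

Definition sh_mres : {linear sh_sec U -> sh_sec V | ores sVU \; *:%R} := slin sh_res_linear.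
End Res.

Lemma sh_mres_id (U : opens X) (sUU : U `<=` U) x : sh_mres sUU x = x.
Proof. by apply: sh_ext => p Up; exact: (sh_irr x (sUU p Up) Up). Qed.
Lemma sh_mres_comp (U V W : opens X) (sVU : V `<=` U) (sWV : W `<=` V)
  (sWU : W `<=` U) x : sh_mres sWV (sh_mres sVU x) = sh_mres sWU x.
Proof. by apply: sh_ext => p Wp; exact: (sh_irr x (sVU p (sWV p Wp)) (sWU p Wp)). Qed.

Lemma sh_sheaf : sheaf_axiom (fun U V (sVU : V `<=` U) => sh_mres sVU).
Proof.
move=> U I W sWU s cov comp.
have sE i j p (Wip : oset (W i) p) (Wjp : oset (W j) p) : sh_at (s i) Wip = sh_at (s j) Wjp.
  have Wijp : oset (opensI (W i) (W j)) p by split.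
  have E : sh_at (s i) (proj1 Wijp) = sh_at (s j) (proj2 Wijp).
    apply: etrans (sh_irr (s i) _ (subIsetl Wijp)) _.
    apply: etrans (congr1 (fun u => sh_at u Wijp) (comp i j)) _.
    exact: (sh_irr (s j) (subIsetr Wijp)).
  exact: etrans (sh_irr (s i) _ _) (etrans E (sh_irr (s j) _ _)).
have pick p : oset U p -> {i | oset (W i) p}.
  by move=> Up; apply: cid; have [i _ Wip] := cov p Up; exists i.
pose g p Up := sh_at (s (sval (pick p Up))) (proj2_sig (pick p Up)).
have gc p q (pq : spec_le p q) Up Uq : str F pq (g p Up) = g q Uq.
  have Wq : oset (W (sval (pick p Up))) q.
    apply: min_open_sub (proj2_sig (pick p Up)) _ _.
    exact/spec_leP.
  by rewrite /g (sh_str _ pq _ Wq); exact: sE.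
exists (sh_mk gc); split=> [i|t tE].
  by apply: sh_ext => p Wip; exact: sE.
apply: sh_ext => p Up; rewrite -[LHS]/(g p Up) /g.
set i := sval _; set Wip := proj2_sig _.
by rewrite -(tE i); exact: (sh_irr t (sWU i p Wip) Up).
Qed.

Definition sheafify : omodule X := @OModule X sh_sec (fun U V sVU => sh_mres sVU)
  sh_mres_id sh_mres_comp sh_sheaf.

Definition sh_stalk_fun (p : X) (x : stalks sheafify p) : F p :=
  sh_at (x : sh_sec _) (@min_open_refl X p).

Lemma sh_stalk_linear p : linear (@sh_stalk_fun p).
Proof.
move=> a x y; rewrite /sh_stalk_fun sh_lin; congr (_ *: _ + _).
exact: ores_id.
Qed.

Lemma sh_stalk_natural (p q : X) (pq : spec_le p q) x :
  lin (@sh_stalk_linear q) (str (stalks sheafify) pq x) =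
    str F pq (lin (@sh_stalk_linear p) x).
Proof. by apply: esym; exact: (sh_str (x : sh_sec _)). Qed.

Definition sh_stalk : stalk_hom (stalks sheafify) F := StalkHom sh_stalk_natural.

Lemma sh_stalk_bij p : bijective (sh_stalk p).
Proof.
have gc a q r (qr : spec_le q r) (pq : oset (min_open p) q) (pr : oset (min_open p) r) :
    str F qr (str F (min_open_sub pq) a) = str F (min_open_sub pr) a by exact: str_comp.
exists (fun a => sh_mk (gc a) : stalks sheafify p) => [s|a]; last exact: str_id.
by apply: sh_ext => q pq; exact: sh_str.
Qed.

Lemma sheafify_qc : stalk_qc F -> quasi_coherent sheafify.
Proof. exact: (qc_transfer sh_stalk_bij). Qed.

Lemma sheafify_flat : (forall p, flat_at F p) -> flat_omodule sheafify.
Proof. by move=> fF p; exact: (flat_transfer sh_stalk_bij). Qed.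
End Sheaf.

Section Maps.
Variables (F G : stalk_mod X) (g : stalk_hom F G).

Lemma sh_map_compat (W : opens X) (x : sh_sec F W) p q (pq : spec_le p q)
  (Wp : oset W p) (Wq : oset W q) : str G pq (g p (sh_at x Wp)) = g q (sh_at x Wq).
Proof. by rewrite -stalk_natural (sh_str _ _ _ Wq). Qed.

Lemma sh_map_linear (W : opens X) :
  linear (fun x : sh_sec F W => sh_mk (sh_map_compat x)).
Proof.
move=> a x y; apply: sh_ext => p Wp; apply: etrans _ (esym (sh_lin _ _ _ _)).
by rewrite -[LHS]/(g p (sh_at (a *: x + y) Wp)) sh_lin linearP.
Qed.

Lemma sh_map_res (U V : opens X) (sVU : V `<=` U) (x : sh_sec F U) :
  lin (@sh_map_linear V) (sh_res sVU x) = sh_res sVU (lin (@sh_map_linear U) x).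
Proof. by apply: sh_ext => p Vp. Qed.

Definition sh_map : ohom (sheafify F) (sheafify G) :=
  @OHom X (sheafify F) (sheafify G) (fun W => lin (@sh_map_linear W)) sh_map_res.

Lemma sh_map_stalk (p : X) (x : stalks (sheafify F) p) :
  sh_stalk G p (sh_map (min_open p) x) = g p (sh_stalk F p x).
Proof. by []. Qed.
End Maps.

Section Augmentation.
Variables (F : stalk_mod X) (M : omodule X) (g : stalk_hom F (stalks M)).

(** The stalkwise values g p (x_p) form a compatible family of germs of M,
    hence glue. *)
Lemma aug_ex (W : opens X) (x : sh_sec F W) :
  {t : msec M W | forall p (Wp : oset W p), mres M (min_open_sub Wp) t = g p (sh_at x Wp)}.
Proof.
apply: cid.
have [|t [tE _]] := @sheaf_glue X (msec M) (fun U V sVU => mres M sVU) (@mres_comp X M)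
  (@mres_sheaf X M) W (fun p Wp => g p (sh_at x Wp)); last by exists t.
by move=> p q pq Wp Wq; exact: (sh_map_compat g).
Qed.

Lemma mres_semi (U V : opens X) (sVU : V `<=` U) a (x y : msec M U) :
  mres M sVU (a *: x + y) = ores sVU a *: mres M sVU x + mres M sVU y.
Proof. by rewrite linearP. Qed.

Lemma aug_linear (W : opens X) : linear (fun x : sh_sec F W => sval (aug_ex x)).
Proof.
move=> a x y.
apply: (@sheaf_local X (msec M) (fun U V sVU => mres M sVU) (@mres_comp X M)
  (@mres_sheaf X M)) => p Wp.
rewrite (svalP (aug_ex (a *: x + y))) mres_semi (svalP (aug_ex x)) (svalP (aug_ex y)).
by rewrite sh_lin linearP.
Qed.

Lemma aug_res (U V : opens X) (sVU : V `<=` U) (x : sh_sec F U) :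
  sval (aug_ex (sh_res sVU x)) = mres M sVU (sval (aug_ex x)).
Proof.
apply: (@sheaf_local X (msec M) (fun U V sVU => mres M sVU) (@mres_comp X M)
  (@mres_sheaf X M)) => p Vp.
rewrite (svalP (aug_ex (sh_res sVU x))) (mres_comp _ _ (min_open_sub (sVU p Vp))).
by rewrite (svalP (aug_ex x)).
Qed.

Definition aug : ohom (sheafify F) M :=
  @OHom X (sheafify F) M (fun W => lin (@aug_linear W)) aug_res.

Lemma aug_stalk (p : X) (x : stalks (sheafify F) p) :
  aug (min_open p) x = g p (sh_stalk F p x).
Proof.
have := svalP (aug_ex (x : sh_sec F (min_open p))) p (@min_open_refl X p).
by rewrite mres_id.
Qed.
End Augmentation.

Definition stalk_exact (F G H : stalk_mod X) (f : stalk_hom F G) (g : stalk_hom G H)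
  : Prop :=
  forall p y, g p y = 0 <-> exists x, f p x = y.

Lemma sh_map_exact (F G H : stalk_mod X) (f : stalk_hom F G) (g : stalk_hom G H) :
  stalk_exact f g -> ohom_exact (sh_map f) (sh_map g).
Proof.
move=> ex p y; have inj K := bij_inj (sh_stalk_bij K p).
have [h hK Kh] := sh_stalk_bij F p.
have [e1 e2] := ex p (sh_stalk G p y); split=> [y0|[x <-]].
  have [|x xE] := e1; first by rewrite -sh_map_stalk y0 linear0.
  by exists (h x); apply: (inj G); rewrite sh_map_stalk Kh.
apply: (inj H); rewrite linear0 2!sh_map_stalk.
by apply: (proj2 (ex p _)); exists (sh_stalk F p x).
Qed.

Lemma aug_exact (F G : stalk_mod X) (M : omodule X) (f : stalk_hom F G)
  (g : stalk_hom G (stalks M)) :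
  stalk_exact f g -> ohom_exact (sh_map f) (aug g).
Proof.
move=> ex p y; have inj K := bij_inj (sh_stalk_bij K p).
have [h hK Kh] := sh_stalk_bij F p.
have [e1 e2] := ex p (sh_stalk G p y); split=> [y0|[x <-]].
  have [|x xE] := e1; first by rewrite -aug_stalk y0.
  by exists (h x); apply: (inj G); rewrite sh_map_stalk Kh.
rewrite aug_stalk sh_map_stalk.
by apply: (proj2 (ex p _)); exists (sh_stalk F p x).
Qed.

Lemma aug_epi (F : stalk_mod X) (M : omodule X) (g : stalk_hom F (stalks M)) :
  stalk_epi g -> ohom_epi (aug g).
Proof.
move=> gs p y; have [x xE] := gs p y.
have [h hK Kh] := sh_stalk_bij F p.
by exists (h x); rewrite aug_stalk Kh.
Qed.

Section Resolve.
Hypothesis finX : finite_space X.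
Hypothesis enough : forall F : stalk_mod X, stalk_qc F ->
  exists (P : stalk_mod X) (h : stalk_hom P F),
  [/\ stalk_qc P, stalk_epi h & forall p : X, flat_at P p].

(** A flat cover as data, so that it can be chosen and the syzygies defined by
    iteration. *)
Record flat_epi (F : stalk_mod X) := FlatEpi {
  fe_ob : stalk_mod X;
  fe_hom : stalk_hom fe_ob F;
  fe_qc : stalk_qc fe_ob;
  fe_epi : stalk_epi fe_hom;
  fe_flat : forall p : X, flat_at fe_ob p
}.

Lemma flat_epi_ex F : stalk_qc F -> inhabited (flat_epi F).
Proof. by move=> /enough[P [h [? ? ?]]]; split; exact: (@FlatEpi F P h). Qed.

Definition qc_ob : Type := {F : stalk_mod X | stalk_qc F}.

Lemma pick_flat_epi (F : qc_ob) : flat_epi (sval F).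
Proof.
suff /cid[] : exists _ : flat_epi (sval F), True by [].
by have [e] := flat_epi_ex (svalP F); exists e.
Qed.

Lemma syzygy_qc (F : qc_ob) : stalk_qc (stalk_ker (fe_hom (pick_flat_epi F))).
Proof.
apply: stalk_ker_qc => //; first exact: fe_epi.
  exact: fe_qc.
by move=> p q pq; apply: bij_inj; exact: (svalP F).
Qed.

Definition syzygy (F : qc_ob) : qc_ob := exist _ _ (syzygy_qc F).

Definition syz (F : qc_ob) (n : nat) : qc_ob := iter n syzygy F.
Definition syz_cover (F : qc_ob) n : stalk_mod X := fe_ob (pick_flat_epi (syz F n)).
Definition syz_diff (F : qc_ob) n : stalk_hom (syz_cover F n.+1) (syz_cover F n) :=
  stalk_hom_comp (stalk_ker_hom (fe_hom (pick_flat_epi (syz F n))))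
    (fe_hom (pick_flat_epi (syz F n.+1))).

Lemma syz_diff_im (F : qc_ob) n p y :
  fe_hom (pick_flat_epi (syz F n)) p y = 0 <-> exists x, syz_diff F n p x = y.
Proof.
split=> [y0|[x <-]]; last exact: lin_kerP.
have [k kE] := lin_ker_lift y0.
have [x xE] := fe_epi (pick_flat_epi (syz F n.+1)) (k : sval (syz F n.+1) p); exists x.
by rewrite -kE -xE.
Qed.

Lemma syz_exact (F : qc_ob) n : stalk_exact (syz_diff F n.+1) (syz_diff F n).
Proof.
move=> p y; rewrite -syz_diff_im; split=> [y0|y0].
  by apply: (@sincl_inj _ _ _ (ker_submod (fe_hom (pick_flat_epi (syz F n)) p)));
    rewrite linear0.
rewrite -[LHS]/(stalk_ker_inc _ p (fe_hom (pick_flat_epi (syz F n.+1)) p y)).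
by rewrite y0 linear0.
Qed.

Lemma flat_resolution (M : omodule X) : quasi_coherent M ->
  exists P : resolution M,
    forall n : nat, quasi_coherent (res_obj P n) /\ flat_omodule (res_obj P n).
Proof.
move=> qcM; pose F : qc_ob := exist _ (stalks M) qcM.
exists (@Resolution X M (fun n => sheafify (syz_cover F n)) (fun n => sh_map (syz_diff F n))
  (aug (fe_hom (pick_flat_epi F))) (aug_epi (fe_epi (pick_flat_epi F)))
  (aug_exact (f := syz_diff F 0) (@syz_diff_im F 0)) (fun n =>
    sh_map_exact (@syz_exact F n))) => n.
split; first by apply: sheafify_qc; exact: fe_qc.
by apply: sheafify_flat; exact: fe_flat.
Qed.
End Resolve.
End Sheafify.

(** * Cohomology of the fibres of the diagonal *)

Section DiagonalHypotheses.
Variable X : finRingedSpace.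
Local Notation O := (stalk_O X).

Lemma prod_spec_le (p q x y : X) : spec_le p q -> spec_le x y ->
  @spec_le (prod_top X X) (p, x) (q, y).
Proof.
move=> /spec_leP pq /spec_leP xy; apply/spec_leP => W [oW Wpx].
have : nbhs ((p, x) : prod_top X X) W by exact: open_nbhs_nbhs.
case=> -[A B] /= [nA nB] AB; apply: AB; split=> /=.
- move: nA; rewrite nbhsE => -[A' [oA' A'p]]; apply.
  exact: pq _ (conj oA' A'p).
- move: nB; rewrite nbhsE => -[B' [oB' B'x]]; apply.
  exact: xy _ (conj oB' B'x).
Qed.

Definition diag_open (p x : X) : opens X :=
  opreim (rfun_continuous (diagonal X)) (@min_open (prod_top X X) (p, x)).

(** The preimage of the smallest neighbourhood of (p, x) under the diagonal is
    U_px. *)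
Lemma diag_openE (p x : X) : diag_open p x = opensI (min_open p) (min_open x).
Proof.
apply: opens_ext; apply/seteqP; split=> z.
- move=> /(proj2 (spec_leP (X := prod_top X X) (p, x) (z, z))) le.
  by split; apply/spec_leP; [exact: spec_le_fst le | exact: spec_le_snd le].
- move=> [/spec_leP pz /spec_leP xz].
  by apply/(spec_leP (X := prod_top X X) (p, x) (z, z)); exact: prod_spec_le.
Qed.

Section Chains.
Variables (W U : opens X) (sub : U `<=` W).

Definition to_tchain n (c : chain U n) : tchain (@pts_le X U) n :=
  @Tchain _ _ n (fun i => exist _ (c i) (chain_in c i) : pts U) (fun i j ij =>
    @chain_le X U n c i j ij).

Definition of_tchain n (c : tchain (@pts_le X U) n) : chain U n :=
  @Chain X U n (fun i => sval (c i)) (fun i => svalP (c i)) (fun i j ij =>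
    @tpt_le _ _ n c i j ij).

Lemma of_tchainK n (c : tchain (@pts_le X U) n) : to_tchain (of_tchain c) = c.
Proof. by apply: tchain_ext => i; exact: pts_ext. Qed.

Lemma to_tchain_face n (k : 'I_n.+2) (c : chain U n.+1) :
  tface k (to_tchain c) = to_tchain (face k c).
Proof. by apply: tchain_ext => i; exact: pts_ext. Qed.

Lemma of_tchain_face n (k : 'I_n.+2) (c : tchain (@pts_le X U) n.+1) :
  face k (of_tchain c) = of_tchain (tface k c).
Proof. by congr Chain; apply: Prop_irrelevance. Qed.

Lemma restr_sign (i : pts U) (k : nat) (x : restr sub O i) :
  (-1) ^+ k *: x = ((-1) ^+ k : stalk (sval i)) *: (x : O (sval i)).
Proof. by rewrite restr_scaleE rmorphXn rmorphN1. Qed.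

Lemma mres_at n (s : cochain (structure_module X) U n) c c' (j : X)
  (h : spec_le (chain_last c) j) (h' : spec_le (chain_last c') j) : c = c' ->
  mres (structure_module X) h (s c) = mres (structure_module X) h' (s c').
Proof. by move=> E; case: _ / E in h' *; rewrite (Prop_irrelevance h h'). Qed.

(** The two complexes agree up to the presentation of chains in U, as points
    of X lying in U or as points of the subspace U. *)
Lemma cohomology_acyclic :
  (forall n, cohomology_zero (structure_module X) U n.+1) -> acyclic (restr sub O).
Proof.
move=> H n s s0.
pose s' : cochain (structure_module X) U n.+1 := fun c => s (to_tchain c).
have s'0 c : coboundary s' c = 0.
  apply: etrans _ (s0 (to_tchain c)); apply: eq_bigr => k _.
  apply: etrans _ (esym (restr_sign _ _)).
  have E := dtr_at (F := restr sub O) s (c := tface k (to_tchain c)) (c' :=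
    to_tchain (face k c))
    (j := tlast (to_tchain c)) (tface_last_le k (to_tchain c))
      (@face_last_le X U n.+1 k c) (to_tchain_face k c).
  exact: (congr1 (fun y : O (chain_last c) => (-1) ^+ k *: y) (esym E)).
have [t' t'E] := H n s' s'0.
pose t : tcochain (restr sub O) n := fun c => t' (of_tchain c).
exists t => c.
have E : cob t c = coboundary t' (of_tchain c).
  apply: eq_bigr => k _; apply: etrans (restr_sign _ _) _.
  have E := mres_at t' (c := of_tchain (tface k c)) (c' := face k (of_tchain c))
    (j := sval (tlast c)) (tface_last_le k c) (@face_last_le X U n k (of_tchain c))
    (esym (of_tchain_face k c)).
  exact: (congr1 (fun y : O (sval (tlast c)) => (-1) ^+ k *: y) E).
rewrite E t'E.
have r : pts_le (tlast (to_tchain (of_tchain c))) (tlast c) by exact: spec_le_refl.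
have E2 := dtr_at (F := restr sub O) s r (@pts_le_refl X U (tlast c)) (of_tchainK c).
have E3 := @dtr_id _ _ _ (restr sub O) _ (@pts_le_refl X U (tlast c)) (s c).
apply: etrans _ (etrans E2 E3).
by apply: esym; exact: (@str_id X O (sval (tlast c)) r).
Qed.
End Chains.

Section FromSemiSeparated.
Hypothesis sepX : semi_separated X.

Lemma semi_separated_acyclic (p x : X) (W : opens X)
  (sub : opensI (min_open p) (min_open x) `<=` W) : acyclic (restr sub O).
Proof.
apply: cohomology_acyclic => n; rewrite -diag_openE.
exact: (proj2 sepX n.+1 (ltn0Sn n) (p, x)).
Qed.

End FromSemiSeparated.
End DiagonalHypotheses.

(** * The direct image of the structure sheaf under the diagonal *)

Lemma bij_of_comp_r (A B C : Type) (g : B -> C) (f : A -> B) :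
  bijective f -> bijective (g \o f) -> bijective g.
Proof.
case=> f' fK Kf [h hK Kh]; exists (f \o h) => [b|c]; last exact: Kh.
by rewrite -(Kf b) /=; congr f; exact: hK.
Qed.

Section TensorReg.
Variables (A B C : comPzRingType) (phi : {rmorphism A -> B}) (psi : {rmorphism A -> C}).
Implicit Types (b : B) (c : C).

Lemma tens_to_regMz b c (n : int) :
  tens (to_reg phi (b *~ n)) (to_reg psi c) = tens (to_reg phi b) (to_reg psi (c *~ n)).
Proof. by rewrite !to_regMz tensMzl tensMzr. Qed.
Lemma tens_to_reg0 c : tens (to_reg phi 0) (to_reg psi c) = 0.
Proof. by rewrite to_reg0 tens0l. Qed.
Lemma tens_to_regDl b b' c : tens (to_reg phi (b + b')) (to_reg psi c) =
  tens (to_reg phi b) (to_reg psi c) + tens (to_reg phi b') (to_reg psi c).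
Proof. by rewrite to_regD tensDl. Qed.
Lemma tens_to_regDr b c c' : tens (to_reg phi b) (to_reg psi (c + c')) =
  tens (to_reg phi b) (to_reg psi c) + tens (to_reg phi b) (to_reg psi c').
Proof. by rewrite to_regD tensDr. Qed.
Lemma tens_to_regZ a b c :
  tens (to_reg phi (phi a * b)) (to_reg psi c) =
    tens (to_reg phi b) (to_reg psi (psi a * c)).
Proof. by rewrite !to_regZ tensZ. Qed.
End TensorReg.

Section RingSquare.
Variables (A B C E : comPzRingType).
Variables (phi : {rmorphism A -> B}) (gam : {rmorphism A -> C}).
Variables (psi : {rmorphism B -> E}) (lam : {rmorphism C -> E}).
Hypothesis square : forall a, psi (phi a) = lam (gam a).

Local Notation D := (restrict_scalars psi E^o).

Definition square_fun (c : restrict_scalars gam C^o) : restrict_scalars phi D :=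
  to_restr phi (to_reg psi (lam (of_reg c))).

Lemma square_linear : linear square_fun.
Proof.
move=> a c c'; rewrite /square_fun of_regP rmorphD rmorphM -square.
by rewrite to_regD to_regZ to_restrP.
Qed.

Definition square_lin : {linear restrict_scalars gam C^o -> restrict_scalars phi D} :=
  lin square_linear.

Variable inv : E -> tensor (restrict_scalars phi B^o) (restrict_scalars gam C^o).
Hypothesis invD : {morph inv : s t / s + t}.
Hypothesis invE : forall b c, inv (psi b * lam c) = tens (to_reg phi b) (to_reg gam c).
Hypothesis generated : forall e, exists s : seq (B * C),
  e = \sum_(bc <- s) psi bc.1 * lam bc.2.

(** A criterion for E to be B (x)_A C: it is generated by products, and b (x)
    c can be recovered from psi b * lam c. *)
Lemma square_po_bij : bijective (po_map square_lin).
Proof.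
pose out (d : restrict_scalars phi D) : E := of_reg (of_restr d).
have poE b c : out (po_map square_lin (tens (to_reg phi b) (to_reg gam c))) = psi b * lam c.
  by rewrite po_mapE.
have outD : {morph out : s t / s + t} by [].
have outK : injective out by [].
have invK : cancel (po_map square_lin) (inv \o out).
  apply: tensor_ext => [t u|t u|b c] //; first by rewrite linearD /= outD invD.
  by rewrite -(of_regK b) -(of_regK c) /= poE invE.
exists (inv \o out) => // d; apply: outK; rewrite /=.
have [s ->] := generated (out d).
suff [t <-] : exists t, out (po_map square_lin t) = \sum_(bc <- s) psi bc.1 * lam bc.2.
  by have /= -> := invK t.
elim: s => [|bc s [t tE]]; first by exists 0; rewrite big_nil linear0.
exists (tens (to_reg phi bc.1) (to_reg gam bc.2) + t).
by rewrite big_cons linearD outD poE tE.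
Qed.
End RingSquare.

Section ProductGerms.
Variable X : finRingedSpace.
Local Notation PX := (prod_space X X).

Lemma min_open_fst (z v : PX) : oset (min_open z) v -> spec_le z.1 v.1.
Proof. by move=> h; apply: spec_le_fst; apply/spec_leP. Qed.
Lemma min_open_snd (z v : PX) : oset (min_open z) v -> spec_le z.2 v.2.
Proof. by move=> h; apply: spec_le_snd; apply/spec_leP. Qed.

Section At.
Variables p x : X.
Let z : PX := (p, x).

Let fst_le (v : PX) (h : oset (min_open z) v) : spec_le p v.1 := min_open_fst h.
Let snd_le (v : PX) (h : oset (min_open z) v) : spec_le x v.2 := min_open_snd h.

Lemma lgerm_compat (a : stalk p) (u v : PX) (uv : spec_le u v)
  (hu : oset (min_open z) u) (hv : oset (min_open z) v) :
  prod_tr uv (rtens (ores (fst_le hu) a) 1) = rtens (ores (fst_le hv) a) 1.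
Proof. by rewrite prod_trE rmorph1; congr rtens; exact: ores_comp. Qed.

Lemma rgerm_compat (a : stalk x) (u v : PX) (uv : spec_le u v)
  (hu : oset (min_open z) u) (hv : oset (min_open z) v) :
  prod_tr uv (rtens 1 (ores (snd_le hu) a)) = rtens 1 (ores (snd_le hv) a).
Proof. by rewrite prod_trE rmorph1; congr rtens; exact: ores_comp. Qed.

Definition lgerm_fun (a : stalk p) : stalk (X := PX) z := Germs (lgerm_compat a).
Definition rgerm_fun (a : stalk x) : stalk (X := PX) z := Germs (rgerm_compat a).

Lemma lgerm_zmod : zmod_morphism lgerm_fun.
Proof.
move=> a b; apply: germs_ext => v h.
exact: (raddfB (@rtensl (stalk v.1) (stalk v.2) \o ores (fst_le h))).
Qed.
Lemma lgerm_monoid : monoid_morphism lgerm_fun.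
Proof.
split=> [|a b]; apply: germs_ext => v h.
  exact: (rmorph1 (@rtensl (stalk v.1) (stalk v.2) \o ores (fst_le h))).
exact: (rmorphM (@rtensl (stalk v.1) (stalk v.2) \o ores (fst_le h))).
Qed.
Lemma rgerm_zmod : zmod_morphism rgerm_fun.
Proof.
move=> a b; apply: germs_ext => v h.
exact: (raddfB (@rtensr (stalk v.1) (stalk v.2) \o ores (snd_le h))).
Qed.
Lemma rgerm_monoid : monoid_morphism rgerm_fun.
Proof.
split=> [|a b]; apply: germs_ext => v h.
  exact: (rmorph1 (@rtensr (stalk v.1) (stalk v.2) \o ores (snd_le h))).
exact: (rmorphM (@rtensr (stalk v.1) (stalk v.2) \o ores (snd_le h))).
Qed.

Definition lgerm : {rmorphism stalk p -> stalk (X := PX) z} :=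
  HB.pack lgerm_fun (GRing.isZmodMorphism.Build _ _ lgerm_fun lgerm_zmod)
    (GRing.isMonoidMorphism.Build _ _ lgerm_fun lgerm_monoid).
Definition rgerm : {rmorphism stalk x -> stalk (X := PX) z} :=
  HB.pack rgerm_fun (GRing.isZmodMorphism.Build _ _ rgerm_fun rgerm_zmod)
    (GRing.isMonoidMorphism.Build _ _ rgerm_fun rgerm_monoid).

Definition germ_at (s : stalk (X := PX) z) : prod_stalk z := germ s (@min_open_refl _ z).

(** The inverse of germ_at, which shows that each germ at (p, x) is a
    combination of products of germs from the two factors. *)
Definition germ_gen : {rmorphism prod_stalk z -> stalk (X := PX) z} :=
  tensor_ring_lift lgerm rgerm.

Lemma germ_genE a b : germ_gen (rtens a b) = lgerm a * rgerm b.
Proof. exact: tensor_ring_liftE. Qed.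

Lemma germ_at_tens a b : germ_at (lgerm a * rgerm b) = rtens a b.
Proof.
rewrite -[LHS]/(rtens (ores _ a) 1 * rtens 1 (ores _ b)) rtensM mulr1 mul1r.
by rewrite !ores_id.
Qed.

Lemma germ_atD s t : germ_at (s + t) = germ_at s + germ_at t.
Proof. by []. Qed.

Lemma germ_at_gen u : germ_at (germ_gen u) = u.
Proof.
elim/tensor_ring_ind: u => [|u v IHu IHv|a b]; first by rewrite rmorph0.
  by rewrite rmorphD germ_atD IHu IHv.
by rewrite germ_genE germ_at_tens.
Qed.

Lemma germ_at_inj : injective germ_at.
Proof.
have b := @germ_stalk_bij (prod_top X X) (@prod_stalk X X) (@prod_tr X X) z
  (fun q => @prod_tr_id X X q) (fun q r t => @prod_tr_comp X X q r t).
exact: (bij_inj b).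
Qed.

Lemma germ_gen_at s : germ_gen (germ_at s) = s.
Proof. by apply: germ_at_inj; rewrite germ_at_gen. Qed.
End At.

Section Base.
Variables (p q x : X) (pq : spec_le p q).
Let z : PX := (p, x).
Let w : PX := (q, x).
Let zw : @spec_le (prod_top X X) z w := prod_spec_le pq (@spec_le_refl X x).

Lemma lgerm_res (a : stalk p) : @ores PX _ _ zw (lgerm p x a) = lgerm q x (ores pq a).
Proof.
by apply: germs_ext => v h; rewrite /=; congr rtens; apply: esym; exact: ores_comp.
Qed.
Lemma rgerm_res (b : stalk x) : @ores PX _ _ zw (rgerm p x b) = rgerm q x b.
Proof.
by apply: germs_ext => v h; rewrite /=; congr rtens; congr (ores _ _);
  exact: Prop_irrelevance.
Qed.

Definition lgerm_lin := square_lin lgerm_res.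

(** The inverse of the base change map sends the germ c (x) b at (q, x) to (1
    (x) b) (x) c. *)
Lemma lam0_balanced : balanced (fun (c : zmodule (stalk q)) (b : zmodule (stalk x)) =>
  tens (to_reg (lgerm p x) (rgerm p x b)) (to_reg (ores pq) c)).
Proof.
split=> [b c c'|c b b'|n c b].
- exact: tens_to_regDr.
- by rewrite rmorphD; exact: tens_to_regDl.
- have MZ (c' : stalk q) (b' : stalk x) :
      tens (to_reg (lgerm p x) (rgerm p x b')) (to_reg (ores pq) (c' *~ n)) =
      tens (to_reg (lgerm p x) (rgerm p x (b' *~ n))) (to_reg (ores pq) c').
    by rewrite (rmorphMz (rgerm p x)); apply: esym; exact: tens_to_regMz.
  exact: MZ.
Qed.

(** The stalk A_q (x)_Z A_x of the product at (q, x) is the base change to A_q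
    of the stalk A_p (x)_Z A_x at (p, x). Hence quasi-coherence along the
    first factor only involves - (x)_{A_p} A_q. *)
Lemma prod_po_bij : bijective (po_map lgerm_lin).
Proof.
pose lam (u : prod_stalk w) := tensor_lift (fun (c : zmodule (stalk q))
  (b : zmodule (stalk x)) =>
  tens (to_reg (lgerm p x) (rgerm p x b)) (to_reg (ores pq) c)) u.
have lamD u v : lam (u + v) = lam u + lam v by exact: (tensor_liftD lam0_balanced).
have lam_0 : lam 0 = 0 by apply: (addrI (lam 0)); rewrite -lamD !addr0.
have lamE (c : stalk q) (b : stalk x) : lam (rtens c b) =
    tens (to_reg (lgerm p x) (rgerm p x b)) (to_reg (ores pq) c).
  exact: (tensor_liftE lam0_balanced).
apply: (@square_po_bij _ _ _ _ _ _ _ _ lgerm_res (fun t => lam (germ_at t))) => [t u|r c|t].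
- by rewrite germ_atD lamD.
- rewrite -(germ_gen_at r); move: (germ_at r) => u.
  elim/tensor_ring_ind: u => [|u v IHu IHv|a b].
  + by rewrite !rmorph0 mul0r [RHS]tens_to_reg0; exact: lam_0.
  + by rewrite !rmorphD mulrDl germ_atD lamD IHu IHv [RHS]tens_to_regDl.
  + rewrite germ_genE rmorphM lgerm_res rgerm_res mulrAC -rmorphM germ_at_tens lamE.
    by rewrite [RHS]tens_to_regZ.
- rewrite -(germ_gen_at t); move: (germ_at t) => u.
  elim/tensor_ring_ind: u => [|u v [s IHs] [s' IHs']|c b].
  + by exists [::]; rewrite rmorph0 big_nil.
  + by exists (s ++ s'); rewrite rmorphD IHs IHs' big_cat.
  + by exists [:: (rgerm p x b, c)]; rewrite big_seq1 rgerm_res germ_genE mulrC.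
Qed.
End Base.

Section Theta.
Variable x : X.
Local Notation V := (min_open x).
Local Notation O := (stalk_O X).
Local Notation PF := (pushforward (diagonal X) (structure_module X)).

Section AtPoint.
Variable p : X.
Let z : PX := (p, x).

Lemma theta_in (i : pts (opensI (min_open p) V)) : oset (diag_open p x) (sval i).
Proof. by rewrite diag_openE; exact: (svalP i). Qed.

Lemma theta_compat (m : osec X (diag_open p x)) : compatible
  ((fun i => ores (min_open_sub (theta_in i)) m) : dprod (restr (push_sub V p) O)).
Proof. by move=> i j h; exact: ores_comp. Qed.

Definition push_section (m : mstalk PF z) : osec X (diag_open p x) := m.

Lemma push_sectionP (s : stalk (X := PX) z) (m m' : mstalk PF z) :
  push_section (s *: m + m') =
  rcomorph (diagonal X) (@min_open (prod_top X X) z) s * push_section m + push_section m'.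
Proof. by []. Qed.

Local Notation PFp := (restrict_scalars (lgerm p x) (mstalk PF z)).

(** The identification of the stalk at (p, x) of the direct image of O under
    the diagonal with O(U_px). *)
Definition theta_fun (m : PFp) : push V O p :=
  mk_sections (theta_compat (push_section (of_restr m))).

Lemma pev_theta (m : PFp) i : pev i (theta_fun m) =
  ores (min_open_sub (theta_in i)) (push_section (of_restr m)).
Proof. by []. Qed.

(** The comorphism of the diagonal multiplies the two factors, and so sends a
    (x) 1 to the restriction of a. *)
Lemma rcomorph_lgerm (a : stalk p) (i : pts (opensI (min_open p) V)) :
  @ores X (diag_open p x) _ (min_open_sub (theta_in i))
    (rcomorph (diagonal X) (@min_open (prod_top X X) z) (lgerm p x a)) =
  ores (base_le (push_sub V p) i) a.
Proof.
apply: etrans (@diag_comorphE X (@min_open (prod_top X X) z) (lgerm p x a)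
  _ (theta_in i)) _.
apply: etrans (diag_multE _ _) _; rewrite mulr1.
by congr (ores _ _); exact: Prop_irrelevance.
Qed.

Lemma theta_linear : linear theta_fun.
Proof.
move=> a m m'; apply: push_ext => i.
apply: etrans _ (esym (linearP (ev (restr (push_sub V p) O) i) _ _ _)).
apply: etrans (pev_theta _ _) _.
rewrite of_restrP push_sectionP rmorphD rmorphM rcomorph_lgerm.
by [].
Qed.

Definition theta : {linear PFp -> push V O p} := lin theta_linear.

Lemma thetaE m : theta m = theta_fun m. Proof. by []. Qed.

Lemma theta_bij : bijective theta.
Proof.
have inj : injective theta.
  move=> m m' E; apply: (can_inj (@of_restrK _ _ _ _)).
  suff : push_section (of_restr m) = push_section (of_restr m') by [].
  apply: (@sheaf_local X _ (fun U V sVU => ores sVU) (@ores_comp X) (@ores_sheaf X)) =>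
    y Dy.
  have Vy : oset (opensI (min_open p) V) y by rewrite -diag_openE.
  have := congr1 (pev (exist _ y Vy)) E.
  rewrite !thetaE !pev_theta.
  by rewrite (Prop_irrelevance (min_open_sub (theta_in (exist _ y Vy))) (min_open_sub Dy)).
have surj s : {m | theta m = s}.
  apply: cid.
  have toV y : oset (diag_open p x) y -> oset (opensI (min_open p) V)
    y by rewrite diag_openE.
  have [|t [tE _]] := @sheaf_glue X _ (fun U V sVU =>
    ores sVU) (@ores_comp X) (@ores_sheaf X)
    (diag_open p x) (fun y Dy => pev (exist _ y (toV y Dy)) s : stalk y).
    move=> y y' yy' Dy Dy'.
    exact: (ev_compat (F := restr (push_sub V p) O) (i := exist _ y (toV y Dy))
      (j := exist _ y' (toV y' Dy')) yy' s).
  exists (to_restr (lgerm p x) (t : mstalk PF z)); apply: push_ext => -[y Vy].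
  rewrite thetaE pev_theta to_restrK.
  by apply: etrans (tE y (theta_in (exist _ y Vy))) _;
    exact: (pev_at s (toV y (theta_in (exist _ y Vy))) Vy).
exists (fun s => sval (surj s)) => [m|s]; last exact: (svalP (surj s)).
by apply: inj; exact: (svalP (surj _)).
Qed.
End AtPoint.

(** The base change map for O(U_px) along p <= q is, up to theta, that of the
    direct image under the diagonal along (p, x) <= (q, x), composed with the
    bijection of pushout_bij. *)
Lemma push_O_qc : quasi_coherent PF -> stalk_qc (push V O).
Proof.
move=> qcD p q pq.
pose z : PX := (p, x); pose w : PX := (q, x).
pose zw : @spec_le (prod_top X X) z w := prod_spec_le pq (@spec_le_refl X x).
have pb := pushout_bij (prod_po_bij x pq) (mstalk PF z).
have mb : bijective (base_change (mres PF zw)) := qcD z w zw.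
pose pN := po_N (lgerm_lin x pq) (mstalk PF z).
pose be t := to_restr (lgerm q x) (base_change (mres PF zw) (of_restr (pN t))).
have bb : bijective be.
  have rb : bijective (@of_restr _ _ (lgerm p x) (tensor (mstalk PF z)
    (restrict_scalars (@ores PX _ _ zw) (stalk (X := PX) w)^o))).
    by exists (to_restr _); [exact: of_restrK | exact: to_restrK].
  have cb := bij_comp mb (bij_comp rb pb).
  apply: (@bij_comp _ _ _ (to_restr (lgerm q x)) _ _ cb).
  by exists (@of_restr _ _ _ _); [exact: to_restrK | exact: of_restrK].
apply: (bij_of_comp_r (lmap_bij (restrict_scalars (ores pq) (stalk q)^o) (theta_bij p))).
apply: (@eq_bij _ _ (theta q \o be)); first exact: bij_comp (theta_bij q) bb.
have tD : {morph (fun t => theta q (be t)) : t u / t + u}.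
  move=> t u; rewrite -linearD; congr (theta q _).
  rewrite /be (linearD pN) of_restrD.
  by rewrite base_changeD to_restrD.
pose L t := base_change (str (push V O) pq)
  (lmap (restrict_scalars (ores pq) (stalk q)^o) (theta p) t).
have LD : {morph L : t u / t + u} by move=> t u; rewrite /L linearD base_changeD.
apply: (tensor_ext tD LD) => m c.
rewrite /L lmapE base_changeE thetaE.
have -> : be (tens m c) =
    to_restr (lgerm q x) ((lgerm q x c : stalk (X := PX) w) *: mres PF zw (of_restr m)).
  by rewrite /be /pN po_NE; congr (to_restr _ _); exact: base_changeE.
apply: push_ext => i; rewrite pev_theta to_restrK.
apply: etrans _ (esym (linearZ_LR (ev (restr (push_sub V q) O) i) (c : stalk q)
  (str (push V O) pq (theta p m)))).
rewrite -[_ *: _]addr0 push_sectionP rmorphD rmorphM rcomorph_lgerm.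
rewrite [X in _ + X](rmorph0 (ores _)) addr0.
congr (_ * _).
exact: ores_comp.
Qed.
End Theta.
End ProductGerms.

Theorem theorem3p6 (X : finRingedSpace)
    (finX : finite_space X) (sepX : semi_separated X)
    (M : omodule X) (qcM : quasi_coherent M) :
  exists P : resolution M,
    forall n : nat, quasi_coherent (res_obj P n) /\ flat_omodule (res_obj P n).
Proof.
apply: flat_resolution => // F.
apply: flat_cover => // [p x W sub|x]; first exact: semi_separated_acyclic.
by apply: push_O_qc; exact: (proj1 sepX).
Qed.
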